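(* Let $\alpha>0$ and $0<r_1<r_2$, and let $A_{r_1,r_2}=B_{r_2}\setminus\overline{B}_{r_1}\subset\mathbb{R}^2$, where $B_r$ is the open disc of radius $r$ centred at the origin. Let $V_1$ be the vector field on $\partial A_{r_1,r_2}$ given by $V_1(x)=\nu(x)$ if $|x|=r_2$ and $V_1(x)=0$ otherwise (i.e. if $|x|=r_1$), where $\nu$ is the unit outward normal of $\partial A_{r_1,r_2}$. Then $$d\lambda_1\left(A_{r_1,r_2},V_1\right)>0.$$ In particular, if $r_2<\tilde r_2$, then $$\lambda_1\left(A_{r_1,r_2}\right)<\lambda_1\left(A_{r_1,\tilde r_2}\right).$$
   Context: For a bounded open set $\Omega\subset\mathbb{R}^2$ with smooth boundary and a fixed parameter $\alpha>0$, $\lambda_1(\Omega)$ denotes the first (smallest) eigenvalue of the Robin problem with negative boundary parameter $$-\Delta u=\lambda u \ \text{ in } \Omega,\qquad \frac{\partial u}{\partial \nu}=\alpha u\ \text{ on } \partial\Omega,$$ where $\nu$ is the unit outward normal, i.e. $$\lambda_1(\Omega)=\inf_{v\in H^1(\Omega)\setminus\{0\}}\frac{\int_\Omega|\nabla v|^2\,dx-\alpha\int_{\partial\Omega}v^2\,d\sigma}{\int_\Omega v^2\,dx}.$$ For a smooth vector field $V$ defined on $\partial\Omega$, $d\lambda_1(\Omega,V)$ denotes the shape derivative of $\lambda_1$ at $\Omega$ in the direction $V$, that is $$d\lambda_1(\Omega,V)=\left.\frac{d}{dt}\right|_{t=0}\lambda_1(\Omega_t),\qquad \Omega_t=(\mathrm{Id}+t\hat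 V)(\Omega),$$ where $\hat V$ is any smooth extension of $V$ to $\mathbb{R}^2$. It is given by the classical Hadamard formula $$d\lambda_1(\Omega,V)=\int_{\partial\Omega}\left(|\nabla u_1|^2-\lambda_1(\Omega)u_1^2-2\alpha^2u_1^2-\alpha H u_1^2\right)(V\cdot\nu)\,d\sigma,$$ where $u_1$ is the positive eigenfunction associated with $\lambda_1(\Omega)$, normalized by $\int_\Omega u_1^2\,dx=1$, and $H$ is the (signed) curvature of $\partial\Omega$ with respect to the outward normal (so for $\Omega=A_{r_1,r_2}$, $H=1/r_2$ on $|x|=r_2$ and $H=-1/r_1$ on $|x|=r_1$). *)

(* Defs.v *)
From HB Require Import structures.
From mathcomp Require Import all_boot all_order all_algebra.
From mathcomp Require Import all_classical all_reals all_analysis.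

Set Implicit Arguments.
Unset Strict Implicit.
Unset Printing Implicit Defensive.

Import Order.TTheory GRing.Theory Num.Theory.
Import numFieldNormedType.Exports.

Local Open Scope classical_set_scope.
Local Open Scope ring_scope.

(* The plane is [R * R]. Its library norm is the sup norm: it gives the right *)
(* topology, but every metric quantity below is taken in the Euclidean norm.  *)

Section RobinShape.
Variable R : realType.

Local Notation plane := (R * R)%type.
(* The same type, carrying the Borel sigma-algebra for which the library's     *)
(* Lebesgue measure is declared.                                              *)
Local Notation mplane := (measurableTypeR R * measurableTypeR R)%type.
Implicit Types (Omega A : set plane) (x : plane).

Definition dotp (x y : plane) : R := x.1 * y.1 + x.2 * y.2.
Definition enorm x : R := Num.sqrt (dotp x x).

Definition ebdry A : set plane := closure A `\` interior A.

Definition partial1 (f : plane -> R) x : R := 'D_((1 : R), (0 : R)) f x.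
Definition partial2 (f : plane -> R) x : R := 'D_((0 : R), (1 : R)) f x.
Definition grad (f : plane -> R) x : plane := (partial1 f x, partial2 f x).

Fixpoint Ck (k : nat) (f : plane -> R) : Prop :=
  continuous f /\
  if k is k'.+1 then
    [/\ (forall x, derivable f x ((1 : R), (0 : R))),
        (forall x, derivable f x ((0 : R), (1 : R))),
        Ck k' (partial1 f) & Ck k' (partial2 f)]
  else True.

Definition smooth (f : plane -> R) : Prop := forall k, Ck k f.
Definition smooth_field (V : plane -> plane) : Prop :=
  smooth (fun x => (V x).1) /\ smooth (fun x => (V x).2).

Definition area : {measure set mplane -> \bar R} :=
  (@lebesgue_measure R \x @lebesgue_measure R)%E.

(* [0] is added to the supremum so that the empty set has diameter [0]. *)
Definition ediam A : \bar R :=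
  ereal_sup (0%E |` [set (enorm (p.1 - p.2))%:E | p in A `*` A]).

(* One-dimensional Hausdorff (outer) measure. It is kept as a set function:   *)
(* the library integral evaluates it on Borel sets only, where it is a        *)
(* measure, so that [\int[arclength]_(x in ebdry Omega)] is integration with  *)
(* respect to arc length on a smooth boundary.                                *)
Definition arclength_delta (delta : R) A : \bar R :=
  ereal_inf [set (\sum_(0 <= k <oo) ediam (U k))%E | U in
    [set U : (set plane)^nat | A `<=` \bigcup_k U k /\
       forall k, (ediam (U k) <= delta%:E)%E]].

Definition arclength A : \bar R :=
  ereal_sup [set arclength_delta delta A | delta in [set delta : R | 0 < delta]].

Definition sqint (mu : set mplane -> \bar R) (A : set mplane) (f : mplane -> R) : \bar R :=
  (\int[mu]_(x in A) ((f x) ^+ 2)%:E)%E.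

Definition L2 (mu : set mplane -> \bar R) (A : set mplane) (f : mplane -> R) : Prop :=
  measurable_fun A f /\ (sqint mu A f < +oo)%E.

Definition L2_cvg (mu : set mplane -> \bar R) (A : set mplane)
    (f_ : nat -> mplane -> R) (f : mplane -> R) : Prop :=
  sqint mu A (fun x => f_ n x - f x) @[n --> \oo] --> (0%E : \bar R).

Definition test_function Omega (phi : plane -> R) : Prop :=
  [/\ smooth phi,
      compact (closure [set x | phi x != 0]) &
      closure [set x | phi x != 0] `<=` Omega].

(* H^1(Omega) is presented by pairs of a function and its weak gradient. *)
Definition H1 Omega (v : plane -> R) (g : plane -> plane) : Prop :=
  [/\ L2 area Omega v,
      L2 area Omega (fun x => (g x).1),
      L2 area Omega (fun x => (g x).2) &
      forall phi, test_function Omega phi ->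
        (\int[area]_(x in (Omega : set mplane)) (v x * partial1 phi x)%:E =
          - \int[area]_(x in (Omega : set mplane)) ((g x).1 * phi x)%:E)%E /\
        (\int[area]_(x in (Omega : set mplane)) (v x * partial2 phi x)%:E =
          - \int[area]_(x in (Omega : set mplane)) ((g x).2 * phi x)%:E)%E].

(* [w] is the trace of [v] on the boundary: the trace operator is the         *)
(* continuous extension to H^1(Omega) of the restriction to the boundary,     *)
(* defined on functions that are C^1 up to the boundary.                      *)
Definition trace Omega (v : plane -> R) (g : plane -> plane) (w : plane -> R)
    : Prop :=
  L2 arclength (ebdry Omega) w /\
  exists phi_ : nat -> plane -> R,
    [/\ forall n, Ck 1 (phi_ n),
        L2_cvg area Omega phi_ v,
        L2_cvg area Omega (fun n => partial1 (phi_ n)) (fun x => (g x).1),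
        L2_cvg area Omega (fun n => partial2 (phi_ n)) (fun x => (g x).2) &
        L2_cvg arclength (ebdry Omega) phi_ w].

Definition robin_quotient (alpha : R) Omega
    (v : plane -> R) (g : plane -> plane) (w : plane -> R) : R :=
  (fine (\int[area]_(x in (Omega : set mplane)) (dotp (g x) (g x))%:E)%E
     - alpha * fine (sqint arclength (ebdry Omega) w))
  / fine (sqint area Omega v).

(* First eigenvalue of [- Laplacian u = lambda u] in [Omega] with             *)
(* [du/dnu = alpha u] on the boundary. *)
Definition robin_lambda1 (alpha : R) Omega : \bar R :=
  ereal_inf [set q : \bar R | exists v g w,
    [/\ H1 Omega v g, trace Omega v g w, sqint area Omega v != 0%E &
        q = (robin_quotient alpha Omega v g w)%:E]].

(* [n] is the unit outward normal of [Omega] at [x]: [Omega] is, near the     *)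
(* boundary point [x], the sublevel set [rho < 0] of a smooth function with   *)
(* nonvanishing gradient at [x], and [n] is its normalized gradient.          *)
Definition outward_normal Omega x (n : plane) : Prop :=
  ebdry Omega x /\
  exists rho : plane -> R,
    [/\ smooth rho,
        (\forall y \near x, Omega y <-> rho y < 0),
        grad rho x != 0 &
        n = ((partial1 rho x) / enorm (grad rho x),
             (partial2 rho x) / enorm (grad rho x))].

Definition normal Omega x : plane :=
  xget (0 : plane) [set n | outward_normal Omega x n].

Definition deform (V : plane -> plane) (t : R) Omega : set plane :=
  [set ((x.1 + t * (V x).1, x.2 + t * (V x).2) : plane) | x in Omega].

Definition smooth_extension Omega (V Vh : plane -> plane) : Prop :=
  smooth_field Vh /\ forall x, ebdry Omega x -> Vh x = V x.

(* [d] is the shape derivative of the functional [F] at [Omega] in the        *)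
(* direction of the smooth field [V] on the boundary, computed with any       *)
(* smooth extension of [V]. Only the values of [V] on the boundary matter.    *)
Definition is_shape_derivative (F : set plane -> \bar R) Omega
    (V : plane -> plane) (d : R) : Prop :=
  (exists Vh, smooth_extension Omega V Vh) /\
  forall Vh, smooth_extension Omega V Vh ->
    (\forall t \near (0 : R), F (deform Vh t Omega) \is a fin_num) /\
    is_derive (0 : R) (1 : R) (fun t : R => fine (F (deform Vh t Omega))) d.

Definition disc (r : R) : set plane := [set x | enorm x < r].
Definition annulus (r1 r2 : R) : set plane := disc r2 `\` closure (disc r1).

Definition V1 (r1 r2 : R) x : plane :=
  if enorm x == r2 then normal (annulus r1 r2) x else 0.

End RobinShape.

(* Main.v *)
Require Import Defs.
From HB Require Import structures.
From mathcomp Require Import all_boot all_order all_algebra.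
From mathcomp Require Import all_classical all_reals all_analysis.
From mathcomp Require Import measurable_realfun ring lra.

Set Implicit Arguments.
Unset Strict Implicit.
Unset Printing Implicit Defensive.

Import Order.TTheory GRing.Theory Num.Theory.
Import numFieldNormedType.Exports.

Local Open Scope classical_set_scope.
Local Open Scope ring_scope.

(** Let lambda(s) be the first eigenvalue of the ring a < |x| < s. For every
    b > a, the theorem amounts to lambda'(b) > 0, by way of two-sided bounds on
    lambda(s) for s near b that agree to first order at s = b.

    The ground state of the ring a < |x| < b is radial, u = u(r) > 0, with
    u'' + u' / r = kappa u, u' = -alpha u at a and u' = alpha u at b; it exists
    for some kappa > 0 ([exists_mode]), by a combination of modified Bessel
    functions and the intermediate value theorem in kappa.

    Two principles bound the eigenvalue. Above, any radial test function does
    ([robin_upper_bound]). Below, put f = w' / w for a positive radial function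
    w: if f' + f^2 + f / r <= K on the ring, f(a) <= -alpha and f(s) >= alpha,
    then lambda(s) >= -K ([robin_lower_bound]). Indeed, completing the square
    bounds alpha times the boundary values of v^2 at both ends of a ray by the
    integral of r (v_r^2 + K v^2) along the ray.

    Applied on the ring of outer radius s near b, the mode u of the ring of
    outer radius b yields lambda(s) <= -kappa + c(s), where
    c(s) = s u(s)^2 (u'(s) / u(s) - alpha) / N(s) and N(s) is the integral of
    r u^2 over [a, s] ([upper_estimate]). The correction
    F = u' / u - c(s) N / (r u^2) satisfies the hypotheses of the lower bound
    with K = kappa - c(s) + M c(s)^2 ([lower_estimate]). As c(b) = 0,
    lambda is differentiable at b, with
    lambda'(b) = c'(b) = b u(b)^2 (kappa - alpha^2 - alpha / b) / N(b).

    The sign comes from a comparison with the constant barrier alpha: were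
    kappa <= alpha^2 + alpha / b, then u' / u could not go from -alpha at a to
    alpha at b ([constant_barrier], [lambda1_growth]). Strict monotonicity
    follows by the mean value theorem.

    Two more ingredients give these computations a meaning. One-dimensional
    Hausdorff measure is computed on circles, where it is the length of the set
    of angles times the radius ([arclength_circles]), so that boundary integrals
    become integrals over angles; area is treated in polar coordinates
    ([area_polar]). And for any smooth extension of the field, the deformed ring
    is, for small t, exactly the ring of outer radius b + t ([deform_annulus]),
    so that the shape derivative is lambda'(b). *)

(** * One-variable inequalities *)

Section Calculus1.
Variable R : realType.
Implicit Types (f df : R -> R).

Lemma mvt_cc f df (a b : R) : a <= b ->
  (forall x, a <= x <= b -> is_derive x 1 f (df x)) ->
  exists2 c, a <= c <= b & f b - f a = df c * (b - a).
Proof.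
move=> ab H; have [||c] := @MVT_segment R f df a b ab.
- by move=> x; rewrite in_itv/= => /andP[/ltW ax /ltW xb]; apply: H; rewrite ax xb.
- apply: derivable_within_continuous => x; rewrite in_itv/= => /H Hx.
  exact: ex_derive.
- by rewrite in_itv/=; exists c.
Qed.

Lemma ndecr_cc f df (a b : R) : a <= b ->
  (forall x, a <= x <= b -> is_derive x 1 f (df x)) ->
  (forall x, a <= x <= b -> 0 <= df x) -> f a <= f b.
Proof.
move=> ab H H0; have [c cab e] := mvt_cc ab H.
by rewrite -subr_ge0 e mulr_ge0 ?subr_ge0// H0.
Qed.

Lemma incr_cc f df (a b : R) : a < b ->
  (forall x, a <= x <= b -> is_derive x 1 f (df x)) ->
  (forall x, a <= x <= b -> 0 < df x) -> f a < f b.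
Proof.
move=> ab H H0; have [c cab e] := mvt_cc (ltW ab) H.
by rewrite -subr_gt0 e mulr_gt0 ?subr_gt0// H0.
Qed.

Lemma is_derive_continuous f d (x : R) : is_derive x 1 f d -> {for x, continuous f}.
Proof. by move=> [D _]; exact/differentiable_continuous/derivable1_diffP. Qed.

Lemma continuous_of_derive f df : (forall x : R, is_derive x 1 f (df x)) -> continuous f.
Proof. by move=> D x; exact: is_derive_continuous. Qed.

Lemma continuous_sq_comp f : continuous f -> continuous (fun r : R => f (r ^+ 2)).
Proof.
move=> cf r; apply: (@continuous_comp _ _ _ (fun r : R => r ^+ 2) f); last exact: cf.
by apply: cvgM; exact: cvg_id.
Qed.

Lemma sin_le_id (x : R) : 0 <= x -> sin x <= x.
Proof.
move=> x0; have := @ndecr_cc (fun t => t - sin t) (fun t => 1 - cos t) 0 x x0.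
rewrite sin0 !subr0 subr_ge0; apply=> t _; last by rewrite subr_ge0 cos_le1.
Qed.

Lemma norm_sin_le (x : R) : `|sin x| <= `|x|.
Proof.
wlog x0 : x / 0 <= x => [H|].
  have [/H//|x0] := leP 0 x; rewrite -[X in sin X]opprK sinN normrN -(normrN x).
  by apply: H; rewrite oppr_ge0 ltW.
rewrite [leRHS]ger0_norm// ler_norml sin_le_id// andbT.
have := @ndecr_cc (fun t => t + sin t) (fun t => 1 + cos t) 0 x x0.
rewrite sin0 addr0 => H; rewrite -subr_ge0 opprK addrC; apply: H => t _.
by rewrite -lerBlDl sub0r cos_geN1.
Qed.

(** Together with [norm_sin_le] this compares an arc of circle with its chord:
    half the angle times its cosine is below the half-chord, which is below
    half the angle. *)
Lemma mul_cos_le_sin (x : R) : 0 <= x <= pi -> x * cos x <= sin x.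
Proof.
move=> /andP[x0 xpi].
have := @ndecr_cc (fun t => sin t - t * cos t) (fun t => t * sin t) 0 x x0.
rewrite sin0 mul0r subr0 subr_ge0; apply=> t /andP[t0 tx]; last first.
  by rewrite mulr_ge0// sin_ge0_pi// t0 (le_trans tx).
apply: is_derive_eq; rewrite /GRing.scale/=; lra.
Qed.

End Calculus1.

(** * Arc length as a metric outer measure *)

Section ArclengthOuter.
Variable R : realType.
Local Notation plane := (R * R)%type.
Implicit Types (A B : set plane) (x y : plane).

Lemma enorm_ge0 x : 0 <= enorm x. Proof. exact: sqrtr_ge0. Qed.

Lemma enorm_sq x : enorm x ^+ 2 = x.1 ^+ 2 + x.2 ^+ 2.
Proof.
by rewrite /enorm /dotp -!expr2 sqr_sqrtr// addr_ge0// sqr_ge0.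
Qed.

Lemma ediam_ge0 A : (0 <= ediam A)%E.
Proof. by apply: le_ereal_sup_tmp; exists 0%E => //; left. Qed.

Lemma ediam0 : @ediam R set0 = 0%E.
Proof.
apply/eqP; rewrite eq_le ediam_ge0 andbT; apply: ge_ereal_sup => z [->//|].
by move=> [p [[]]].
Qed.

Lemma ediam_le A (c : R) : 0 <= c ->
  (forall x y, A x -> A y -> enorm (x - y) <= c) -> (ediam A <= c%:E)%E.
Proof.
move=> c0 H; apply: ge_ereal_sup => z [->|]; first by rewrite lee_fin.
by move=> [p [/= p1 p2] <-]; rewrite lee_fin; exact: H.
Qed.

Lemma le_ediam A x y : A x -> A y -> ((enorm (x - y))%:E <= ediam A)%E.
Proof.
move=> Ax Ay; apply: le_ereal_sup_tmp; exists (enorm (x - y))%:E => //.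
by right; exists (x, y).
Qed.

Lemma arclength_delta_ge0 (delta : R) A : (0 <= arclength_delta delta A)%E.
Proof.
apply: le_ereal_inf_tmp => _ [U _ <-].
by apply: nneseries_ge0 => *; exact: ediam_ge0.
Qed.

Lemma arclength_delta_le (delta : R) A B : A `<=` B ->
  (arclength_delta delta A <= arclength_delta delta B)%E.
Proof.
move=> AB; apply: ereal_inf_le_tmp => _ [U [BU dU] <-].
by exists U => //; split => // x /AB /BU.
Qed.

Lemma arclength_delta_decr (d1 d2 : R) A : d1 <= d2 ->
  (arclength_delta d2 A <= arclength_delta d1 A)%E.
Proof.
move=> d12; apply: ereal_inf_le_tmp => _ [U [BU dU] <-].
exists U => //; split => // k; apply: le_trans (dU k) _.
by rewrite lee_fin.
Qed.

Lemma arclength_delta_arclength (delta : R) A : 0 < delta ->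
  (arclength_delta delta A <= arclength A)%E.
Proof. by move=> d0; apply: ereal_sup_ubound; exists delta. Qed.

Lemma arclength_ge0 A : (0 <= arclength A)%E.
Proof.
exact: le_trans (arclength_delta_ge0 1 A) (arclength_delta_arclength _ _).
Qed.

Lemma le_arclength A B : A `<=` B -> (arclength A <= arclength B)%E.
Proof.
move=> AB; apply: ge_ereal_sup => _ [d /= d0 <-].
exact: le_trans (arclength_delta_le _ AB) (arclength_delta_arclength _ _).
Qed.

(** The set [A] alone, completed by empty sets, is an admissible cover. *)
Lemma arclength_delta_one (delta : R) A : 0 < delta ->
  (ediam A <= delta%:E)%E -> (arclength_delta delta A <= ediam A)%E.
Proof.
move=> d0 Ad; apply: ge_ereal_inf.
exists (\sum_(0 <= k <oo) ediam (if k is 0%N then A else set0))%E.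
  exists (fun k => if k is 0%N then A else set0) => //; split.
    by move=> x Ax; exists 0%N.
  by case => [|k] //; rewrite ediam0 lee_fin ltW.
rewrite nneseries_recl//; last by move=> *; exact: ediam_ge0.
by rewrite eseries0 ?adde0// => -[|k]// _ _; exact: ediam0.
Qed.

(** Giving infinite size to the sets of diameter above [delta] removes the
    constraint on covers, and turns the pre-measure at scale [delta] into the
    outer measure generated by a gauge, which is countably subadditive. *)
Let gauge (delta : R) (U : set (g_sigma_algebraType [set: set plane])) : \bar R :=
  if (ediam (U : set plane) <= delta%:E)%E then ediam (U : set plane) else +oo%E.

Let arclength_deltaE (delta : R) A :
  arclength_delta delta A = mu_ext (gauge delta) A.
Proof.
apply/eqP; rewrite eq_le; apply/andP; split; last first.
  apply: ereal_inf_le_tmp => _ [U [AU dU] <-]; exists U.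
    by split => // i; apply: sub_gen_smallest.
  by apply: eq_eseriesr => i _; rewrite /gauge dU.
apply: le_ereal_inf_tmp => _ [U [_ AU] <-].
have [dU|] := pselect (forall k, ediam (U k) <= delta%:E)%E.
  apply: ereal_inf_lbound; exists U => //.
  by apply: eq_eseriesr => i _; rewrite /gauge dU.
move=> /existsNP[k /negP Uk]; rewrite [leRHS](@nneseries_pinfty _ _ _ k) ?leey//.
  by move=> n _; rewrite /gauge; case: ifP => _ //; exact: ediam_ge0.
by rewrite /gauge (negbTE Uk).
Qed.

Lemma arclength_delta_bigcup (delta : R) (F : nat -> set plane) : 0 < delta ->
  (arclength_delta delta (\bigcup_n F n)
     <= \sum_(0 <= k <oo) arclength_delta delta (F k))%E.
Proof.
move=> d0; rewrite arclength_deltaE; under eq_eseriesr do rewrite arclength_deltaE.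
apply: mu_ext_sigma_subadditive.
by move=> X; rewrite /gauge; case: ifP => _ //; exact: ediam_ge0.
Qed.

Lemma arclength_bigcup (F : nat -> set plane) :
  (arclength (\bigcup_n F n) <= \sum_(0 <= k <oo) arclength (F k))%E.
Proof.
apply: ge_ereal_sup => _ [d /= d0 <-].
apply: (le_trans (arclength_delta_bigcup _ d0)).
apply: lee_nneseries => n *; first exact: arclength_delta_ge0.
exact: arclength_delta_arclength.
Qed.

Lemma arclength_set0 : @arclength R set0 = 0%E.
Proof.
apply/eqP; rewrite eq_le arclength_ge0 andbT; apply: ge_ereal_sup => _ [d /= d0 <-].
rewrite -(ediam0); apply: arclength_delta_one => //.
by rewrite ediam0 lee_fin ltW.
Qed.

Lemma arclength_delta_setU (delta : R) A B : 0 < delta ->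
  (arclength_delta delta (A `|` B)
   <= arclength_delta delta A + arclength_delta delta B)%E.
Proof.
move=> d0; have -> : A `|` B = \bigcup_n (fun n => if n is 0%N then A else
   if n is 1%N then B else set0) n.
  rewrite eqEsubset; split => [x [Ax|Bx]|x [[|[|//]]]] /=; rewrite ?set0E//;
   by [exists 0%N|exists 1%N|left|right].
apply: le_trans (arclength_delta_bigcup _ d0) _.
have ge0 n : (0 <= arclength_delta delta (if n is 0%N then A else
   if n is 1%N then B else set0))%E by exact: arclength_delta_ge0.
rewrite (nneseries_split 0 2)//= add0n big_nat_recr//= big_nat1.
rewrite eseries0 ?adde0// => -[|[|k]] // _ _ /=.
apply/eqP; rewrite eq_le arclength_delta_ge0 andbT;
rewrite -[leRHS](ediam0); apply: arclength_delta_one => //;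
by rewrite ediam0 lee_fin ltW.
Qed.

Lemma arclength_setU A B : (arclength (A `|` B) <= arclength A + arclength B)%E.
Proof.
apply: ge_ereal_sup => _ [d /= d0 <-].
apply: (le_trans (arclength_delta_setU _ _ d0)).
by apply: leeD; exact: arclength_delta_arclength.
Qed.

(** Once the mesh is below the gap [e], no set of a cover meets both [A] and
    [B], so every cover of the union splits into a cover of [A] and a cover of
    [B]. *)
Lemma arclength_setU_separated A B (e : R) : 0 < e ->
  (forall x y, A x -> B y -> e <= enorm (x - y)) ->
  (arclength A + arclength B <= arclength (A `|` B))%E.
Proof.
move=> e0 AB.
have key (d : R) : 0 < d -> d < e ->
  (arclength_delta d A + arclength_delta d B <= arclength_delta d (A `|` B))%E.
  move=> d0 de; apply: le_ereal_inf_tmp => _ [U [ABU dU] <-].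
  pose V C k := if `[< U k `&` C !=set0 >] then U k else set0.
  have sV C k : V C k `<=` U k by rewrite /V; case: asboolP => _ x.
  have cV C : C `<=` A `|` B -> (arclength_delta d C <= \sum_(0 <= k <oo) ediam (V C k))%E.
    move=> CAB; apply: ereal_inf_lbound; exists (V C) => //; split.
      move=> x Cx; have [k _ Ukx] := ABU x (CAB x Cx); exists k => //.
      by rewrite /V asboolT//; exists x.
    move=> k; rewrite /V; case: ifP => // _.
    by rewrite ediam0 lee_fin ltW.
  have ge0 C k : (0 <= ediam (V C k))%E by exact: ediam_ge0.
  apply: le_trans (leeD (cV A _) (cV B _)) _; [by left|by right|].
  rewrite -nneseriesD//.
  apply: lee_nneseries => [i _ _|k _]; first exact: adde_ge0.
  rewrite /V; case: asboolP => [[x [Ux Ax]]|_]; case: asboolP => [[y [Uy By]]|_].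
  - exfalso; have := le_trans (le_ediam Ux Uy) (dU k).
    by rewrite lee_fin => /(le_lt_trans)/(_ de); rewrite ltNge AB.
  - by rewrite ediam0 adde0.
  - by rewrite ediam0 add0e.
  - by rewrite ediam0 adde0 ediam_ge0.
have sup_addr (c M : \bar R) (S : set (\bar R)) : (0 <= c)%E -> (exists2 z, S z & (0 <= z)%E) ->
    (forall z, S z -> (c + z <= M)%E) -> (c + ereal_sup S <= M)%E.
  case: c => [c| |]//.
    move=> _ _ H; rewrite -leeBrDl//; apply: ge_ereal_sup => y Sy.
    by rewrite leeBrDl//; exact: H.
  move=> _ [y Sy y0] /(_ _ Sy); rewrite addye; last by rewrite gt_eqF// (lt_le_trans _ y0).
  by move=> /(le_trans _); apply; exact: leey.
have ex C : exists2 y : \bar R, [set arclength_delta delta C | delta in [set delta : R | 0 < delta]] y & (0 <= y)%E.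
  by exists (arclength_delta 1 C); [exists 1 => /=|exact: arclength_delta_ge0].
apply: (@sup_addr _ _ _) => //; first exact: arclength_ge0.
move=> _ [d2 /= d20 <-]; rewrite addeC; apply: (@sup_addr _ _ _) => //.
  exact: arclength_delta_ge0.
move=> _ [d1 /= d10 <-].
pose d := Num.min (Num.min d1 d2) (e / 2).
have d0 : 0 < d by rewrite !lt_min d10 d20 divr_gt0.
have de : d < e by rewrite !gt_min; apply/orP; right; lra.
rewrite addeC; apply: le_trans (arclength_delta_arclength _ d0).
apply: le_trans (key d d0 de).
by apply: leeD; apply: arclength_delta_decr; rewrite !ge_min lexx ?orbT.
Qed.

End ArclengthOuter.

(** * Arc length of arcs of circle *)

Section HalfCircles.
Variable R : realType.
Local Notation plane := (R * R)%type.
Local Notation mu := (@lebesgue_measure R).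

Definition polar (r t : R) : plane := (r * cos t, r * sin t).

(** The open half-turn. With radii of both signs, [polar] then covers the plane
    minus the vertical axis, and the tangent is a bijection onto the line. *)
Definition angles : set R := `](- (pi / 2)), (pi / 2)[%classic.

Lemma enorm_polar_sub (r s t : R) :
  enorm (polar r s - polar r t) = 2 * (`|r| * `|sin ((s - t) / 2)|).
Proof.
rewrite /enorm; have -> : dotp (polar r s - polar r t) (polar r s - polar r t) =
    (2 * (r * sin ((s - t) / 2))) ^+ 2.
  rewrite /dotp /= !exprMn.
  set p := (s + t) / 2; set q := (s - t) / 2.
  have [-> ->] : s = p + q /\ t = p - q by rewrite /p /q; split; field.
  rewrite cosB sinB cosD sinD.
  have e1 := cos2Dsin2 p.
  transitivity (4 * r ^+ 2 * sin q ^+ 2 * (cos p ^+ 2 + sin p ^+ 2)); first by ring.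
  by rewrite e1; ring.
by rewrite sqrtr_sqr !normrM [X in X * _]ger0_norm.
Qed.

Lemma chord_le_arc (r s t : R) :
  enorm (polar r s - polar r t) <= `|r| * `|s - t|.
Proof.
rewrite enorm_polar_sub mulrCA ler_wpM2l//.
have := norm_sin_le ((s - t) / 2).
by rewrite [leRHS]normrM (@ger0_norm _ 2^-1)// => H; lra.
Qed.

(** With x half the angle between the two points, the ratio of the chord to the
    arc is sin x / x >= cos x, and cos x >= 1 - e as soon as sin x <= e. The
    cosine is nonnegative because both angles lie in the open half-turn. *)
Lemma arc_le_chord (r s t e : R) : r != 0 -> 0 < e < 1 ->
  angles s -> angles t -> enorm (polar r s - polar r t) <= 2 * `|r| * e ->
  (1 - e) * `|r| * `|s - t| <= enorm (polar r s - polar r t).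
Proof.
move=> r0 /andP[e0 e1].
wlog ts : s t / t <= s => [H Js Jt|].
  have [/H|/ltW st] := leP t s; first exact.
  have -> : enorm (polar r s - polar r t) = enorm (polar r t - polar r s).
    by rewrite !enorm_polar_sub -(opprB t s) mulNr sinN normrN.
  by rewrite -(normrN (s - t)) opprB; exact: H.
rewrite /angles /= !in_itv/= => /andP[s1 s2] /andP[t1 t2].
rewrite enorm_polar_sub; set x := (s - t) / 2.
have x0 : 0 <= x by rewrite divr_ge0// subr_ge0.
have xpi : x < pi / 2 by rewrite /x; lra.
have p0 := pi_gt0 R.
have sx0 : 0 <= sin x by apply: sin_ge0_pi; rewrite x0/=; lra.
have cx0 : 0 <= cos x by apply: cos_ge0_pihalf; rewrite ltW//=; lra.
have r0' : 0 < `|r| by rewrite normr_gt0.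
rewrite (ger0_norm sx0) (ger0_norm (_ : 0 <= s - t)) ?subr_ge0//.
rewrite mulrA -[_ * _ * e]mulrA -[2 * _ * _]mulrA ler_pM2l// ler_pM2l// => sxe.
have : x * cos x <= sin x by apply: mul_cos_le_sin; rewrite x0/=; lra.
have cx1 : cos x <= 1 by exact: cos_le1.
have cs : cos x ^+ 2 = 1 - sin x ^+ 2 by rewrite cos2sin2.
have c1e : 1 - e <= cos x by nra.
have -> : s - t = 2 * x by rewrite /x; field.
move=> H; have : (1 - e) * x <= sin x.
  by apply: le_trans H; rewrite mulrC ler_wpM2l.
move=> {}H.
rewrite (_ : (1 - e) * `|r| * (2 * x) = 2 * `|r| * ((1 - e) * x)); last by ring.
by rewrite [leRHS]mulrA ler_pM2l// mulr_gt0.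
Qed.

(** A fine cover of the arc induces a cover of [E] by intervals, the hulls of
    the sets of angles seen by each member. By [arc_le_chord] such a hull is at
    most (1 - e)^-1 times as long as the diameter of the member, divided by the
    radius. *)
Lemma arclength_polar_ge (r : R) (E : set R) : r != 0 -> measurable E ->
  E `<=` angles -> (`|r|%:E * mu E <= arclength (polar r @` E))%E.
Proof.
move=> r0 mE EJ; have r0' : 0 < `|r| by rewrite normr_gt0.
have key e : 0 < e < 1 ->
    (((1 - e) * `|r|)%:E * mu E <= arclength (polar r @` E))%E.
  move=> e01; move: (e01) => /andP[e0 e1].
  have d0 : 0 < 2 * `|r| * e by rewrite !mulr_gt0.
  apply: le_trans (arclength_delta_arclength _ d0).
  apply: le_ereal_inf_tmp => _ [U [EU dU] <-].
  have c0 : 0 < (1 - e) * `|r| by rewrite mulr_gt0// subr_gt0.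
  pose S k := [set t | angles t /\ U k (polar r t)].
  pose I k : set R := if pselect (S k !=set0) then `[inf (S k), sup (S k)]%classic else set0.
  have mI k : measurable (I k) by rewrite /I; case: pselect => Sn; [exact: measurable_itv|exact: measurable0].
  have EI : E `<=` \bigcup_k I k.
    move=> t Et; have [k _ Ut] := EU _ (imageP _ Et).
    have St : S k t by split => //; exact: EJ.
    exists k => //; rewrite /I; case: pselect => [Sn|]; last by case; exists t.
    rewrite /= in_itv/=; apply/andP; split.
      apply: ge_inf => //; exists (- (pi / 2)) => u [].
      by rewrite /angles /= in_itv/= => /andP[/ltW].
    apply: ub_le_sup => //; exists (pi / 2) => u [].
    by rewrite /angles /= in_itv/= => /andP[_ /ltW].
  have UI k : (((1 - e) * `|r|)%:E * mu (I k) <= ediam (U k))%E.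
    rewrite /I; case: pselect => [Sn|Sn]; last by rewrite measure0 mule0 ediam_ge0.
    have Dfin : ediam (U k) \is a fin_num.
      by rewrite ge0_fin_numE ?ediam_ge0// (le_lt_trans (dU k))// ltry.
    rewrite -(fineK Dfin); set D := fine _.
    have D0 : 0 <= D by rewrite fine_ge0// ediam_ge0.
    have H s t : S k s -> S k t -> s - t <= D / ((1 - e) * `|r|).
      move=> [Js Us] [Jt Ut]; rewrite ler_pdivlMr// mulrC.
      have h1 : enorm (polar r s - polar r t) <= D.
        by rewrite -lee_fin fineK//; exact: le_ediam.
      have h2 : enorm (polar r s - polar r t) <= 2 * `|r| * e.
        by rewrite -lee_fin; apply: le_trans (dU k); exact: le_ediam.
      apply: le_trans h1; apply: le_trans (arc_le_chord r0 e01 Js Jt h2).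
      by apply: ler_wpM2l; [exact: ltW|exact: ler_norm].
    rewrite lebesgue_measure_itv/= lte_fin; case: ifPn => _; last first.
      by rewrite mule0 lee_fin.
    rewrite -EFinD -EFinM lee_fin mulrC -ler_pdivlMr//.
    rewrite lerBlDr; apply: ge_sup => // s Ss.
    rewrite -lerBlDl; apply: lb_le_inf => // t St.
    by rewrite lerBlDr -lerBlDl; exact: H.
  apply: le_trans (_ : ((1 - e) * `|r|)%:E * \sum_(0 <= k <oo) mu (I k) <= _)%E.
    rewrite lee_pmul2l ?lte_fin//.
    exact: (@measure_sigma_subadditive _ _ _ mu E I).
  rewrite -nneseriesZl; last by [].
  by apply: lee_nneseries => // k _ _; rewrite mule_ge0// lee_fin ltW.
(* Both sides are finite, so e can be sent to 0 with an explicit loss d. *)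
have Efin : mu E \is a fin_num.
  rewrite ge0_fin_numE//; apply: (@le_lt_trans _ _ (mu angles)).
    by apply: le_measure => //; rewrite inE//; exact: measurable_itv.
  rewrite /angles lebesgue_measure_itv/=.
  by case: ifP => _; rewrite ?ltry// -EFinD ltry.
rewrite -(fineK Efin); set m := fine _.
have [|Afin] := leP +oo%E (arclength (polar r @` E)).
  by rewrite leye_eq => /eqP->; exact: leey.
have {}Afin : arclength (polar r @` E) \is a fin_num.
  by rewrite ge0_fin_numE ?arclength_ge0.
rewrite -(fineK Afin) -EFinM lee_fin; apply/ler_addgt0Pr => d d0.
have m0 : 0 <= m by rewrite fine_ge0.
(* The loss is e |r| m <= d; the + 1 only keeps the quotient defined. *)
pose e := Num.min (1 / 2) (d / (`|r| * m + 1)).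
have rm : 0 < `|r| * m + 1 by rewrite ltr_wpDl// mulr_ge0.
have e01 : 0 < e < 1.
  by rewrite lt_min divr_gt0//= divr_gt0//= gt_min; apply/orP; left; lra.
have := key _ e01; rewrite -(fineK Afin) -(fineK Efin) -EFinM lee_fin -/m => H.
have : e * (`|r| * m + 1) <= d by rewrite -ler_pdivlMr// /e ge_min lexx orbT.
move: e01 H => /andP[e0 _]; nra.
Qed.

(** The arc is halved until its pieces are shorter than [d]; the diameter of a
    piece is at most its length. *)
Let arclength_delta_polar_itv (d r u v : R) : 0 < d -> u <= v ->
  (arclength_delta d (polar r @` `]u, v]) <= (`|r| * (v - u))%:E)%E.
Proof.
move=> d0; suff H n : forall u v, u <= v -> `|r| * (v - u) <= 2 ^+ n * d ->
    (arclength_delta d (polar r @` `]u, v]) <= (`|r| * (v - u))%:E)%E.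
  move=> uv; pose n := (Num.trunc (`|r| * (v - u) / d)).+1; apply: (H n) => //.
  have h0 : 0 <= `|r| * (v - u) / d by rewrite divr_ge0 ?(ltW d0)// mulr_ge0// subr_ge0.
  rewrite -ler_pdivrMr//; apply: (@le_trans _ _ n%:R).
    by rewrite ltW// /n; exact: truncnS_gt.
  by rewrite -natrX ler_nat ltnW// ltn_expl.
elim: n => [|n IH] {}u {}v uv h.
  have h1 : (ediam (polar r @` `]u, v]) <= (`|r| * (v - u))%:E)%E.
    apply: ediam_le; first by rewrite mulr_ge0// subr_ge0.
    move=> _ _ [s + <-] [t + <-]; rewrite /= !in_itv/= => /andP[s1 s2] /andP[t1 t2].
    apply: le_trans (chord_le_arc _ _ _) _; rewrite ler_wpM2l// ler_norml.
    by apply/andP; split; lra.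
  apply: (le_trans _ h1); apply: arclength_delta_one => //.
  by apply: (le_trans h1); rewrite lee_fin; move: h; rewrite expr0 mul1r.
pose w := (u + v) / 2.
have uw : u <= w by rewrite /w; lra.
have wv : w <= v by rewrite /w; lra.
have -> : `]u, v]%classic = `]u, w]%classic `|` `]w, v]%classic.
  by rewrite -itv_bndbnd_setU// bnd_simp.
rewrite image_setU; apply: le_trans (arclength_delta_setU _ _ d0) _.
have -> : (`|r| * (v - u))%:E = ((`|r| * (w - u))%:E + (`|r| * (v - w))%:E)%E.
  by rewrite -EFinD -mulrDr; congr (_ * _)%:E; ring.
have hw : `|r| * (v - u) = 2 * (`|r| * (w - u)) by rewrite /w; field.
have hw' : `|r| * (v - u) = 2 * (`|r| * (v - w)) by rewrite /w; field.
rewrite exprS in h.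
by apply: leeD; apply: IH => //; nra.
Qed.

(** Lebesgue outer measure is computed with half-open intervals, whose images
    are arcs. *)
Lemma arclength_polar_le (r : R) (E : set R) : r != 0 ->
  (arclength (polar r @` E) <= `|r|%:E * mu_ext (wlength idfun) E)%E.
Proof.
move=> r0; have r0' : 0 < `|r| by rewrite normr_gt0.
rewrite -lee_pdivrMl//; apply: le_ereal_inf_tmp => _ [A [mA EA] <-].
rewrite lee_pdivrMl// -nneseriesZl; last by move=> i _; exact: wlength_ge0.
have -> : polar r @` E = \bigcup_k (polar r @` (E `&` A k)).
  rewrite -image_bigcup -setI_bigcupr; congr image.
  by apply/esym/setIidl.
apply: le_trans (arclength_bigcup _) _.
apply: lee_nneseries => [k _ _|k _]; first exact: arclength_ge0.
apply: le_trans (le_arclength _) _; first exact: (@image_subset _ _ _ _ (A k)).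
have [[u v] _ <-] := mA k; rewrite /=.
have [uv|vu] := leP u v; last first.
  have -> : `]u, v]%classic = set0 by apply: set_itv_ge; rewrite bnd_simp -leNgt ltW.
  rewrite image_set0 arclength_set0.
  by rewrite wlength0 mule0.
rewrite wlength_itv_bnd// -EFinM; apply: ge_ereal_sup => _ [d /= d0 <-].
exact: arclength_delta_polar_itv.
Qed.

Lemma arclength_polar (r : R) (E : set R) : r != 0 -> measurable E ->
  E `<=` angles -> arclength (polar r @` E) = (`|r|%:E * mu E)%E.
Proof.
move=> r0 mE EJ; apply/eqP; rewrite eq_le arclength_polar_ge// andbT.
exact: arclength_polar_le.
Qed.

End HalfCircles.
Arguments angles {R}.

(** * Arc length of two concentric circles *)

Section Circles.
Variable R : realType.
Local Notation plane := (R * R)%type.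
Local Notation mplane := (measurableTypeR R * measurableTypeR R)%type.
Local Notation mu := (@lebesgue_measure R).

Lemma angles_gt0 (t : R) : angles t -> 0 < cos t.
Proof. by rewrite /angles /= in_itv/= => ?; exact: cos_gt0_pihalf. Qed.

Lemma enorm_polar (r t : R) : enorm (polar r t) = `|r|.
Proof.
rewrite /enorm; have -> : dotp (polar r t) (polar r t) = r ^+ 2.
  rewrite /dotp /=; transitivity (r ^+ 2 * (cos t ^+ 2 + sin t ^+ 2)); first by ring.
  by rewrite cos2Dsin2 mulr1.
by rewrite sqrtr_sqr.
Qed.

(** For radii of the same sign the distance is even at least |r - r'|; for
    opposite signs the first coordinates have opposite signs and are at least c
    |r| and c |r'| in absolute value. *)
Lemma polar_separated (r r' s t c : R) : 0 <= c -> c <= cos s -> c <= cos t ->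
  c * `|r - r'| <= enorm (polar r s - polar r' t).
Proof.
move=> c0 cs ct; rewrite -(ger0_norm (enorm_ge0 _)) -[X in X * _]ger0_norm// -normrM.
rewrite -ler_sqr ?nnegrE// !real_normK ?num_real// enorm_sq /= exprMn.
have s1 := cos2Dsin2 s; have t1 := cos2Dsin2 t.
set cos_s := cos s in s1 cs *; set cos_t := cos t in t1 ct *.
set ss := sin s in s1 *; set st := sin t in t1 *.
have c1 : c ^+ 2 <= 1.
  rewrite -s1 (@le_trans _ _ (cos_s ^+ 2))// ?lerDl ?sqr_ge0//.
  by rewrite ler_sqr ?nnegrE// (le_trans c0).
have [rr|rr] := leP 0 (r * r').
  have : (r - r') ^+ 2 <= (r * cos_s - r' * cos_t) ^+ 2 + (r * ss - r' * st) ^+ 2.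
    rewrite -subr_ge0.
    have -> : (r * cos_s - r' * cos_t) ^+ 2 + (r * ss - r' * st) ^+ 2 - (r - r') ^+ 2
      = r ^+ 2 * (cos_s ^+ 2 + ss ^+ 2 - 1) + r' ^+ 2 * (cos_t ^+ 2 + st ^+ 2 - 1)
        + r * r' * ((cos_s - cos_t) ^+ 2 + (ss - st) ^+ 2)
        + r * r' * (2 - (cos_s ^+ 2 + ss ^+ 2) - (cos_t ^+ 2 + st ^+ 2)) by ring.
    rewrite s1 t1 subrr !mulr0 !add0r.
    have -> : (2 - 1 - 1 = 0 :> R) by ring.
    by rewrite mulr0 addr0 mulr_ge0// addr_ge0 ?sqr_ge0.
  apply: le_trans; rewrite -[leRHS]mul1r ler_wpM2r ?sqr_ge0//.
apply: (@le_trans _ _ ((r * cos_s - r' * cos_t) ^+ 2)); last by rewrite lerDl sqr_ge0.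
have [r0|r0] := leP 0 r.
  have r'0 : r' <= 0 by nra.
  rewrite -exprMn ler_sqr ?nnegrE ?mulr_ge0//; first by nra.
    by rewrite subr_ge0; lra.
  by nra.
have r'0 : 0 <= r' by nra.
rewrite -exprMn -sqrrN -[leRHS]sqrrN ler_sqr ?nnegrE; first by nra.
  by rewrite -mulrN mulr_ge0// opprB subr_ge0; lra.
by nra.
Qed.

Lemma measurable_polar (r : R) :
  measurable_fun [set: measurableTypeR R] (polar r : _ -> mplane).
Proof.
apply: measurable_fun_pair; apply: continuous_measurable_fun => x.
  by apply: cvgM; [exact: cvg_cst|exact: continuous_cos].
by apply: cvgM; [exact: cvg_cst|exact: continuous_sin].
Qed.

(** The angle is asin (x.2 / rho), up to the sign of the radius when x.1 <
    0. *)
Lemma circle_polar (rho : R) (x : plane) : 0 < rho -> enorm x = rho -> x.1 != 0 ->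
  exists2 t, angles t & x = polar rho t \/ x = polar (- rho) t.
Proof.
move=> rho0 xrho x1.
have e : x.1 ^+ 2 + x.2 ^+ 2 = rho ^+ 2 by rewrite -enorm_sq xrho.
wlog x10 : x x1 e {xrho} / 0 < x.1 => [H|].
  have [/H|x0|x0] := ltgtP 0 x.1; [exact| |by rewrite -x0 eqxx in x1].
  have [||/=|t Jt xt] := H (- x.1, - x.2); rewrite /= ?oppr_eq0// ?oppr_gt0//.
    by rewrite !sqrrN.
  exists t => //; case: xt => -[e1 e2]; [right|left].
    by rewrite /polar !mulNr -e1 -e2 !opprK -surjective_pairing.
  by rewrite [LHS]surjective_pairing /polar; congr pair; lra.
pose y := x.2 / rho.
have y1 : `|y| < 1.
  rewrite normrM normfV (gtr0_norm rho0) ltr_pdivrMr// mul1r -ltr_sqr ?nnegrE// ?ltW//.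
  by rewrite real_normK ?num_real// -e ltrDr exprn_gt0.
move: (y1); rewrite ltr_norml => /andP[yN1 yP1].
exists (asin y).
  by rewrite /angles /= in_itv/= asin_gtNpi2 ?asin_ltpi2 ?yN1 ?yP1 ?(ltW yN1) ?(ltW yP1).
left; rewrite /polar asinK ?in_itv/= ?(ltW yN1) ?(ltW yP1)//.
rewrite cos_asin ?(ltW yN1) ?(ltW yP1)// [LHS]surjective_pairing; congr pair; last first.
  by rewrite /y mulrC divfK// gt_eqF.
rewrite -[rho in RHS](ger0_norm (ltW rho0)) -sqrtr_sqr -sqrtrM ?sqr_ge0//.
have -> : rho ^+ 2 * (1 - y ^+ 2) = x.1 ^+ 2.
  by rewrite /y -[RHS](addrK (x.2 ^+ 2)) e; field; rewrite gt_eqF.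
by rewrite sqrtr_sqr gtr0_norm.
Qed.

Definition circles (a b : R) : set plane := [set x | enorm x = a \/ enorm x = b].

Lemma arclength_set1 (x : plane) : arclength [set x] = 0%E.
Proof.
have d0 : (ediam [set x] <= 0%:E)%E.
  apply: ediam_le => // _ _ -> ->; rewrite subrr /enorm /dotp /= mulr0 addr0 sqrtr0//.
apply/eqP; rewrite eq_le arclength_ge0 andbT; apply: ge_ereal_sup => _ [d /= d1 <-].
apply: (le_trans (arclength_delta_one d1 _)) => //.
by apply: (le_trans d0); rewrite lee_fin ltW.
Qed.

Lemma arclength_polar_imageI (r : R) (B : set mplane) : r != 0 -> measurable B ->
  forall E : set R, measurable E -> E `<=` angles ->
  arclength (B `&` polar r @` E) = (`|r|%:E * mu (E `&` polar r @^-1` B))%E.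
Proof.
move=> r0 mB E mE EJ.
have -> : B `&` polar r @` E = polar r @` (E `&` polar r @^-1` B).
  rewrite eqEsubset; split=> [x [Bx [t Et tx]]|_ [t [Et Bt] <-]].
    by exists t => //; split => //; rewrite /= tx.
  by split => //; exists t.
apply: arclength_polar => //; last by move=> t [/EJ].
apply: measurableI => //; rewrite -[X in measurable X]setTI.
exact: measurable_polar.
Qed.

Lemma measurable_angles : measurable (@angles R : set (measurableTypeR R)).
Proof. exact: measurable_itv. Qed.

(** The image of |r| dt under [polar r], with the half-turn as set of angles: a
    genuine measure that agrees with arc length on the subsets of a
    half-circle. *)
Definition half_circle (r : R) : {measure set mplane -> \bar R} :=
  mscale `|r|%:nng
    (measure_function_pushforward__canonical__measure_function_Measure
      (mrestr mu measurable_angles) (@measurable_polar r)).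

Definition two_circles (a b : R) : {measure set mplane -> \bar R} :=
  measure_add (measure_add (half_circle a) (half_circle (- a)))
              (measure_add (half_circle b) (half_circle (- b))).

Lemma half_circleE (r : R) (B : set mplane) :
  half_circle r B = (`|r|%:E * mu (angles `&` polar r @^-1` B))%E.
Proof. by rewrite /half_circle /mscale /= /pushforward /mrestr setIC. Qed.

Lemma two_circlesE (a b : R) (B : set mplane) : two_circles a b B =
  (half_circle a B + half_circle (- a) B + (half_circle b B + half_circle (- b) B))%E.
Proof. by rewrite -!measure_addE. Qed.

(** Four half-circles and four poles cover both circles, which gives the upper
    bound by subadditivity. For the lower bound the half-circles are shortened
    near the poles, which makes them metrically separated, and arc length is
    additive on separated sets; the length removed tends to 0. *)
Lemma arclength_circles (a b : R) (B : set mplane) : 0 < a -> a < b ->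
  measurable B -> B `<=` circles a b -> arclength B = two_circles a b B.
Proof.
move=> a0 ab mB Bab; have b0 : 0 < b by exact: lt_trans ab.
have na0 : - a != 0 by rewrite oppr_eq0 gt_eqF.
have nb0 : - b != 0 by rewrite oppr_eq0 gt_eqF.
have a0' : a != 0 by rewrite gt_eqF.
have b0' : b != 0 by rewrite gt_eqF.
rewrite two_circlesE !half_circleE.
rewrite -!arclength_polar_imageI//; try exact: measurable_angles.
apply/eqP; rewrite eq_le; apply/andP; split.
  have null (x : plane) : arclength (B `&` [set x]) = 0%E.
    apply/eqP; rewrite eq_le arclength_ge0 andbT -(arclength_set1 x).
    by apply: le_arclength => y [].
  set A1 := B `&` polar a @` _; set A2 := B `&` polar (- a) @` _.
  set A3 := B `&` polar b @` _; set A4 := B `&` polar (- b) @` _.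
  pose P1 := B `&` [set ((0 : R), a)]; pose P2 := B `&` [set ((0 : R), - a)].
  pose P3 := B `&` [set ((0 : R), b)]; pose P4 := B `&` [set ((0 : R), - b)].
  have cov : B `<=` ((A1 `|` A2) `|` (A3 `|` A4)) `|` ((P1 `|` P2) `|` (P3 `|` P4)).
    move=> x Bx; have [x10|x10] := eqVneq x.1 0.
      right; have e rho : 0 < rho -> enorm x = rho -> x = (0, rho) \/ x = (0, - rho).
        move=> rho0 xr; have := enorm_sq x; rewrite xr x10 expr0n add0r => /eqP.
        rewrite eqf_sqr => /orP[/eqP h|/eqP h]; [left|right];
        by rewrite [LHS]surjective_pairing x10 h ?opprK.
      by case: (Bab x Bx) => [/(e _ a0)|/(e _ b0)] [ex|ex];
        [left; left|left; right|right; left|right; right].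
    left; case: (Bab x Bx) => [/(circle_polar a0)|/(circle_polar b0)] /(_ x10) [t Jt [ex|ex]];
        [left; left|left; right|right; left|right; right]; split => //; by exists t.
  apply: le_trans (le_arclength cov) _.
  apply: le_trans (arclength_setU _ _) _.
  have -> : arclength ((P1 `|` P2) `|` (P3 `|` P4)) = 0%E.
    apply/eqP; rewrite eq_le arclength_ge0 andbT.
    apply: le_trans (arclength_setU _ _) _; apply: adde_le0;
    by apply: le_trans (arclength_setU _ _) _; rewrite !null adde0.
  rewrite adde0; apply: le_trans (arclength_setU _ _) _.
  by apply: leeD; exact: arclength_setU.
(* The half-circles touch at the poles (0, r): they are separated only after
   an angle eta has been removed near both ends of each of them. *)
rewrite !arclength_polar_imageI//; try exact: measurable_angles.
pose m r := mu (angles `&` polar r @^-1` B).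
have mfin r : m r \is a fin_num.
  rewrite ge0_fin_numE; last exact: measure_ge0.
  apply: (@le_lt_trans _ _ (mu angles)).
    apply: le_measure; rewrite ?inE.
    - apply: measurableI; first exact: measurable_angles.
      by rewrite -[X in measurable X]setTI; exact: measurable_polar.
    - exact: measurable_angles.
    - by move=> t [].
  rewrite /angles lebesgue_measure_itv/=.
  by case: ifP => _; rewrite ?ltry// -EFinD ltry.
rewrite -/(m a) -/(m (- a)) -/(m b) -/(m (- b)).
rewrite -(fineK (mfin a)) -(fineK (mfin (- a))) -(fineK (mfin b)) -(fineK (mfin (- b))).
rewrite -!EFinM -!EFinD.
have [|Bfin] := leP +oo%E (arclength B).
  by rewrite leye_eq => /eqP->; exact: leey.
have {}Bfin : arclength B \is a fin_num by rewrite ge0_fin_numE ?arclength_ge0.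
rewrite -(fineK Bfin) lee_fin.
have key eta : 0 < eta < pi / 2 ->
  `|a| * (fine (m a) - 2 * eta) + `|- a| * (fine (m (- a)) - 2 * eta) +
  (`|b| * (fine (m b) - 2 * eta) + `|- b| * (fine (m (- b)) - 2 * eta))
   <= fine (arclength B).
  move=> /andP[eta0 etapi].
  pose J : set R := `](- (pi / 2) + eta), (pi / 2 - eta)[%classic.
  have mJ : measurable (J : set (measurableTypeR R)) by exact: measurable_itv.
  have JA : J `<=` angles.
    by move=> t; rewrite /J /angles /= !in_itv/= => /andP[t1 t2]; apply/andP; split; lra.
  have p0 := pi_gt0 R.
  have sin0 : 0 < sin eta by apply: sin_gt0_pihalf; rewrite eta0.
  have cJ t : J t -> sin eta <= cos t.
    rewrite /J /= in_itv/= => /andP[t1 t2].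
    wlog t0 : t t1 t2 / 0 <= t => [H|].
      have [/H|t0] := leP 0 t; first exact.
      by rewrite -cosN; apply: H; lra.
    have -> : cos t = sin (pi / 2 - t).
      by rewrite sinB sin_pihalf cos_pihalf mul0r subr0 mul1r.
    have : eta <= pi / 2 - t by lra.
    rewrite le_eqVlt => /predU1P[->//|h]; apply: ltW.
    by rewrite ltr_sin// in_itv/=; apply/andP; split; lra.
  pose F r := B `&` polar r @` J.
  have Fle r : r != 0 -> ((`|r| * (fine (m r) - 2 * eta))%:E <= arclength (F r))%E.
    move=> r0; rewrite /F arclength_polar_imageI// EFinM.
    rewrite lee_pmul2l ?lte_fin ?normr_gt0// EFinB fineK// leeBlDr//.
    have mE (E : set R) : measurable (E : set (measurableTypeR R)) ->
        measurable (E `&` polar r @^-1` B : set (measurableTypeR R)).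
      move=> ?; apply: measurableI => //.
      by rewrite -[X in measurable X]setTI; exact: measurable_polar.
    pose I1 : set R := `[- (pi / 2), - (pi / 2) + eta]%classic.
    pose I2 : set R := `[pi / 2 - eta, pi / 2]%classic.
    have mI1 : measurable (I1 : set (measurableTypeR R)) by exact: measurable_itv.
    have mI2 : measurable (I2 : set (measurableTypeR R)) by exact: measurable_itv.
    have muI1 : mu I1 = eta%:E.
      rewrite /I1 lebesgue_measure_itv/= lte_fin ltrDl eta0 -EFinD.
      by congr EFin; ring.
    have muI2 : mu I2 = eta%:E.
      rewrite /I2 lebesgue_measure_itv/= lte_fin gtrDl oppr_lt0 eta0 -EFinD.
      by congr EFin; ring.
    apply: (@le_trans _ _ (mu ((J `&` polar r @^-1` B) `|` (I1 `|` I2)))).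
      apply: le_measure; rewrite ?inE.
      - by apply: mE; exact: measurable_angles.
      - by apply: measurableU; [exact: mE|exact: measurableU].
      move=> t [Jt Bt]; have [h1|h1] := leP t (- (pi / 2) + eta).
        right; left; move: Jt; rewrite /angles /I1 /= !in_itv/= => /andP[].
        by rewrite h1 => /ltW->.
      have [h2|h2] := leP (pi / 2 - eta) t.
        right; right; move: Jt; rewrite /angles /I2 /= !in_itv/= => /andP[_ /ltW].
        by rewrite h2.
      by left; split => //; rewrite /J /= in_itv/= h1 h2.
    apply: le_trans (measureU2 _ _ _) _; [exact: mE|exact: measurableU|].
    apply: leeD; first exact: lexx.
    apply: le_trans (measureU2 _ _ _) _ => //.
    rewrite -[leLHS]/(mu I1 + mu I2)%E.
    by rewrite muI1 muI2 -EFinD lee_fin; lra.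
  rewrite -lee_fin (fineK Bfin).
  apply: (@le_trans _ _ (arclength ((F a `|` F (- a)) `|` (F b `|` F (- b))))); last first.
    by apply: le_arclength => x [[]|[]] [].
  pose e := Num.min a (b - a).
  have e0 : 0 < e by rewrite lt_min a0 subr_gt0.
  have ea : e <= a by rewrite ge_min lexx.
  have eba : e <= b - a by rewrite ge_min lexx orbT.
  have se0 : 0 < sin eta * e by rewrite mulr_gt0.
  have S r r' x y : e <= `|r - r'| -> F r x -> F r' y -> sin eta * e <= enorm (x - y).
    move=> er [_ [s Js <-]] [_ [t Jt <-]].
    apply: le_trans (polar_separated _ _ (ltW sin0) (cJ s Js) (cJ t Jt)).
    by rewrite ler_pM2l.
  rewrite !EFinD.
  apply: le_trans (arclength_setU_separated se0 _); last first.
    by move=> x y [Fx|Fx] [Fy|Fy]; apply: (S _ _ _ _ _ Fx Fy); rewrite ler_normr;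
    apply/orP; ((left; lra) || (right; lra)).
  apply: leeD.
    apply: le_trans (arclength_setU_separated se0 _); last first.
      move=> x y Fx Fy; apply: (S _ _ _ _ _ Fx Fy); rewrite ler_normr.
      by apply/orP; left; lra.
    by apply: leeD; exact: Fle.
  apply: le_trans (arclength_setU_separated se0 _); last first.
    move=> x y Fx Fy; apply: (S _ _ _ _ _ Fx Fy); rewrite ler_normr.
    by apply/orP; left; lra.
  by apply: leeD; exact: Fle.
rewrite !normrN (gtr0_norm a0) (gtr0_norm b0) in key *.
apply/ler_addgt0Pr => d d0.
have ab0 : 0 < 4 * (a + b) by rewrite mulr_gt0// addr_gt0.
pose eta := Num.min (1 / 2) (d / (4 * (a + b))).
have p2 := pi_ge2 R.
have h : 0 < eta < pi / 2.
  rewrite lt_min divr_gt0//= divr_gt0//= gt_min; apply/orP; left; lra.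
have h2 : eta * (4 * (a + b)) <= d by rewrite -ler_pdivlMr// ge_min lexx orbT.
have := key _ h; lra.
Qed.

End Circles.

(** * Integration along concentric circles *)

Section IntegralSetFunction.
Local Open Scope ereal_scope.
Import HBNNSimple.

(** The integral of a function vanishing outside [D] is a supremum of finite
    sums of values of the set function on level sets contained in [D]. This
    replaces arc length, a mere outer measure, by a measure under the integral
    sign. *)
Lemma eq_set_function_integral d (T : measurableType d) (R : realType) (D : set T)
    (m1 m2 : set T -> \bar R) (f : T -> \bar R) :
  (forall A, measurable A -> A `<=` D -> m1 A = m2 A) ->
  \int[m1]_(x in D) f x = \int[m2]_(x in D) f x.
Proof.
move=> m12.
have E (g : T -> \bar R) : (forall x, ~ D x -> g x = 0) ->
    sintegral m1 @` [set h : {nnsfun T >-> R} | forall x, (h x)%:E <= g x] =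
    sintegral m2 @` [set h : {nnsfun T >-> R} | forall x, (h x)%:E <= g x].
  move=> g0; apply: eq_imagel => h /= hg; apply: eq_fsbigr => r _.
  have [->|r0] := eqVneq r 0%R; first by rewrite !mul0e.
  rewrite m12// => x /= hx; apply: contrapT => /g0 gx.
  have := hg x; rewrite gx hx lee_fin => r0'.
  by move: r0; rewrite -hx eq_le hx r0' -hx fun_ge0.
rewrite /integral; congr (ereal_sup _ - ereal_sup _).
  by apply: E => x Dx; rewrite funeposE patchE memNset// maxxx.
by apply: E => x Dx; rewrite funenegE patchE memNset// oppe0 maxxx.
Qed.

Lemma ge0_integral_mrestr d (T : measurableType d) (R : realType)
    (m : {measure set T -> \bar R}) (D E : set T) (mD : measurable D)
    (f : T -> \bar R) : measurable E -> measurable_fun E f ->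
  (forall x, E x -> 0 <= f x) ->
  \int[mrestr m mD]_(x in E) f x = \int[m]_(x in E `&` D) f x.
Proof.
move=> mE mf f0.
have mN : measurable (E `\` D) by exact: measurableD.
have mI : measurable (E `&` D) by exact: measurableI.
rewrite -[X in integral _ X _](setUIDK E D) ge0_integral_setU ?setUIDK//; last first.
  by apply/disj_set2P; rewrite -subset0 => x [[_ Dx] []].
rewrite [X in _ + X](_ : _ = 0) ?adde0; last first.
  rewrite -(@integral_measure_zero _ T R (E `\` D) f).
  apply: eq_set_function_integral => A mA AED.
  have AD0 : A `&` D = set0 by rewrite -subset0 => x [/AED[]].
  by rewrite -[LHS]/(m (A `&` D)) AD0 measure0.
apply: eq_set_function_integral => A mA AED; congr (m _).
by apply/setIidl => x /AED[].
Qed.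

End IntegralSetFunction.

Section IntegralCircles.
Variable R : realType.
Local Notation plane := (R * R)%type.
Local Notation mplane := (measurableTypeR R * measurableTypeR R)%type.
Local Notation mu := (@lebesgue_measure R).
Local Open Scope ereal_scope.

Let integral_half_circle (D : set mplane) (r : R) (F : mplane -> \bar R) :
  measurable D -> measurable_fun D F -> (forall x, D x -> 0 <= F x) ->
  (forall t, D (polar r t)) ->
  \int[half_circle r]_(x in D) F x = `|r|%:E * \int[mu]_(t in angles) F (polar r t).
Proof.
move=> mD mF F0 Dr; rewrite ge0_integral_mscale//; congr (_ * _).
rewrite (@ge0_integral_pushforward _ _ _ _ _ _ (@measurable_polar R r))//=; last first.
  by move=> x; rewrite inE; exact: F0.
have -> : polar r @^-1` D = setT by apply/seteqP; split=> // t _; exact: Dr.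
rewrite ge0_integral_mrestr ?setTI//; last by move=> t _ /=; exact/F0/Dr.
apply: (measurable_comp mD) => //; [by move=> _ [t _ <-]|exact: measurable_polar].
Qed.

Lemma measurable_enorm : measurable_fun [set: mplane] (@enorm R : mplane -> measurableTypeR R).
Proof.
apply: measurableT_comp; first exact: (continuous_measurable_fun (@sqrt_continuous R)).
apply: measurable_funD; apply: measurable_funM;
by [exact: measurable_fst|exact: measurable_snd].
Qed.

Lemma measurable_circles (a b : R) : measurable (circles a b : set mplane).
Proof.
have -> : circles a b = @enorm R @^-1` [set a] `|` @enorm R @^-1` [set b].
  by apply/seteqP; split.
by apply: measurableU; rewrite -[X in measurable X]setTI; apply: measurable_enorm => //;
  exact: measurable_set1.
Qed.

Lemma integral_circles (a b : R) (F : mplane -> \bar R) : (0 < a)%R -> (a < b)%R ->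
  measurable_fun (circles a b : set mplane) F -> (forall x, circles a b x -> 0 <= F x) ->
  \int[(@arclength R : set mplane -> \bar R)]_(x in (circles a b : set mplane)) F x =
  \int[mu]_(t in angles) (a%:E * (F (polar a t) + F (polar (- a) t))
                         + b%:E * (F (polar b t) + F (polar (- b) t))).
Proof.
move=> a0 ab mF F0; have b0 := lt_trans a0 ab.
have mD := measurable_circles a b.
have mJ := @measurable_angles R.
have D1 r t : `|r|%R = a \/ `|r|%R = b -> circles a b (polar r t).
  by move=> H; rewrite /circles/= enorm_polar.
have ra : `|a|%R = a by rewrite gtr0_norm.
have rb : `|b|%R = b by rewrite gtr0_norm.
have mFr r : `|r|%R = a \/ `|r|%R = b -> measurable_fun angles (fun t : measurableTypeR R => F (polar r t)).
  move=> H; apply: measurable_funTS; apply: (measurable_comp mD) => //.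
    by move=> _ [t _ <-]; exact: D1.
  exact: measurable_polar.
rewrite (@eq_set_function_integral _ mplane R _ _ (two_circles a b)); last first.
  by move=> A mA AD; exact: arclength_circles.
rewrite /two_circles ge0_integral_measure_add//.
rewrite ge0_integral_measure_add// ge0_integral_measure_add//.
rewrite !integral_half_circle//; try by (move=> t; apply: D1; rewrite ?normrN ?ra ?rb; tauto).
rewrite !normrN ra rb.
have H1 : `|(- a)%R|%R = a by rewrite normrN.
have H2 : `|(- b)%R|%R = b by rewrite normrN.
have ma1 := mFr _ (or_introl ra); have ma2 := mFr _ (or_introl H1).
have mb1 := mFr _ (or_intror rb); have mb2 := mFr _ (or_intror H2).
have pos r t : `|r|%R = a \/ `|r|%R = b -> 0 <= F (polar r t) by move=> /(D1 _ t); exact: F0.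
have pa1 t := pos _ t (or_introl ra); have pa2 t := pos _ t (or_introl H1).
have pb1 t := pos _ t (or_intror rb); have pb2 t := pos _ t (or_intror H2).
have a0' : 0 <= a%:E by rewrite lee_fin ltW.
have b0' : 0 <= b%:E by rewrite lee_fin ltW.
rewrite [RHS]ge0_integralD//; last first.
- by apply: measurable_funeM; exact: emeasurable_funD.
- by move=> t _; rewrite mule_ge0// adde_ge0.
- by apply: measurable_funeM; exact: emeasurable_funD.
- by move=> t _; rewrite mule_ge0// adde_ge0.
rewrite !ge0_integralZl//; last first.
- by move=> t _; rewrite adde_ge0.
- exact: emeasurable_funD.
- by move=> t _; rewrite adde_ge0.
- exact: emeasurable_funD.
rewrite !ge0_integralD//.
by congr (_ + _); rewrite [RHS]ge0_muleDr//; exact: integral_ge0.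
Qed.

End IntegralCircles.

(** * Changes of variable on the line *)

Section Density.
Context d (T : measurableType d) (R : realType).
Variables (m : {measure set T -> \bar R}) (w : T -> R).
Hypotheses (mw : measurable_fun setT w) (w0 : forall x, 0 <= w x).
Local Open Scope ereal_scope.

Definition density (A : set T) : \bar R := \int[m]_(x in A) (w x)%:E.

Let density0 : density set0 = 0. Proof. exact: integral_set0. Qed.

Let density_ge0 A : 0 <= density A.
Proof. by apply: integral_ge0 => x _; rewrite lee_fin. Qed.

Let density_sigma_additive : semi_sigma_additive density.
Proof.
move=> F mF tF mUF; rewrite /density ge0_integral_bigcup//; last 2 first.
- by apply/measurable_EFinP; exact: measurable_funTS.
- by move=> x _; rewrite lee_fin.
apply: is_cvg_ereal_nneg_natsum_cond => n _ _.
by apply: integral_ge0 => x _; rewrite lee_fin.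
Qed.

HB.instance Definition _ := isMeasure.Build _ _ _ density
  density0 density_ge0 density_sigma_additive.

Definition density_measure : {measure set T -> \bar R} := density.

Import HBNNSimple.

Let integral_density_nnsfun (h : {nnsfun T >-> R}) :
  \int[density]_x (h x)%:E = \int[m]_x ((h x)%:E * (w x)%:E).
Proof.
rewrite integralT_nnsfun sintegralE.
transitivity (\int[m]_x (\sum_(r \in range h) (r * \1_(h @^-1` [set r]) x * w x)%:E)).
  rewrite ge0_integral_fsum//; last 2 first.
  - move=> r; apply/measurable_EFinP; apply: measurable_funM => //.
    by apply: measurable_funM.
  - by move=> r x _; rewrite lee_fin mulr_ge0// -lee_fin nnfun_muleindic_ge0.
  apply: eq_fsbigr => r; rewrite inE => -[x _ hx].
  have r0 : (0 <= r)%R by rewrite -hx fun_ge0.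
  under eq_integral do rewrite -mulrA EFinM.
  rewrite ge0_integralZl//; last 2 first.
  - by apply/measurable_EFinP; apply: measurable_funM.
  - by move=> y _; rewrite lee_fin mulr_ge0.
  congr (_ * _); rewrite [LHS]integral_mkcond; apply: eq_integral => y _.
  by rewrite patchE indicE; case: ifP => _; rewrite ?mul1r ?mul0r.
apply: eq_integral => x _; rewrite [in RHS](fimfunE h) muleC -fsumEFin//.
rewrite ge0_mule_fsumr; last by move=> r; exact: nnfun_muleindic_ge0.
by apply: eq_fsbigr => r _; rewrite EFinM muleC.
Qed.

(** From simple functions to nonnegative measurable functions by monotone
    convergence. *)
Lemma ge0_integral_density (F : T -> \bar R) :
  measurable_fun setT F -> (forall x, 0 <= F x) ->
  \int[density_measure]_x F x = \int[m]_x (F x * (w x)%:E).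
Proof.
move=> mF F0; pose f_ := nnsfun_approx measurableT mF.
have cF x : (f_ n x)%:E @[n --> \oo] --> F x by exact: cvg_nnsfun_approx.
have nF x : {homo (fun n => (f_ n x)%:E) : a b / (a <= b)%N >-> a <= b}.
  by move=> a b ab; rewrite lee_fin; exact/lefP/nd_nnsfun_approx.
transitivity (limn (fun n => \int[density]_x (f_ n x)%:E)).
  rewrite -monotone_convergence//=.
  - by apply: eq_integral => x _; apply/esym/cvg_lim.
  - by move=> n; exact/measurable_EFinP.
  - by move=> n x _; rewrite lee_fin.
transitivity (limn (fun n => \int[m]_x ((f_ n x)%:E * (w x)%:E))).
  by congr (limn _); apply/funext => n; exact: integral_density_nnsfun.
rewrite -monotone_convergence//=.
- apply: eq_integral => x _; apply/cvg_lim => //.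
  under eq_fun do rewrite muleC; rewrite muleC.
  by apply: cvgeZl.
- by move=> n; apply/measurable_EFinP; exact: measurable_funM.
- by move=> n x _; rewrite mule_ge0// lee_fin.
- by move=> x _ a b ab; rewrite lee_pmul// ?lee_fin// -lee_fin; exact: nF.
Qed.

End Density.

Section PolarCoordinates.
Variable R : realType.
Local Notation rT := (measurableTypeR R).
Local Notation plane := (R * R)%type.
Local Notation mplane := (measurableTypeR R * measurableTypeR R)%type.
Local Notation mu := (@lebesgue_measure R).

(** Extended by 0 outside the half-turn, the tangent is measurable on the whole
    line. *)
Definition tan_angles : rT -> rT := (@tan R) \_ angles.

Lemma tan_anglesE (t : R) : angles t -> tan_angles t = tan t.
Proof. by move=> Jt; rewrite /tan_angles patchE mem_set. Qed.

Lemma measurable_tan_angles : measurable_fun setT tan_angles.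
Proof.
apply/(measurable_restrictT _ (@measurable_angles R)).
apply: subspace_continuous_measurable_fun; first exact: measurable_angles.
apply: continuous_in_subspaceT => t; rewrite inE => Jt.
by apply: continuous_tan; rewrite gt_eqF// angles_gt0.
Qed.

Let w (t : rT) : R := 1 + tan_angles t ^+ 2.

Let mw : measurable_fun setT w.
Proof.
apply: measurable_funD => //; apply: measurable_funX; exact: measurable_tan_angles.
Qed.

Let w_ge0 t : 0 <= w t. Proof. by rewrite addr_ge0// sqr_ge0. Qed.

Let tan_measure : {measure set rT -> \bar R} :=
  measure_function_pushforward__canonical__measure_function_Measure
   (density_measure (mrestr mu (@measurable_angles R)) mw w_ge0) measurable_tan_angles.

(** The substitution y = tan t. The measure of density 1 + tan^2 on the
    half-turn, pushed forward by the tangent, gives each interval its length by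
    the fundamental theorem of calculus, hence it is Lebesgue measure. *)
Lemma integral_tan (G : rT -> \bar R) :
  measurable_fun setT G -> (forall x, (0 <= G x)%E) ->
  (\int[mu]_y G y = \int[mu]_(t in (angles : set rT)) (G (tan_angles t) * (1 + tan_angles t ^+ 2)%:E))%E.
Proof.
move=> mG G0; rewrite (eq_measure_integral tan_measure); last first.
  move=> A mA _; apply: lebesgue_measure_unique mA => _ [[u v] _ <-] /=.
  have mA : measurable (tan_angles @^-1` `]u, v] : set rT).
    by rewrite -[X in measurable X]setTI; apply: measurable_tan_angles => //; exact: measurable_itv.
  transitivity (\int[mu]_(t in (tan_angles @^-1` `]u, v] `&` angles : set rT)) (w t)%:E)%E; last first.
    rewrite -[RHS]/(\int[mrestr mu (@measurable_angles R)]_(t in (tan_angles @^-1` `]u, v] : set rT)) (w t)%:E)%E.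
    rewrite ge0_integral_mrestr//.
    - by apply/measurable_EFinP; exact: measurable_funTS.
    - by move=> t _; rewrite lee_fin w_ge0.
  have tanlt (z t : R) : angles t -> (z < tan t) = (atan z < t).
    move=> Jt; rewrite -{1}(atanK z) ltr_tan//.
    by rewrite in_itv/= atan_gtNpi2 atan_ltpi2.
  have -> : tan_angles @^-1` `]u, v] `&` angles = `]atan u, atan v]%classic.
    apply/seteqP; split=> [t [/= + Jt]|t /=].
      by rewrite tan_anglesE// !in_itv/= tanlt// !leNgt tanlt.
    rewrite in_itv/= => /andP[ut tv].
    have Jt : angles t.
      rewrite /angles/= in_itv/= (lt_trans _ ut) ?atan_gtNpi2//=.
      by rewrite (le_lt_trans tv)// atan_ltpi2.
    by split => //; rewrite tan_anglesE// in_itv/= tanlt// ut/= leNgt tanlt// -leNgt.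
  have [vu|uv] := leP v u.
    rewrite !set_itv_ge ?bnd_simp -?leNgt// ?le_atan//.
    by rewrite measure0 integral_set0.
  have auv : atan u < atan v by exact: lt_atan.
  rewrite lebesgue_measure_itv/= lte_fin uv integral_itv_obnd_cbnd; last first.
    by apply/measurable_EFinP; exact: measurable_funTS.
  have inJ t : t \in `[atan u, atan v] -> angles t.
    rewrite in_itv/= => /andP[ut tv]; rewrite /angles/= in_itv/=.
    by rewrite (lt_le_trans _ ut) ?atan_gtNpi2//= (le_lt_trans tv)// atan_ltpi2.
  have cosn t : angles t -> cos t != 0 by move=> Jt; rewrite gt_eqF// angles_gt0.
  transitivity (\int[mu]_(t in `[atan u, atan v]) ((cos t)^-2)%:E)%E; last first.
    apply: eq_integral => t; rewrite inE/= => tuv.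
    by rewrite /w tan_anglesE ?cos2_tan2//; [exact/cosn/inJ|exact: inJ].
  rewrite (@continuous_FTC2 _ _ (@tan R))// ?atanK//.
  - apply: continuous_in_subspaceT => t; rewrite inE/= => /inJ/cosn ct.
    apply: cvgV; first by rewrite expf_neq0.
    apply: (@continuous_comp _ _ _ (@cos R) (fun x : R => x ^+ 2) t).
      exact: continuous_cos.
    exact: exprn_continuous.
  - split.
    + move=> t tuv; apply: derivable_tan; apply: cosn; apply: inJ.
      exact: subset_itv_oo_cc.
    + apply: cvg_at_right_filter; apply: continuous_tan; apply: cosn; apply: inJ.
      by rewrite bound_itvE ltW.
    + apply: cvg_at_left_filter; apply: continuous_tan; apply: cosn; apply: inJ.
      by rewrite bound_itvE ltW.
  - move=> t tuv; rewrite derive1E; have ct : cos t != 0.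
      by apply: cosn; apply: inJ; exact: subset_itv_oo_cc.
    by have := is_derive_tan ct => h; rewrite derive_val.
rewrite ge0_integral_pushforward//; last exact: measurable_tan_angles.
rewrite preimage_setT (ge0_integral_density _ mw w_ge0)/=; last 2 first.
- by apply: measurableT_comp => //; exact: measurable_tan_angles.
- by move=> x; exact: G0.
rewrite ge0_integral_mrestr ?setTI//.
- apply: emeasurable_funM; last by apply/measurable_EFinP; exact: mw.
  by apply: measurableT_comp => //; exact: measurable_tan_angles.
- by move=> x _; rewrite mule_ge0// lee_fin w_ge0.
Qed.

(** Lebesgue measure is |c| times its image under the homothety of ratio c,
    because both agree on intervals. *)
Lemma integral_scale (c : R) (G : rT -> \bar R) : c != 0 ->
  measurable_fun setT G -> (forall x, (0 <= G x)%E) ->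
  (\int[mu]_y G y = `|c|%:E * \int[mu]_y G (c * y)%R)%E.
Proof.
move=> c0 mG G0.
have mc : measurable_fun [set: rT] (fun x : rT => c * x : rT) by exact: measurable_funM.
pose nu : {measure set rT -> \bar R} := mscale (NngNum (normr_ge0 c))
  (measure_function_pushforward__canonical__measure_function_Measure mu mc).
rewrite (eq_measure_integral nu); last first.
  move=> A mA _; apply: lebesgue_measure_unique mA => _ [[u v] _ <-] /=.
  rewrite -[RHS]/(`|c|%:E * mu ((fun x : rT => (c * x)%R) @^-1` `]u, v]))%E.
  have [cn|cp] := ltP c 0.
    have -> : (fun x : rT => c * x) @^-1` `]u, v] = `[v / c, u / c[%classic.
      apply/seteqP; split => x /=; rewrite !in_itv/= (mulrC c).
        by rewrite ler_ndivrMr// ltr_ndivlMr// andbC.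
      by rewrite ler_ndivrMr// ltr_ndivlMr// andbC.
    rewrite !lebesgue_measure_itv/= !lte_fin ltr_ndivrMr// divfK//.
    case: ifPn => _; last by rewrite mule0.
    by rewrite -!EFinD -EFinM ltr0_norm//; congr EFin; field.
  have {}cp : 0 < c by rewrite lt_neqAle eq_sym c0.
  have -> : (fun x : rT => c * x) @^-1` `]u, v] = `]u / c, v / c]%classic.
    apply/seteqP; split => x /=; rewrite !in_itv/= (mulrC c).
      by rewrite ler_pdivlMr// ltr_pdivrMr.
    by rewrite ler_pdivlMr// ltr_pdivrMr.
  rewrite !lebesgue_measure_itv/= !lte_fin ltr_pdivrMr// divfK//.
  case: ifPn => _; last by rewrite mule0.
  by rewrite -!EFinD -EFinM gtr0_norm//; congr EFin; field.
rewrite ge0_integral_mscale//; congr (_ * _)%E.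
by rewrite ge0_integral_pushforward//; move=> y _.
Qed.

End PolarCoordinates.
Arguments tan_angles {R}.

(** * Area in polar coordinates *)

Section AreaPolar.
Variable R : realType.
Local Notation rT := (measurableTypeR R).
Local Notation plane := (R * R)%type.
Local Notation mplane := (measurableTypeR R * measurableTypeR R)%type.
Local Notation mu := (@lebesgue_measure R).
Local Open Scope ereal_scope.

(** Tonelli in Cartesian coordinates, then y = x tan t at fixed x, Tonelli
    again, and x = r cos t at fixed t. The factor |x| (1 + tan^2 t) cos t is
    |r|. *)
Lemma area_polar (g : mplane -> \bar R) :
  measurable_fun setT g -> (forall z, 0 <= g z) ->
  \int[@area R]_z g z =
  \int[mu]_(t in (angles : set rT)) \int[mu]_r (`|r|%:E * g (polar r t)).
Proof.
move=> mg g0; rewrite /area fubini_tonelli1//.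
have mT := @measurable_tan_angles R.
have m0 : mu [set (0%R : R)] = 0 by rewrite lebesgue_measure_set1.
have msec x : measurable_fun [set: rT] (fun y : rT => g (x, y)).
  exact: measurable_fun_pair2.
pose w (t : rT) : R := (1 + tan_angles t ^+ 2)%R.
have mw : measurable_fun setT w.
  by apply: measurable_funD => //; exact: measurable_funX.
have w0 t : (0 <= w t)%R by rewrite addr_ge0// sqr_ge0.
have mF : measurable_fun [set: rT] (fubini_F mu g).
  exact: measurable_fun_fubini_tonelli_F.
pose h (z : rT * rT) : \bar R :=
  (`|z.1| * (w z.2 * \1_(angles : set rT) z.2))%:E * g (z.1, z.1 * tan_angles z.2)%R.
have mh : measurable_fun [set: rT * rT] h.
  apply: emeasurable_funM.
    apply/measurable_EFinP; apply: measurable_funM.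
      apply: measurableT_comp; [exact: normr_measurable|exact: measurable_fst].
    apply: measurable_funM; first by apply: measurableT_comp => //; exact: measurable_snd.
    apply: measurableT_comp; last exact: measurable_snd.
    by apply: measurable_indic; exact: measurable_angles.
  apply: measurableT_comp => //; apply: measurable_fun_pair; first exact: measurable_fst.
  apply: measurable_funM; first exact: measurable_fst.
  by apply: measurableT_comp => //; exact: measurable_snd.
have h0 z : 0 <= h z.
  by rewrite mule_ge0// lee_fin !mulr_ge0.
transitivity (\int[mu]_x \int[mu]_t h (x, t)).
  rewrite (ge0_negligible_integral (N := [set (0%R : R)] : set rT))//; last first.
    by move=> x _; exact: integral_ge0.
  rewrite [RHS](ge0_negligible_integral (N := [set (0%R : R)] : set rT))//; last 2 first.
  - exact: (measurable_fun_fubini_tonelli_F h).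
  - by move=> x _; exact: integral_ge0.
  apply: eq_integral => x; rewrite inE => -[_ /eqP x0].
  rewrite -[LHS]/(\int[mu]_y g (x, y)) [LHS](integral_scale x0)//.
  have mgx : measurable_fun [set: rT] (fun y : rT => g (x, x * y)%R).
    by apply: (measurableT_comp (msec x)); exact: measurable_funM.
  rewrite (integral_tan mgx (fun y => g0 _)).
  rewrite -ge0_integralZl//; last 3 first.
  - exact: measurable_angles.
  - apply: emeasurable_funM; last by apply/measurable_EFinP; exact: measurable_funTS.
    by apply: measurable_funTS; apply: (measurableT_comp mgx).
  - by move=> t _; rewrite mule_ge0// lee_fin w0.
  rewrite integral_mkcond; apply: eq_integral => t _; rewrite /h /= patchE indicE.
  case: ifP => _; last by rewrite !mulr0 mul0e.
  by rewrite mulr1 EFinM -!muleA [w t]/w; congr (_ * _); rewrite muleC.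
transitivity (\int[mu]_t \int[mu]_x h (x, t)).
  exact: (@fubini_tonelli _ _ _ _ _ mu mu h mh h0).
rewrite [RHS]integral_mkcond; apply: eq_integral => t _; rewrite patchE.
case: ifPn => [|tJ]; last first.
  apply: integral0_eq => x _; rewrite /h/= indicE (negbTE tJ).
  by rewrite !mulr0 mul0e.
rewrite inE => Jt; have ct := angles_gt0 Jt; have ct0 : cos t != 0%R by rewrite gt_eqF.
have mht : measurable_fun [set: rT] (fun x : rT => h (x, t)).
  exact: measurable_fun_pair1.
rewrite (integral_scale ct0)// -ge0_integralZl//; last first.
- by apply: (measurableT_comp mht); exact: measurable_funM.
apply: eq_integral => r _; rewrite /h /= indicE mem_set// mulr1 muleA -EFinM.
congr (_%:E * _).
  rewrite /w tan_anglesE// -cos2_tan2// normrM gtr0_norm//.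
  by field.
by rewrite /polar tan_anglesE// /tan; congr (g (_, _)); field.
Qed.

Definition open_ring (a b : R) : set plane := [set x | (a < enorm x < b)%R].

Lemma measurable_open_ring (a b : R) : measurable (open_ring a b : set mplane).
Proof.
have -> : open_ring a b = @enorm R @^-1` `]a, b[.
  by apply/seteqP; split => x /=; rewrite in_itv.
rewrite -[X in measurable X]setTI; apply: measurable_enorm => //.
Qed.

Lemma measurable_polar_radius (t : R) :
  measurable_fun [set: rT] (fun r : rT => polar r t : mplane).
Proof. by apply: measurable_fun_pair; exact: measurable_funM. Qed.

Lemma area_ring_polar (a b : R) (g : mplane -> \bar R) : (0 <= a)%R ->
  measurable_fun (open_ring a b : set mplane) g -> (forall z, open_ring a b z -> 0 <= g z) ->
  \int[@area R]_(z in (open_ring a b : set mplane)) g z =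
  \int[mu]_(t in (angles : set rT)) \int[mu]_(r in (`]a, b[%classic : set rT))
     (r%:E * (g (polar r t) + g (polar (- r) t))).
Proof.
move=> a0 mg g0; have mA := measurable_open_ring a b.
rewrite integral_mkcond area_polar; last 2 first.
- by apply/(measurable_restrictT _ mA).
- by move=> z; rewrite patchE; case: ifPn => //; rewrite inE; exact: g0.
apply: eq_integral => t _.
pose G (r : rT) := `|r|%:E * g (polar r t).
have Dr r : open_ring a b (polar r t) <-> (a < `|r| < b)%R.
  by rewrite /open_ring /= enorm_polar.
pose I1 : set rT := `]a, b[%classic; pose I2 : set rT := `](- b)%R, (- a)%R[%classic.
have mI1 : measurable I1 by exact: measurable_itv.
have mI2 : measurable I2 by exact: measurable_itv.
have DE r : open_ring a b (polar r t) <-> (I1 `|` I2) r.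
  rewrite Dr; split.
    rewrite ltr_norml ltr_normr => /andP[/orP[ar|ar] /andP[br rb]]; [left|right];
    by rewrite /I1 /I2 /= in_itv/=; apply/andP; split; lra.
  rewrite /I1 /I2 /= !in_itv/= => -[/andP[h1 h2]|/andP[h1 h2]].
    by rewrite gtr0_norm ?h1//; lra.
  by rewrite ltr0_norm; [apply/andP; split; lra|lra].
have mG : measurable_fun (I1 `|` I2) G.
  have mn : measurable_fun (I1 `|` I2) (EFin \o (fun r : rT => `|r|%R)).
    by apply/measurable_EFinP; exact: normr_measurable.
  apply: (emeasurable_funM mn).
  apply: (measurable_comp mA) => //; last first.
    by apply: measurable_funTS; exact: measurable_polar_radius.
  by move=> _ [r /DE Ir <-].
have G0 r : (I1 `|` I2) r -> 0 <= G r by move=> /DE Ir; rewrite mule_ge0// g0.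
transitivity (\int[mu]_(r in I1 `|` I2) G r).
  rewrite [RHS]integral_mkcond; apply: eq_integral => r _; rewrite !patchE.
  case: ifPn => [|/negP h]; first by rewrite inE => /DE h; rewrite mem_set.
  rewrite memNset ?mule0// => /DE h'; by apply: h; rewrite inE.
rewrite ge0_integral_setU//; last first.
  apply/disj_set2P; rewrite -subset0 => r []; rewrite /I1 /I2 /= !in_itv/=.
  by move=> /andP[h1 _] /andP[_ h2]; lra.
have mG1 : measurable_fun I1 G by apply: (measurable_funS (measurableU _ _ mI1 mI2) _ mG) => r; left.
have mG2 : measurable_fun I2 G by apply: (measurable_funS (measurableU _ _ mI1 mI2) _ mG) => r; right.
have I12 r : I2 (- r)%R <-> I1 r.
  by rewrite /I1 /I2 /= !in_itv/= !ltrN2 andbC.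
have -> : \int[mu]_(r in I2) G r = \int[mu]_(r in I1) G (- r)%R.
  rewrite integral_mkcond (@integral_scale R (-1)); last 3 first.
  - by rewrite oppr_eq0 oner_eq0.
  - by apply/(measurable_restrictT _ mI2).
  - by move=> r; rewrite patchE; case: ifPn => //; rewrite inE => h; apply: G0; right.
  rewrite normrN normr1 mul1e [RHS]integral_mkcond; apply: eq_integral => r _.
  rewrite !patchE mulN1r; case: ifPn => [|/negP h]; last first.
    by rewrite memNset// => h'; apply: h; rewrite inE; apply/I12.
  by rewrite inE => /I12 h; rewrite mem_set.
have mo : measurable_fun I1 (fun r : rT => (- r)%R : rT) by exact: oppr_measurable.
have mGN : measurable_fun I1 (fun r : rT => G (- r)%R).
  apply: (measurable_comp mI2 _ mG2 mo).
  by move=> _ [r /I12 h <-].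
rewrite -ge0_integralD//; last 2 first.
- by move=> r h; apply: G0; left.
- by move=> r /I12 h; apply: G0; right.
apply: eq_integral => r; rewrite inE /I1 /= in_itv/= => /andP[ar rb].
have r0 : (0 < r)%R by exact: le_lt_trans ar.
rewrite /G normrN gtr0_norm// ge0_muleDr//; apply: g0; apply/Dr.
  by rewrite gtr0_norm// ar.
by rewrite normrN gtr0_norm// ar.
Qed.

End AreaPolar.

(** * Functions of class C^k in the plane *)

Section PlaneCalculus.
Variable R : realType.
Local Notation plane := (R * R)%type.
Implicit Types (f g : plane -> R) (x v : plane).

Lemma Ck_continuous k f : Ck k f -> continuous f.
Proof. by case: k => [|k] []. Qed.

Lemma Ck_le k f : Ck k.+1 f -> Ck k f.
Proof.
elim: k f => [|k IH] f; first by case.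
move=> [cf [d1 d2 p1 p2]].
by split; [exact: cf|split; [exact: d1|exact: d2|exact: IH p1|exact: IH p2]].
Qed.

(** A derivative unfolded into difference quotients, which can be transported
    between directional derivatives in the plane and derivatives along a
    line. *)
Lemma is_derive_eps (V : normedModType R) (f : V -> R) (x v : V) (df : R) :
  (forall e, 0 < e -> exists2 d, 0 < d & forall h, h != 0 -> `|h| < d ->
     `|df - h^-1 * (f (h *: v + x) - f x)| <= e) -> is_derive x v f df.
Proof.
move=> H; have C : h^-1 *: (f (h *: v + x) - f x) @[h --> (0 : R)^'] --> df.
  apply/cvgrPdist_le => e e0; have [d d0 Hd] := H e e0.
  by exists d => // h /=; rewrite sub0r normrN => hd h0; exact: Hd.
apply: DeriveDef; first by apply/cvg_ex; exists df.
exact: cvg_lim C.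
Qed.

Lemma eps_is_derive (V : normedModType R) (f : V -> R) (x v : V) (df : R) :
  is_derive x v f df ->
  forall e, 0 < e -> exists2 d, 0 < d & forall h, h != 0 -> `|h| < d ->
     `|df - h^-1 * (f (h *: v + x) - f x)| <= e.
Proof.
move=> [dv <-] e e0; have /cvgrPdist_le/(_ _ e0)[d d0 Hd] := dv.
exists d => // h h0 hd; apply: Hd => //.
by rewrite /= sub0r normrN.
Qed.

Lemma Ck_is_derive1 k f x : Ck k.+1 f -> is_derive x ((1 : R), (0 : R)) f (partial1 f x).
Proof. by move=> [_ [d1 _ _ _]]; apply: derivableP. Qed.

Lemma Ck_is_derive2 k f x : Ck k.+1 f -> is_derive x ((0 : R), (1 : R)) f (partial2 f x).
Proof. by move=> [_ [_ d2 _ _]]; apply: derivableP. Qed.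

(** It reduces membership in C^(k+1) to a guess of the two partial
    derivatives. *)
Lemma Ck_partialE k f p1 p2 : continuous f ->
  (forall x, is_derive x ((1 : R), (0 : R)) f (p1 x)) ->
  (forall x, is_derive x ((0 : R), (1 : R)) f (p2 x)) ->
  Ck k p1 -> Ck k p2 -> Ck k.+1 f.
Proof.
move=> cf d1 d2 C1 C2; split; first exact: cf.
split.
- by move=> x; have [] := d1 x.
- by move=> x; have [] := d2 x.
- have -> : partial1 f = p1; last exact: C1.
  by apply/funext => x; rewrite /partial1 derive_val.
- have -> : partial2 f = p2; last exact: C2.
  by apply/funext => x; rewrite /partial2 derive_val.
Qed.

Lemma Ck_cst k (c : R) : Ck k (fun=> c : R).
Proof.
elim: k c => [|k IH] c; first by split => // x; exact: cvg_cst.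
apply: (Ck_partialE (p1 := fun=> 0) (p2 := fun=> 0)) => //.
by move=> x; exact: cvg_cst.
Qed.

Lemma Ck_fst k : Ck k (fst : plane -> R).
Proof.
have cf : continuous (fst : plane -> R) by move=> x; exact: cvg_fst.
case: k => [|k]; first by split.
apply: (Ck_partialE (p1 := fun=> 1) (p2 := fun=> 0)) => //; try exact: Ck_cst.
- move=> x; apply: is_derive_eps => e e0; exists 1 => // h h0 _.
  by rewrite /= addrK /GRing.scale/= mulr1 mulVf// subrr normr0 ltW.
- move=> x; apply: is_derive_eps => e e0; exists 1 => // h h0 _.
  by rewrite /= addrK /GRing.scale/= !mulr0 subrr normr0 ltW.
Qed.

Lemma Ck_snd k : Ck k (snd : plane -> R).
Proof.
have cf : continuous (snd : plane -> R) by move=> x; exact: cvg_snd.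
case: k => [|k]; first by split.
apply: (Ck_partialE (p1 := fun=> 0) (p2 := fun=> 1)) => //; try exact: Ck_cst.
- move=> x; apply: is_derive_eps => e e0; exists 1 => // h h0 _.
  by rewrite /= addrK /GRing.scale/= !mulr0 subrr normr0 ltW.
- move=> x; apply: is_derive_eps => e e0; exists 1 => // h h0 _.
  by rewrite /= addrK /GRing.scale/= mulr1 mulVf// subrr normr0 ltW.
Qed.

Lemma Ck_add k f g : Ck k f -> Ck k g -> Ck k (fun x => f x + g x).
Proof.
elim: k f g => [|k IH] f g Cf Cg.
  by split => // x; apply: cvgD; [exact: (Ck_continuous Cf)|exact: (Ck_continuous Cg)].
have [cf [_ _ f1 f2]] := Cf; have [cg [_ _ g1 g2]] := Cg.
apply: (Ck_partialE (p1 := fun x => partial1 f x + partial1 g x)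
                    (p2 := fun x => partial2 f x + partial2 g x)).
- by move=> x; apply: cvgD; [exact: cf|exact: cg].
- by move=> x; have D1 := Ck_is_derive1 x Cf; have D2 := Ck_is_derive1 x Cg; exact: is_deriveD.
- by move=> x; have D1 := Ck_is_derive2 x Cf; have D2 := Ck_is_derive2 x Cg; exact: is_deriveD.
- exact: IH.
- exact: IH.
Qed.

Lemma Ck_mul k f g : Ck k f -> Ck k g -> Ck k (fun x => f x * g x).
Proof.
elim: k f g => [|k IH] f g Cf Cg.
  by split => // x; apply: cvgM; [exact: (Ck_continuous Cf)|exact: (Ck_continuous Cg)].
have [cf [_ _ f1 f2]] := Cf; have [cg [_ _ g1 g2]] := Cg.
apply: (Ck_partialE (p1 := fun x => f x * partial1 g x + g x * partial1 f x)
                    (p2 := fun x => f x * partial2 g x + g x * partial2 f x)).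
- by move=> x; apply: cvgM; [exact: cf|exact: cg].
- by move=> x; have D1 := Ck_is_derive1 x Cf; have D2 := Ck_is_derive1 x Cg; exact: is_deriveM.
- by move=> x; have D1 := Ck_is_derive2 x Cf; have D2 := Ck_is_derive2 x Cg; exact: is_deriveM.
- by apply: Ck_add; apply: IH => //; exact: Ck_le.
- by apply: Ck_add; apply: IH => //; exact: Ck_le.
Qed.

Lemma is_derive_slice1 f (u y d : R) : is_derive (u, y) ((1 : R), (0 : R)) f d ->
  is_derive u 1 (fun s => f (s, y)) d.
Proof.
move=> /eps_is_derive H; apply: is_derive_eps => e /H[k k0 Hk]; exists k => // h h0 hk.
have := Hk h h0 hk; congr (`|_ - _ * (f _ - _)| <= _).
by rewrite [LHS]surjective_pairing/= /GRing.scale/= mulr0 add0r.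
Qed.

Lemma is_derive_slice2 f (u y d : R) : is_derive (u, y) ((0 : R), (1 : R)) f d ->
  is_derive y 1 (fun s => f (u, s)) d.
Proof.
move=> /eps_is_derive H; apply: is_derive_eps => e /H[k k0 Hk]; exists k => // h h0 hk.
have := Hk h h0 hk; congr (`|_ - _ * (f _ - _)| <= _).
by rewrite [LHS]surjective_pairing/= /GRing.scale/= mulr0 add0r.
Qed.

Lemma mvt_unordered (h dh : R -> R) (a b : R) :
  (forall s : R, is_derive s 1 h (dh s)) ->
  exists2 c : R, `|c - a| <= `|b - a| & h b - h a = dh c * (b - a).
Proof.
move=> H; have [ab|/ltW ba] := leP a b.
  have [c /andP[ac cb] e] := mvt_cc ab (fun z _ => H z); exists c => //.
  by rewrite !ger0_norm ?subr_ge0// lerD2r.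
have [c /andP[bc ca] e] := mvt_cc ba (fun z _ => H z); exists c.
  by rewrite !ler0_norm ?subr_le0// lerN2 lerD2r.
by rewrite -opprB e; ring.
Qed.

(** The increment is split along a horizontal and a vertical segment, and the
    mean value theorem applies to each. *)
Lemma increment_partials f (x y : plane) : Ck 1 f ->
  exists c1 c2, [/\ `|c1 - x.1| <= `|y.1 - x.1|, `|c2 - x.2| <= `|y.2 - x.2| &
    f y - f x = partial1 f (c1, y.2) * (y.1 - x.1) + partial2 f (x.1, c2) * (y.2 - x.2)].
Proof.
move=> Cf.
have [c1 h1 e1] := @mvt_unordered (fun s => f (s, y.2)) (fun s => partial1 f (s, y.2)) x.1 y.1
  (fun s => is_derive_slice1 (Ck_is_derive1 _ Cf)).
have [c2 h2 e2] := @mvt_unordered (fun s => f (x.1, s)) (fun s => partial2 f (x.1, s)) x.2 y.2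
  (fun s => is_derive_slice2 (Ck_is_derive2 _ Cf)).
exists c1, c2; split => //; rewrite -e1 -e2 /=.
by rewrite -!surjective_pairing; ring.
Qed.

(** Chain rule along a line: by [increment_partials] the difference quotient is
    a combination of partial derivatives at nearby points, which are
    continuous. *)
Lemma is_derive_line f x v (t : R) : Ck 1 f ->
  is_derive t 1 (fun s => f (x.1 + s * v.1, x.2 + s * v.2))
    (v.1 * partial1 f (x.1 + t * v.1, x.2 + t * v.2) +
     v.2 * partial2 f (x.1 + t * v.1, x.2 + t * v.2)).
Proof.
move=> Cf; set p : plane := (_, _); apply: is_derive_eps.
have [cf [_ _ [c1 _] [c2 _]]] := Cf.
move=> e e0.
have e' : 0 < e / (2 * (`|v.1| + `|v.2| + 1)).
  by rewrite divr_gt0// mulr_gt0// ltr_wpDl.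
have /cvgrPdist_le/(_ _ e')/nbhs_ballP[d1 /= d10 H1] := c1 p.
have /cvgrPdist_le/(_ _ e')/nbhs_ballP[d2 /= d20 H2] := c2 p.
have d0 : 0 < Num.min d1 d2 / (`|v.1| + `|v.2| + 1).
  by rewrite divr_gt0// ?lt_min ?d10// ltr_wpDl.
exists (Num.min d1 d2 / (`|v.1| + `|v.2| + 1)) => // h h0 hd.
pose q : plane := (x.1 + (h *: 1 + t) * v.1, x.2 + (h *: 1 + t) * v.2).
have [k1 [k2 [hk1 hk2 e12]]] := increment_partials p q Cf.
rewrite -/q e12.
have eq1 : q.1 - p.1 = h * v.1 by rewrite /q /p /= /GRing.scale/=; ring.
have eq2 : q.2 - p.2 = h * v.2 by rewrite /q /p /= /GRing.scale/=; ring.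
move: hd; rewrite ltr_pdivlMr ?ltr_wpDl// lt_min => /andP[hd1 hd2].
have v1 : 0 <= `|h| * `|v.1| by rewrite mulr_ge0.
have v2 : 0 <= `|h| * `|v.2| by rewrite mulr_ge0.
have hh : 0 <= `|h| by [].
have B1 : ball p d1 (k1, q.2).
  split; rewrite /ball /= -opprB normrN.
    by apply: le_lt_trans hk1 _; rewrite eq1 normrM; lra.
  by rewrite eq2 normrM; lra.
have B2 : ball p d2 (p.1, k2).
  split; rewrite /ball /= -opprB normrN ?subrr ?normr0//.
  by apply: le_lt_trans hk2 _; rewrite eq2 normrM; lra.
have := H1 _ B1; have := H2 _ B2; rewrite /= => E2 E1.
rewrite eq1 eq2 /GRing.scale/=.
rewrite (_ : _ - _ = v.1 * (partial1 f p - partial1 f (k1, q.2)) +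
   v.2 * (partial2 f p - partial2 f (p.1, k2))); last by field.
apply: le_trans (ler_normD _ _) _; rewrite !normrM.
apply: (@le_trans _ _ ((`|v.1| + `|v.2|) * (e / (2 * (`|v.1| + `|v.2| + 1))))).
  by rewrite mulrDl lerD// ler_wpM2l.
rewrite mulrA ler_pdivrMr ?mulr_gt0 ?ltr_wpDl//.
have : 0 <= e * (`|v.1| + `|v.2|) by apply: mulr_ge0; [exact: ltW|exact: addr_ge0].
lra.
Qed.

(** The sigma-algebra of the plane is the product one: an open set is the
    countable union of the rational squares that it contains. *)
Lemma open_plane_measurable (O : set plane) : open O ->
  measurable (O : set (measurableTypeR R * measurableTypeR R)).
Proof.
move=> oO.
pose box (p : rat * rat * nat) : set plane :=
  [set y | `|ratr p.1.1 - y.1| < p.2.+1%:R^-1 /\ `|ratr p.1.2 - y.2| < p.2.+1%:R^-1].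
have -> : O = \bigcup_p (if `[< box p `<=` O >] then box p else set0).
  apply/seteqP; split => [x Ox|x [p _]]; last by case: asboolP => // pO /pO.
  have /nbhs_ballP[e /= e0 He] : nbhs x O by exact: open_nbhs_nbhs.
  pose n := Num.trunc (2 / e).
  have ne : 2 * n.+1%:R^-1 < e.
    have := truncnS_gt (2 / e); rewrite -/n => h.
    by move: h; rewrite !ltr_pdivrMr ?ltr0n// mulrC.
  have n0 : 0 < n.+1%:R^-1 :> R by rewrite invr_gt0 ltr0n.
  have rat_near (u : R) : exists q : rat, `|ratr q - u| < n.+1%:R^-1.
    have /rat_in_itvoo[q] : u - n.+1%:R^-1 < u + n.+1%:R^-1.
      by rewrite ltrBlDr -addrA ltrDl addr_gt0.
    by rewrite in_itv/= => qu; exists q; rewrite ltr_distl.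
  have [q1 hq1] := rat_near x.1; have [q2 hq2] := rat_near x.2.
  exists (q1, q2, n) => //; rewrite asboolT//= => y [y1 y2]; apply: He; split.
    rewrite /ball/=; apply: (@le_lt_trans _ _ (`|x.1 - ratr q1| + `|ratr q1 - y.1|)).
      by rewrite (_ : x.1 - y.1 = (x.1 - ratr q1) + (ratr q1 - y.1)) ?ler_normD//; ring.
    by rewrite distrC; move: ne hq1 y1; set c := _^-1; lra.
  rewrite /ball/=; apply: (@le_lt_trans _ _ (`|x.2 - ratr q2| + `|ratr q2 - y.2|)).
    by rewrite (_ : x.2 - y.2 = (x.2 - ratr q2) + (ratr q2 - y.2)) ?ler_normD//; ring.
  by rewrite distrC; move: ne hq2 y2; set c := _^-1; lra.
apply: countable_bigcupT_measurable; first exact: countableP.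
move=> p; case: asboolP => // _.
pose I (q : rat) : set (measurableTypeR R) :=
  `](ratr q - p.2.+1%:R^-1), (ratr q + p.2.+1%:R^-1)[%classic.
have -> : box p = I p.1.1 `*` I p.1.2.
  by apply/seteqP; split => y /=; rewrite /box /I /= !in_itv/= !(distrC (ratr _)) !ltr_distl.
by apply: measurableX; exact: measurable_itv.
Qed.

Lemma continuous_measurable_plane (f : plane -> R) : continuous f ->
  measurable_fun [set: measurableTypeR R * measurableTypeR R] (f : _ -> measurableTypeR R).
Proof.
move=> /continuousP cf; apply: (measurability _ (RGenOpens.measurableE R)).
move=> _ [_ [a [b ->] <-]]; rewrite setTI; apply: open_plane_measurable.
exact/cf/interval_open.
Qed.

End PlaneCalculus.

(** * Boundary and normal of the annulus *)

Section AnnulusGeometry.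
Variable R : realType.
Local Notation plane := (R * R)%type.
Implicit Types (x y : plane).

Definition smul (s : R) x : plane := (s * x.1, s * x.2).

Lemma enorm_smul s x : enorm (smul s x) = `|s| * enorm x.
Proof.
rewrite /enorm (_ : dotp _ _ = s ^+ 2 * dotp x x); last by rewrite /dotp /=; ring.
by rewrite sqrtrM ?sqr_ge0// sqrtr_sqr.
Qed.

Lemma continuous_enorm : continuous (@enorm R).
Proof.
have cdot : continuous (fun x : plane => dotp x x).
  by apply: (@Ck_continuous R 0); apply: Ck_add; apply: Ck_mul;
    (exact: Ck_fst || exact: Ck_snd).
move=> x; apply: (@continuous_comp _ _ _ (fun x : plane => dotp x x) (@Num.sqrt R)).
  exact: cdot.
exact: sqrt_continuous.
Qed.

Lemma nbhs_smul x (B : set plane) : nbhs x B ->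
  exists2 d, 0 < d & forall s, `|s - 1| < d -> B (smul s x).
Proof.
move=> /nbhs_ballP[e /= e0 He].
have S0 : 0 < `|x.1| + `|x.2| + 1 by rewrite ltr_wpDl// addr_ge0.
exists (e / (`|x.1| + `|x.2| + 1)); first by rewrite divr_gt0.
move=> s; rewrite ltr_pdivlMr// => hs; apply: He.
have h1 : 0 <= `|s - 1| * `|x.1| by rewrite mulr_ge0.
have h2 : 0 <= `|s - 1| * `|x.2| by rewrite mulr_ge0.
have h3 : 0 <= `|s - 1| by [].
split; rewrite /ball/= distrC /smul/=.
  by rewrite (_ : s * x.1 - x.1 = (s - 1) * x.1) ?normrM; [lra|ring].
by rewrite (_ : s * x.2 - x.2 = (s - 1) * x.2) ?normrM; [lra|ring].
Qed.

Lemma closed_enorm_le r : closed [set x : plane | enorm x <= r].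
Proof.
rewrite (_ : [set _ | _] = @enorm R @^-1` [set z | z <= r])//.
by apply: closed_comp; [move=> x _; exact: continuous_enorm|exact: closed_le].
Qed.

Lemma closed_enorm_ge r : closed [set x : plane | r <= enorm x].
Proof.
rewrite (_ : [set _ | _] = @enorm R @^-1` [set z | r <= z])//.
by apply: closed_comp; [move=> x _; exact: continuous_enorm|exact: closed_ge].
Qed.

Lemma closure_disc r : 0 < r -> closure (disc r) = [set x : plane | enorm x <= r].
Proof.
move=> r0; apply/seteqP; split => [x|x /= xr].
  have /closure_id -> := @closed_enorm_le r.
  by apply: closure_subset => y; exact: ltW.
move=> B /nbhs_smul[d d0 Hd].
pose e := Num.min (d / 2) (1 / 2).
have ed : e <= d / 2 by rewrite ge_min lexx.
have e2 : e <= 1 / 2 by rewrite ge_min lexx orbT.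
have e0 : 0 < e by rewrite lt_min !divr_gt0.
exists (smul (1 - e) x); split.
  rewrite /disc /= enorm_smul ger0_norm; last by lra.
  by have := enorm_ge0 x; nra.
by apply: Hd; rewrite addrC addKr normrN gtr0_norm//; lra.
Qed.

Lemma annulusE (a b : R) : 0 < a -> annulus a b = open_ring a b.
Proof.
move=> a0; rewrite /annulus closure_disc//.
apply/seteqP; split => x; rewrite /disc /open_ring /=.
  by move=> [-> /negP]; rewrite -ltNge => ->.
by move=> /andP[h1 h2]; split => //; apply/negP; rewrite -ltNge.
Qed.

Lemma open_open_ring (a b : R) : open (open_ring a b).
Proof.
rewrite (_ : open_ring a b = @enorm R @^-1` `]a, b[%classic); last first.
  by apply/seteqP; split => x /=; rewrite in_itv.
by move/continuousP : continuous_enorm; apply; exact: interval_open.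
Qed.

Lemma closure_open_ring (a b : R) : 0 < a -> a < b ->
  closure (open_ring a b) = [set x | a <= enorm x <= b].
Proof.
move=> a0 ab; apply/seteqP; split => [x|x /= /andP[ax xb]].
  have /closure_id -> : closed [set x : plane | a <= enorm x <= b].
    rewrite (_ : [set _ | _] = [set x : plane | a <= enorm x] `&` [set x : plane | enorm x <= b]).
      by apply: closedI; [exact: closed_enorm_ge|exact: closed_enorm_le].
    by apply/seteqP; split => y /=; [move=> /andP|move=> [-> ->]].
  by apply: closure_subset => y /andP[/ltW ay /ltW yb]; rewrite /= ay yb.
move=> B /nbhs_smul[d d0 Hd].
have x0 : 0 < enorm x by exact: lt_le_trans ax.
pose m := (a + b) / 2.
pose e := Num.min (d / 2) 1.
have ed : e <= d / 2 by rewrite ge_min lexx.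
have e1 : e <= 1 by rewrite ge_min lexx orbT.
have e0 : 0 < e by rewrite lt_min divr_gt0//=.
(* Points of the closed ring are moved slightly towards the middle circle. *)
pose k := m / enorm x - 1.
have k0 : 0 <= `|k| by [].
pose s := 1 + Num.min 1 (e / (`|k| + 1)) * k.
set u := Num.min 1 _ in s.
have u0 : 0 < u by rewrite lt_min ltr01 divr_gt0// ltr_wpDl.
have u1 : u <= 1 by rewrite ge_min lexx.
have uk : u * `|k| <= e.
  have : u * (`|k| + 1) <= e by rewrite -ler_pdivlMr ?ltr_wpDl// ge_min lexx orbT.
  by lra.
exists (smul s x); split; last first.
  by apply: Hd; rewrite /s addrC addKr normrM gtr0_norm//; lra.
have e_s : s * enorm x = (1 - u) * enorm x + u * m.
  by rewrite /s /k; field; rewrite gt_eqF.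
have sp : 0 <= s.
  rewrite -(pmulr_lge0 _ x0) e_s; apply: addr_ge0; apply: mulr_ge0;
    [lra|exact: ltW|exact: ltW|rewrite /m; lra].
rewrite /open_ring/= enorm_smul ger0_norm// e_s /m; apply/andP; split; nra.
Qed.

Lemma ebdry_annulus (a b : R) : 0 < a -> a < b ->
  ebdry (annulus a b) = circles a b.
Proof.
move=> a0 ab; rewrite annulusE// /ebdry closure_open_ring//.
have /interior_id -> := @open_open_ring a b.
apply/seteqP; split => x; rewrite /open_ring /circles /=.
  move=> [/andP[ax xb] /negP]; rewrite negb_and -!leNgt => /orP[xa|bx]; [left|right];
  by apply/eqP; rewrite eq_le ?ax ?xb ?xa ?bx.
by move=> [->|->]; rewrite ?ltxx ?lexx ?andbF (ltW ab).
Qed.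

Lemma deriv_sign (phi : R -> R) (d delta : R) : is_derive (0 : R) (1 : R) phi d ->
  0 < delta -> phi 0 <= 0 -> (forall t, 0 < t < delta -> 0 <= phi t) -> 0 <= d.
Proof.
move=> /eps_is_derive H d0 p0 P; rewrite leNgt; apply/negP => dn.
have [k k0 Hk] : exists2 d1, 0 < d1 & _ := H (- d / 2) ltac:(by lra).
pose h := Num.min (k / 2) (delta / 2).
have h0 : 0 < h by rewrite lt_min !divr_gt0.
have hk : h <= k / 2 by rewrite ge_min lexx.
have hd : h <= delta / 2 by rewrite ge_min lexx orbT.
have := Hk h (lt0r_neq0 h0); rewrite gtr0_norm// => /(_ ltac:(by lra)).
rewrite /GRing.scale/= mulr1 addr0 => /ler_normlP[h1 _].
have ph : 0 <= phi h by apply: P; rewrite h0/=; lra.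
have : 0 <= h^-1 * (phi h - phi 0) by apply: mulr_ge0; [rewrite invr_ge0 ltW|lra].
lra.
Qed.

(** The function |y|^2 - b^2 exhibits x / b as an outward normal. Conversely,
    let rho be any defining function. It is nonnegative outside the ring and
    vanishes at x, so its derivative is nonnegative in every direction that
    makes an acute angle with x. Hence its gradient has no tangential part and
    is a positive multiple of x. *)
Lemma normal_outer (a b : R) x : 0 < a -> a < b -> enorm x = b ->
  normal (annulus a b) x = smul b^-1 x.
Proof.
move=> a0 ab xb; have b0 : 0 < b by exact: lt_trans ab.
have xsq : x.1 ^+ 2 + x.2 ^+ 2 = b ^+ 2 by rewrite -enorm_sq xb.
have bx : ebdry (annulus a b) x by rewrite ebdry_annulus//; right.
have near_a : \forall y \near x, a < enorm y.
  have : nbhs (enorm x) [set z | a < z] by apply: open_nbhs_nbhs; split; [exact: open_gt|rewrite /= xb].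
  exact: continuous_enorm.
apply: xget_unique.
  split => //; exists (fun y => y.1 * y.1 + y.2 * y.2 + - b ^+ 2).
  set rho := (fun y : plane => _).
  have srho k : Ck k rho.
    apply: Ck_add; last exact: Ck_cst.
    by apply: Ck_add; apply: Ck_mul; (exact: Ck_fst || exact: Ck_snd).
  have p1 : partial1 rho x = 2 * x.1.
    rewrite /partial1; apply: derive_val; apply: is_derive_eps => e e0.
    exists e => // h h0 he; rewrite /rho /= /GRing.scale/= mulr1 mulr0 add0r.
    rewrite (_ : _ - _ = - h) ?normrN ?ltW//; by field.
  have p2 : partial2 rho x = 2 * x.2.
    rewrite /partial2; apply: derive_val; apply: is_derive_eps => e e0.
    exists e => // h h0 he; rewrite /rho /= /GRing.scale/= mulr1 mulr0 add0r.
    rewrite (_ : _ - _ = - h) ?normrN ?ltW//; by field.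
  have eg : enorm (grad rho x) = 2 * b.
    rewrite (_ : grad rho x = smul 2 x) ?enorm_smul ?xb ?ger0_norm//.
    by rewrite /grad p1 p2.
  split => //.
  - near=> y; have ay : a < enorm y by near: y.
    rewrite annulusE// /open_ring /= ay /= /rho -!expr2 -enorm_sq subr_lt0.
    by rewrite ltr_pXn2r// ?nnegrE ?enorm_ge0 ?ltW.
  - apply/eqP => g0; move: eg; rewrite g0 /enorm /dotp /= !mulr0 addr0 sqrtr0.
    lra.
  - by rewrite eg p1 p2 /smul; congr pair; field; rewrite gt_eqF.
move=> n [_ [rho [srho nrho g0 ->]]].
have rx : 0 <= rho x.
  rewrite leNgt; apply/negP => /(nbhs_singleton nrho).
  by rewrite annulusE// /open_ring/= xb ltxx andbF.
set g1 := partial1 rho x; set g2 := partial2 rho x.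
have line v : is_derive (0 : R) (1 : R)
    (fun s => rho (x.1 + s * v.1, x.2 + s * v.2)) (v.1 * g1 + v.2 * g2).
  have := @is_derive_line R rho x v 0 (srho 1%N).
  by rewrite !mul0r !addr0 -surjective_pairing.
have nearline (v : plane) (P : plane -> Prop) : (\forall y \near x, P y) ->
    exists2 d, 0 < d & forall s, `|s| < d -> P (x.1 + s * v.1, x.2 + s * v.2).
  move=> /nbhs_ballP[e /= e0 He].
  have S0 : 0 < `|v.1| + `|v.2| + 1 by rewrite ltr_wpDl// addr_ge0.
  exists (e / (`|v.1| + `|v.2| + 1)); first by rewrite divr_gt0.
  move=> s; rewrite ltr_pdivlMr// => hs; apply: He.
  have h1 : 0 <= `|s| * `|v.1| by rewrite mulr_ge0.
  have h2 : 0 <= `|s| * `|v.2| by rewrite mulr_ge0.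
  have h3 : 0 <= `|s| by [].
  by split; rewrite /ball/= opprD addNKr normrN normrM; lra.
have esq v s : enorm (x.1 + s * v.1, x.2 + s * v.2) ^+ 2 =
    b ^+ 2 + s * (2 * (v.1 * x.1 + v.2 * x.2) + s * (v.1 ^+ 2 + v.2 ^+ 2)).
  by rewrite enorm_sq /= -xsq; ring.
have small (p q : R) : 0 < p -> exists2 d, 0 < d & forall s, 0 < s < d -> s * q < p.
  move=> p0; exists (p / (`|q| + 1)); first by rewrite divr_gt0// ltr_wpDl.
  move=> s /andP[s0]; rewrite ltr_pdivlMr ?ltr_wpDl// => h.
  by have := ler_norm q; nra.
have q0 (v : plane) : 0 <= v.1 ^+ 2 + v.2 ^+ 2 by rewrite addr_ge0 ?sqr_ge0.
have rho_in v : v.1 * x.1 + v.2 * x.2 < 0 -> exists2 d, 0 < d &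
    forall s, 0 < s < d -> rho (x.1 + s * v.1, x.2 + s * v.2) < 0.
  move=> vx; have [d1 d10 H1] := nearline v _ nrho.
  have [d2 d20 H2] := nearline v _ near_a.
  have [d3 d30 H3] := small (- (2 * (v.1 * x.1 + v.2 * x.2))) (v.1 ^+ 2 + v.2 ^+ 2) ltac:(by lra).
  exists (Num.min d1 (Num.min d2 d3)); first by rewrite !lt_min d10 d20.
  move=> s; rewrite !lt_min => /andP[s0 /andP[s1 /andP[s2 s3]]].
  have sd : `|s| = s by rewrite gtr0_norm.
  apply/(H1 s); rewrite ?sd// annulusE// /open_ring/= H2 ?sd//=.
  rewrite -(ltr_pXn2r (_ : (0 < 2)%N)) ?nnegrE ?enorm_ge0 ?ltW// esq.
  by have := H3 s; rewrite s0 s3 => /(_ isT); nra.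
have rho_out v : 0 < v.1 * x.1 + v.2 * x.2 -> exists2 d, 0 < d &
    forall s, 0 < s < d -> 0 <= rho (x.1 + s * v.1, x.2 + s * v.2).
  move=> vx; have [d1 d10 H1] := nearline v _ nrho.
  exists d1 => // s /andP[s0 s1].
  have sd : `|s| = s by rewrite gtr0_norm.
  rewrite leNgt; apply/negP => /(H1 s); rewrite sd => /(_ s1).
  rewrite annulusE// /open_ring/= => /andP[_].
  rewrite -(ltr_pXn2r (_ : (0 < 2)%N)) ?nnegrE ?enorm_ge0 ?ltW// esq.
  by have := q0 v; nra.
have rx0 : rho x <= 0.
  have := rho_in (- x.1, - x.2); rewrite /= => /(_ _)[|d d0 Hd].
    by rewrite !mulNr -!expr2 -opprD xsq oppr_lt0 exprn_gt0.
  rewrite leNgt; apply/negP => rp.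
  have crho : continuous rho := Ck_continuous (srho 0%N).
  have : \forall y \near x, 0 < rho y.
    have : nbhs (rho x) [set z | 0 < z] by apply: open_nbhs_nbhs; split; [exact: open_gt|].
    exact: crho.
  move=> /(nearline (- x.1, - x.2))[d' d'0 Hd'].
  pose s := Num.min d d' / 2.
  have m0 : 0 < Num.min d d' by rewrite lt_min d0.
  have sd : s < d by have : Num.min d d' <= d; [rewrite ge_min lexx|rewrite /s; lra].
  have sd' : s < d' by have : Num.min d d' <= d'; [rewrite ge_min lexx orbT|rewrite /s; lra].
  have s0 : 0 < s by rewrite divr_gt0.
  have := Hd s; rewrite s0 sd => /(_ isT); have := Hd' s; rewrite gtr0_norm// => /(_ sd').
  by move=> /= h1 h2; have := lt_trans h1 h2; rewrite ltxx.
have sgn v : 0 < v.1 * x.1 + v.2 * x.2 -> 0 <= v.1 * g1 + v.2 * g2.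
  move=> /rho_out[d d0 Hd]; apply: (deriv_sign (line v) d0 _ Hd).
  by rewrite !mul0r !addr0 -surjective_pairing.
(* The directions +-(x.2, -x.1) are tangent; tilted by e / 2 they point outwards,
   and the derivative of rho along them is nonnegative for every small e. *)
have tang : - x.2 * g1 + x.1 * g2 = 0.
  apply/eqP; rewrite eq_le; apply/andP; split; rewrite leNgt; apply/negP => h.
    pose T := - x.2 * g1 + x.1 * g2; pose X := x.1 * g1 + x.2 * g2.
    have [e e0 He] := small T X h.
    have := sgn (x.2 + e / 2 * x.1, - x.1 + e / 2 * x.2) => /=.
    have e2 : 0 < e / 2 < e by apply/andP; split; lra.
    have b2 : 0 < e / 2 * b ^+ 2 by rewrite mulr_gt0 ?exprn_gt0 ?divr_gt0.
    move=> /(_ ltac:(by rewrite (_ : _ + _ = e / 2 * b ^+ 2)//; rewrite -xsq; ring)).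
    by have := He _ e2; rewrite /T /X; lra.
  pose T := x.2 * g1 - x.1 * g2; pose X := x.1 * g1 + x.2 * g2.
  have [e e0 He] := small T X ltac:(by rewrite /T; lra).
  have := sgn (- x.2 + e / 2 * x.1, x.1 + e / 2 * x.2) => /=.
  have e2 : 0 < e / 2 < e by apply/andP; split; lra.
  have b2 : 0 < e / 2 * b ^+ 2 by rewrite mulr_gt0 ?exprn_gt0 ?divr_gt0.
  move=> /(_ ltac:(by rewrite (_ : _ + _ = e / 2 * b ^+ 2)//; rewrite -xsq; ring)).
  by have := He _ e2; rewrite /T /X; lra.
have X0 : 0 <= x.1 * g1 + x.2 * g2.
  by apply: sgn; rewrite -!expr2 xsq exprn_gt0.
pose X := x.1 * g1 + x.2 * g2.
have b2 : b ^+ 2 != 0 by rewrite gt_eqF ?exprn_gt0.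
have e1 : g1 = X / b ^+ 2 * x.1.
  apply: (mulIf b2); rewrite mulrAC divfK// -xsq /X.
  by rewrite -[LHS]addr0 -[in LHS](mulr0 x.2) -tang; ring.
have e2 : g2 = X / b ^+ 2 * x.2.
  apply: (mulIf b2); rewrite mulrAC divfK// -xsq /X.
  by rewrite -[LHS]addr0 -[in LHS](mulr0 (- x.1)) -tang; ring.
have Xn0 : 0 < X.
  rewrite lt_neqAle X0 andbT; apply/negP => /eqP X00; move/negP: g0; apply.
  by rewrite /grad -/g1 -/g2 e1 e2 -X00 !mul0r.
have k0 : 0 < X / b ^+ 2 by rewrite divr_gt0// exprn_gt0.
have -> : grad rho x = smul (X / b ^+ 2) x by rewrite /grad -/g1 -/g2 {1}e1 {1}e2.
rewrite enorm_smul xb (gtr0_norm k0) e1 e2 /smul.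
by congr pair; field; rewrite (gt_eqF Xn0) (gt_eqF b0).
Unshelve. all: by end_near. Qed.

End AnnulusGeometry.

(** * Small deformations of the annulus *)

Section Deformation.
Variable R : realType.
Local Notation plane := (R * R)%type.
Implicit Types (x y : plane).

Lemma V1_outer (a b : R) x : 0 < a -> a < b -> enorm x = b -> V1 a b x = smul b^-1 x.
Proof. by move=> a0 ab xb; rewrite /V1 xb eqxx normal_outer. Qed.

Lemma V1_inner (a b : R) x : a < b -> enorm x = a -> V1 a b x = 0.
Proof. by move=> ab xa; rewrite /V1 xa lt_eqF. Qed.

(** The field (|x|^2 - a^2) / (b (b^2 - a^2)) x is polynomial; it vanishes on
    the inner circle and equals x / b on the outer one. *)
Lemma V1_extension (a b : R) : 0 < a -> a < b ->
  exists Vh, smooth_extension (annulus a b) (V1 a b) Vh.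
Proof.
move=> a0 ab; have b0 : 0 < b by exact: lt_trans ab.
pose c := (b * (b ^+ 2 - a ^+ 2))^-1.
pose w (x : plane) := c * (x.1 * x.1 + x.2 * x.2 + - a ^+ 2).
have Cw k : Ck k w.
  apply: Ck_mul; first exact: Ck_cst.
  apply: Ck_add; last exact: Ck_cst.
  by apply: Ck_add; apply: Ck_mul; (exact: Ck_fst || exact: Ck_snd).
have ba : 0 < b ^+ 2 - a ^+ 2 by rewrite subr_gt0 ltr_pXn2r// ?nnegrE ltW.
exists (fun x => (w x * x.1, w x * x.2)); split.
  by split=> k; apply: Ck_mul => //; (exact: Ck_fst || exact: Ck_snd).
move=> x; rewrite ebdry_annulus// => -[xa|xb].
  have -> : w x = 0 by rewrite /w -!expr2 -enorm_sq xa subrr mulr0.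
  by rewrite V1_inner// !mul0r.
have -> : w x = b^-1.
  by rewrite /w -!expr2 -enorm_sq xb /c; field; rewrite !gt_eqF.
by rewrite V1_outer.
Qed.

Definition norm1 x : R := `|x.1| + `|x.2|.

Lemma norm1_ge0 x : 0 <= norm1 x. Proof. exact: addr_ge0. Qed.

Lemma enorm_le_norm1 x : enorm x <= norm1 x.
Proof.
rewrite -ler_sqr ?nnegrE ?enorm_ge0 ?norm1_ge0// enorm_sq /norm1.
have h1 : x.1 ^+ 2 = `|x.1| ^+ 2 by rewrite real_normK ?num_real.
have h2 : x.2 ^+ 2 = `|x.2| ^+ 2 by rewrite real_normK ?num_real.
rewrite h1 h2; have := normr_ge0 x.1; have := normr_ge0 x.2; nra.
Qed.

Lemma norm_fst_le x : `|x.1| <= enorm x.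
Proof.
rewrite -ler_sqr ?nnegrE ?enorm_ge0// enorm_sq real_normK ?num_real//.
by rewrite lerDl sqr_ge0.
Qed.

Lemma norm_snd_le x : `|x.2| <= enorm x.
Proof.
rewrite -ler_sqr ?nnegrE ?enorm_ge0// enorm_sq real_normK ?num_real//.
by rewrite lerDr sqr_ge0.
Qed.

Lemma norm1_eq0 x : norm1 x <= 0 -> x = 0.
Proof.
rewrite /norm1 => h; have h1 := normr_ge0 x.1; have h2 := normr_ge0 x.2.
have /normr0_eq0 e1 : `|x.1| = 0 by lra.
have /normr0_eq0 e2 : `|x.2| = 0 by lra.
by rewrite [LHS]surjective_pairing e1 e2.
Qed.

Lemma enorm_near x y : `|enorm x - enorm y| <= norm1 (x - y).
Proof.
have tri (u v : plane) : enorm (u + v) <= enorm u + enorm v.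
  rewrite -ler_sqr ?nnegrE ?addr_ge0 ?enorm_ge0// (sqrrD (enorm u)) !enorm_sq /=.
  suff : u.1 * v.1 + u.2 * v.2 <= enorm u * enorm v by lra.
  have [|h] := leP (u.1 * v.1 + u.2 * v.2) 0.
    by move=> /le_trans; apply; rewrite mulr_ge0 ?enorm_ge0.
  rewrite -ler_sqr ?nnegrE ?mulr_ge0 ?enorm_ge0 ?(ltW h)// exprMn !enorm_sq.
  rewrite -subr_ge0 (_ : _ - _ = (u.1 * v.2 - u.2 * v.1) ^+ 2) ?sqr_ge0//.
  by ring.
have h1 : enorm x <= enorm y + norm1 (x - y).
  by have := tri (x - y) y; rewrite subrK; have := enorm_le_norm1 (x - y); lra.
have h2 : enorm y <= enorm x + norm1 (x - y).
  have := tri (y - x) x; rewrite subrK; have := enorm_le_norm1 (y - x).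
  have -> : norm1 (y - x) = norm1 (x - y) by rewrite /norm1 /= distrC [X in _ + X]distrC.
  by lra.
by rewrite ler_norml; apply/andP; split; lra.
Qed.

Definition box (K : R) : set plane := [set x | `|x.1| <= K /\ `|x.2| <= K].

Lemma compact_box K : compact (box K).
Proof.
have -> : box K = (`[- K, K]%classic `*` `[- K, K]%classic : set plane).
  by apply/seteqP; split => x; rewrite /box /= !in_itv/= !ler_norml.
by apply: compact_setX; exact: segment_compact.
Qed.

Lemma bounded_on_box (f : plane -> R) K : 0 <= K -> continuous f ->
  exists2 M, 0 <= M & forall x, box K x -> `|f x| <= M.
Proof.
move=> K0 cf; have [||c _ H] := @compact_EVT_max plane R (fun x => `|f x|) (box K) _ (@compact_box K).
- by exists 0; rewrite /box /= normr0.
- apply: continuous_subspaceT => x; apply: (@continuous_comp _ _ _ f (fun z : R => `|z|)).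
    exact: cf.
  exact: norm_continuous.
by exists `|f c| => // x bx; apply: H; rewrite inE.
Qed.

(** The intermediate points of [increment_partials] may leave the box, but not
    the box three times as large. *)
Lemma lipschitz_on_box (f : plane -> R) K : 0 <= K -> Ck 1 f ->
  exists2 L, 0 <= L & forall x y, box K x -> box K y -> `|f x - f y| <= L * norm1 (x - y).
Proof.
move=> K0 Cf; have [_ [_ _ [c1 _] [c2 _]]] := Cf.
have K30 : 0 <= 3 * K by lra.
have [M1 M10 H1] := bounded_on_box K30 c1.
have [M2 M20 H2] := bounded_on_box K30 c2.
exists (M1 + M2); first exact: addr_ge0.
move=> y x [y1 y2] [x1 x2].
have [k1 [k2 [h1 h2 ->]]] := increment_partials x y Cf.
have b3 (u v w : R) : `|u| <= K -> `|v| <= K -> `|w - u| <= `|v - u| -> `|w| <= 3 * K.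
  move=> uK vK wu; have hB := ler_normB v u; have hD := ler_normD (w - u) u.
  by rewrite subrK in hD; lra.
apply: le_trans (ler_normD _ _) _; rewrite !normrM mulrDl /norm1 /=.
have B1 : `|partial1 f (k1, y.2)| <= M1.
  by apply: H1; split => /=; [exact: (b3 _ _ _ x1 y1)|lra].
have B2 : `|partial2 f (x.1, k2)| <= M2.
  by apply: H2; split => /=; [lra|exact: (b3 _ _ _ x2 y2)].
have n1 := normr_ge0 (y.1 - x.1); have n2 := normr_ge0 (y.2 - x.2); nra.
Qed.

Definition flow (V : plane -> plane) (t : R) x : plane :=
  (x.1 + t * (V x).1, x.2 + t * (V x).2).

(** For small t the map F = Id + t Vh is a small perturbation of the identity:
    it is injective on a large box and its image contains a large disc. It
    fixes the inner circle pointwise and maps the outer circle to the circle of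
    radius b + t, so by injectivity no other point is sent to these two image
    circles. Moving along a ray, the norm of F cannot cross the values a and b
    + t except on the two circles, so F maps the ring into the target ring, and
    its complement outside. *)
Lemma deform_annulus (a b : R) (Vh : plane -> plane) : 0 < a -> a < b ->
  smooth_extension (annulus a b) (V1 a b) Vh ->
  \forall t \near (0 : R), deform Vh t (annulus a b) = annulus a (b + t).
Proof.
move=> a0 ab [[s1 s2] Vb]; have b0 : 0 < b by exact: lt_trans ab.
have Vouter x : enorm x = b -> Vh x = smul b^-1 x.
  by move=> xb; rewrite Vb ?V1_outer// ebdry_annulus//; right.
have Vinner x : enorm x = a -> Vh x = 0.
  by move=> xa; rewrite Vb ?V1_inner// ebdry_annulus//; left.
pose K := 4 * b; have K0 : 0 <= K by rewrite /K; lra.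
have [L1 L10 HL1] := lipschitz_on_box K0 (s1 1%N).
have [L2 L20 HL2] := lipschitz_on_box K0 (s2 1%N).
have cV1 := Ck_continuous (s1 0%N); have cV2 := Ck_continuous (s2 0%N).
have [M1 M10 HM1] := bounded_on_box K0 cV1.
have [M2 M20 HM2] := bounded_on_box K0 cV2.
pose L := L1 + L2; pose M := M1 + M2.
have lip t x y : box K x -> box K y ->
    norm1 (flow Vh t x - flow Vh t y - (x - y)) <= `|t| * L * norm1 (x - y).
  move=> bx by_; rewrite {1}/norm1 /flow /=.
  rewrite (_ : x.1 + _ - _ - _ = t * ((Vh x).1 - (Vh y).1)); last by ring.
  rewrite (_ : x.2 + _ - _ - _ = t * ((Vh x).2 - (Vh y).2)); last by ring.
  rewrite !normrM -mulrDr -mulrA ler_wpM2l// /L mulrDl.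
  by apply: lerD; [exact: HL1|exact: HL2].
have bnd t x : box K x -> norm1 (flow Vh t x - x) <= `|t| * M.
  move=> bx; rewrite /norm1 /flow /= [x.1 + _]addrC [x.2 + _]addrC !addrK !normrM -mulrDr.
  by rewrite ler_wpM2l// /M lerD ?HM1 ?HM2.
pose e0 := Num.min (a / 4) ((b - a) / 8).
have e00 : 0 < e0 by rewrite lt_min !divr_gt0 ?subr_gt0.
have e0a : e0 <= a / 4 by rewrite ge_min lexx.
have e0b : e0 <= (b - a) / 8 by rewrite ge_min lexx orbT.
have LM0 : 0 < 2 * L + M / e0 + 1 + 1 / e0.
  have : 0 <= M / e0 by apply: divr_ge0; [exact: addr_ge0|exact: ltW].
  have : 0 < 1 / e0 by rewrite divr_gt0.
  have : 0 <= L by rewrite addr_ge0.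
  lra.
exists ((2 * L + M / e0 + 1 + 1 / e0)^-1) => /=; first by rewrite invr_gt0.
move=> t; rewrite /= sub0r normrN -(mul1r _^-1) ltr_pdivlMr// => ht.
have t0 := normr_ge0 t.
have Me : 0 <= M / e0 by apply: divr_ge0; [exact: addr_ge0|exact: ltW].
have L0 : 0 <= L by rewrite addr_ge0.
have tL : `|t| * L <= 1 / 2.
  have : 0 <= `|t| * (M / e0) by rewrite mulr_ge0.
  have : 0 <= `|t| * (1 / e0) by apply: mulr_ge0 => //; apply: divr_ge0 => //; exact: ltW.
  by have : 0 <= `|t| * L; [exact: mulr_ge0|lra].
have tM : `|t| * M <= e0.
  have : 0 <= `|t| * L by rewrite mulr_ge0.
  have : 0 <= `|t| * (1 / e0) by apply: mulr_ge0 => //; apply: divr_ge0 => //; exact: ltW.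
  have e : `|t| * M = `|t| * (M / e0) * e0 by field; rewrite gt_eqF.
  by rewrite e => h1 h2; rewrite ler_piMl ?(ltW e00)//; lra.
have te : `|t| <= e0.
  have h1 : 0 <= `|t| * L by rewrite mulr_ge0.
  have h2 : 0 <= `|t| * (M / e0) by rewrite mulr_ge0.
  have e : `|t| = `|t| * (1 / e0) * e0 by field; rewrite gt_eqF.
  by rewrite e ler_piMl ?(ltW e00)//; lra.
set F := flow Vh t.
have [tlo thi] : - e0 <= t /\ t <= e0 by move: te; rewrite ler_norml => /andP[].
have inj x y : box K x -> box K y -> F x = F y -> x = y.
  move=> bx by_ e; have := lip t x y bx by_; rewrite -/F e subrr sub0r.
  have -> : norm1 (- (x - y)) = norm1 (x - y) by rewrite /norm1 /= !normrN.
  move=> h; apply/eqP; rewrite -subr_eq0; apply/eqP; apply: norm1_eq0.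
  by have := norm1_ge0 (x - y); nra.
have boxE x r : enorm x <= r -> r <= K -> box K x.
  move=> xr rK; split.
    by rewrite (le_trans (norm_fst_le x))// (le_trans xr).
  by rewrite (le_trans (norm_snd_le x))// (le_trans xr).
have cF1 : continuous (fun x : plane => (F x).1).
  by move=> z; apply: cvgD; [exact: cvg_fst|apply: cvgM; [exact: cvg_cst|exact: cV1]].
have cF2 : continuous (fun x : plane => (F x).2).
  by move=> z; apply: cvgD; [exact: cvg_snd|apply: cvgM; [exact: cvg_cst|exact: cV2]].
(* A minimizer c of |F c - y| on the box is a solution: otherwise c - (F c - y)
   would be strictly better, F being a perturbation of the identity with
   Lipschitz constant at most 1 / 2. *)
have surj y : enorm y <= 2 * b -> exists2 x, box K x & F x = y.
  move=> yb; have by_ : box K y by apply: boxE yb _; rewrite /K; lra.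
  have cg : continuous (fun x : plane => norm1 (F x - y)).
    move=> x; apply: cvgD.
      apply: (@continuous_comp _ _ _ (fun x : plane => (F x).1 - y.1) (fun z : R => `|z|)); last exact: norm_continuous.
      by apply: cvgB; [exact: cF1|exact: cvg_cst].
    apply: (@continuous_comp _ _ _ (fun x : plane => (F x).2 - y.2) (fun z : R => `|z|)); last exact: norm_continuous.
    by apply: cvgB; [exact: cF2|exact: cvg_cst].
  have [||c bc Hc] := @compact_EVT_min plane R (fun x => norm1 (F x - y)) (box K) _ (@compact_box K).
  - by exists y.
  - exact: continuous_subspaceT.
  move: bc; rewrite inE => bc.
  pose w := F c - y; pose x' := c - w.
  have wy : norm1 w <= e0.
    by apply: le_trans (Hc y _) _; rewrite ?inE// (le_trans (bnd t y by_)).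
  have cw : norm1 (F c - c) <= e0 by rewrite (le_trans (bnd t c bc)).
  have [w1 w2] : `|w.1| <= norm1 w /\ `|w.2| <= norm1 w.
    by rewrite /norm1; split; rewrite ?lerDl ?lerDr.
  have [f1 f2] : `|(F c - c).1| <= norm1 (F c - c) /\ `|(F c - c).2| <= norm1 (F c - c).
    by rewrite /norm1; split; rewrite ?lerDl ?lerDr.
  have bx' : box K x'.
    have := norm_fst_le y; have := norm_snd_le y => y2 y1.
    have xe1 : x'.1 = y.1 - (F c - c).1 by rewrite /x' /w /=; ring.
    have xe2 : x'.2 = y.2 - (F c - c).2 by rewrite /x' /w /=; ring.
    split; rewrite ?xe1 ?xe2; apply: le_trans (ler_normB _ _) _; rewrite /K; lra.
  have := Hc x' ltac:(by rewrite inE).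
  have -> : F x' - y = F x' - F c - (x' - c).
    by rewrite /x' /w; apply/eqP; rewrite xpair_eqE /=; apply/andP; split; apply/eqP; ring.
  move=> h; have := le_trans h (lip t x' c bx' bc).
  have -> : norm1 (x' - c) = norm1 w.
    by rewrite /x' addrC addKr /norm1 /= !normrN.
  move=> h2; exists c => //; apply/eqP; rewrite -subr_eq0; apply/eqP; apply: norm1_eq0.
  by move: h2; rewrite -/w; have := norm1_ge0 w; nra.
have near_F x : box K x -> `|enorm (F x) - enorm x| <= e0.
  move=> bx; apply: le_trans (enorm_near _ _) _.
  exact: le_trans (bnd t x bx) _.
have Fouter x : enorm x = b -> F x = smul (1 + t / b) x.
  move=> xb; rewrite /F /flow Vouter// /smul /=.
  by congr pair; field; rewrite gt_eqF.
have Finner x : enorm x = a -> F x = x.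
  by move=> xa; rewrite /F /flow Vinner// !mulr0 !addr0 -surjective_pairing.
have bt0 : 0 < b + t by lra.
have tb0 : 0 < 1 + t / b by rewrite -(pmulr_lgt0 _ b0) mulrDl mul1r divfK ?gt_eqF.
have circ_b z : box K z -> enorm (F z) = b + t -> enorm z = b.
  move=> bz Fz; pose z' := smul (1 + t / b)^-1 (F z).
  have z'b : enorm z' = b.
    rewrite enorm_smul gtr0_norm ?invr_gt0// Fz.
    by field; rewrite !gt_eqF//; lra.
  have bz' : box K z' by apply: (boxE _ b); rewrite ?z'b// /K; lra.
  suff -> : z = z' by [].
  apply: inj => //; rewrite (Fouter z')// [LHS]surjective_pairing /z' /smul.
  by congr pair; rewrite [RHS]mulrA divff ?mul1r// gt_eqF.
have circ_a z : box K z -> enorm (F z) = a -> enorm z = a.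
  move=> bz Fz; suff <- : F z = z by [].
  apply: inj => //; last exact: Finner.
  by apply: (boxE _ a); rewrite ?Fz// /K; lra.
clear lip bnd inj HL1 HL2 HM1 HM2 LM0 Me L0 tL tM te ht t0 L10 L20 M10 M20.
have cross x p q v : enorm (F (smul p x)) <= v -> v <= enorm (F (smul q x)) ->
    exists2 c, p <= c <= q \/ q <= c <= p & enorm (F (smul c x)) = v.
  move=> hp hq; pose h (s : R) := enorm (F (smul s x)).
  have ch : continuous h.
    move=> s; apply: (@continuous_comp _ _ _ (fun s => F (smul s x)) (@enorm R)); last exact: continuous_enorm.
    have cs : continuous (fun s : R => smul s x).
      have lin (k : R) : continuous (fun s : R => s * k).
        by move=> u; apply: cvgM; [exact: cvg_id|exact: cvg_cst].
      by move=> u; apply: (cvg_pair (lin x.1 u) (lin x.2 u)).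
    apply: (@continuous_comp _ _ _ (fun s : R => smul s x) F); first exact: cs.
    exact: (cvg_pair (cF1 _) (cF2 _)).
  have [pq|/ltW qp] := leP p q.
    have [|c] := IVT pq (continuous_subspaceT ch) (_ : Num.min (h p) (h q) <= v <= Num.max (h p) (h q)).
      by rewrite ge_min le_max hp hq orbT.
    by rewrite in_itv/= => hc e; exists c => //; left.
  have [|c] := IVT qp (continuous_subspaceT ch) (_ : Num.min (h q) (h p) <= v <= Num.max (h q) (h p)).
    by rewrite ge_min le_max hp hq orbT.
  by rewrite in_itv/= => hc e; exists c => //; right.
rewrite /deform; apply/seteqP; split => [_ [x + <-]|y].
  rewrite !annulusE// /open_ring /= => /andP[ax xb]; rewrite -/(flow Vh t x) -/F.
  have x0 : 0 < enorm x by exact: lt_trans ax.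
  pose s0 := (a + b) / 2 / enorm x.
  have s0x : s0 * enorm x = (a + b) / 2 by rewrite /s0 divfK// gt_eqF.
  have s00 : 0 < s0 by rewrite divr_gt0// divr_gt0// addr_gt0.
  have mid : enorm (smul s0 x) = (a + b) / 2 by rewrite enorm_smul gtr0_norm.
  have := near_F (smul s0 x) ltac:(by apply: (boxE _ b); rewrite ?mid /K; lra).
  rewrite mid ler_norml => /andP[m1 m2].
  have e1 : smul 1 x = x by rewrite /smul !mul1r -surjective_pairing.
  have between c : s0 <= c <= 1 \/ 1 <= c <= s0 -> a < enorm (smul c x) < b.
    move=> hc; have c0 : 0 < c by case: hc => /andP[h1 h2]; lra.
    rewrite enorm_smul gtr0_norm//; case: hc => /andP[h1 h2].
      have : s0 * enorm x <= c * enorm x by rewrite ler_pM2r.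
      have : c * enorm x <= 1 * enorm x by rewrite ler_pM2r.
      by move=> ? ?; apply/andP; split; lra.
    have : c * enorm x <= s0 * enorm x by rewrite ler_pM2r.
    have : 1 * enorm x <= c * enorm x by rewrite ler_pM2r.
    by move=> ? ?; apply/andP; split; lra.
  have bbetween c : s0 <= c <= 1 \/ 1 <= c <= s0 -> box K (smul c x).
    by move=> /between/andP[_ /ltW h]; apply: boxE h _; rewrite /K; lra.
  apply/andP; split; rewrite ltNge; apply/negP => h.
    have [||c hc Fc] := @cross x 1 s0 a; rewrite ?e1//; first by lra.
    have hc' : s0 <= c <= 1 \/ 1 <= c <= s0 by tauto.
    have := between c hc'; rewrite (circ_a _ (bbetween c hc') Fc).
    by rewrite ltxx.
  have [||c hc Fc] := @cross x s0 1 (b + t); rewrite ?e1//; first by lra.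
  have := between c hc; rewrite (circ_b _ (bbetween c hc) Fc).
  by rewrite ltxx andbF.
rewrite annulusE// /open_ring /= => /andP[ay yb].
have [x bx Fx] : exists2 x, box K x & F x = y by apply: surj; lra.
exists x => //; rewrite annulusE// /open_ring /=.
have := near_F x bx; rewrite Fx ler_norml => /andP[n1 n2].
have e1 : smul 1 x = x by rewrite /smul !mul1r -surjective_pairing.
have x2b : enorm x <= 2 * b by lra.
apply/andP; split; rewrite ltNge; apply/negP.
  rewrite le_eqVlt => /orP[/eqP xa|xa].
    by move: ay; rewrite -Fx Finner// xa ltxx.
  have z0 : enorm (smul 0 x) = 0 by rewrite enorm_smul normr0 mul0r.
  have := near_F (smul 0 x) ltac:(by apply: (boxE _ 0); rewrite ?z0 /K; lra).
  rewrite z0 subr0 => /ler_normlP[_ h0].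
  have [||c hc Fc] := @cross x 0 1 a; rewrite ?e1 ?Fx; [lra|exact: ltW|].
  have {}hc : 0 <= c <= 1 by case: hc => // /andP[h1 h2]; apply/andP; split; lra.
  move: hc => /andP[c0 c1].
  have le_c : enorm (smul c x) <= enorm x by rewrite enorm_smul ger0_norm// ler_piMl ?enorm_ge0.
  have := circ_a (smul c x) ltac:(by apply: boxE le_c _; rewrite /K; lra) Fc.
  by lra.
rewrite le_eqVlt => /orP[/eqP xb|xb].
  move: yb; rewrite -Fx Fouter; last by rewrite xb.
  rewrite enorm_smul gtr0_norm// -xb (_ : (1 + t / b) * b = b + t) ?ltxx//.
  by field; rewrite gt_eqF.
have x0 : 0 < enorm x by exact: lt_trans xb.
pose sb := 2 * b / enorm x.
have sbx : sb * enorm x = 2 * b by rewrite /sb divfK// gt_eqF.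
have sb1 : 1 <= sb by rewrite /sb ler_pdivlMr// mul1r.
have z1 : enorm (smul sb x) = 2 * b by rewrite enorm_smul ger0_norm//; lra.
have := near_F (smul sb x) ltac:(by apply: (boxE _ (2 * b)); rewrite ?z1 /K; lra).
rewrite z1 ler_norml => /andP[h1 h2].
have [||c hc Fc] := @cross x 1 sb (b + t); rewrite ?e1 ?Fx; [exact: ltW|lra|].
have {}hc : 1 <= c <= sb by case: hc => // /andP[? ?]; apply/andP; split; lra.
move: hc => /andP[c1 cs].
have ec : enorm (smul c x) = c * enorm x by rewrite enorm_smul ger0_norm//; lra.
have c2b : c * enorm x <= 2 * b by rewrite -sbx ler_pM2r.
have := circ_b (smul c x) ltac:(by apply: (boxE _ (2 * b)); rewrite ?ec// /K; lra) Fc.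
have : 1 * enorm x <= c * enorm x by rewrite ler_pM2r.
by rewrite ec; lra.
Qed.

End Deformation.

(** * Antiderivatives *)

Section Antiderivatives.
Variable R : realType.
Local Notation mu := (@lebesgue_measure R).

Lemma antiderivative (phi : R -> R) (A : R) : continuous phi ->
  exists F : R -> R, forall x : R, A < x -> is_derive x 1 F (phi x).
Proof.
move=> cphi.
have int u : mu.-integrable `[A, u] (EFin \o phi).
  apply: continuous_compact_integrable; first exact: segment_compact.
  exact: continuous_subspaceT.
exists (fun x => (\int[mu]_(t in [set` `[A, x]]) (phi t))%R) => x Ax.
have xu : x < x + 1 by rewrite ltrDl.
have [d e] := continuous_FTC1_closed xu (int _) Ax (cphi x).
by rewrite -e derive1E; apply: derivableP.
Qed.

(** Antiderivatives on two overlapping half-lines, the second one for the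
    reflected function, differ by a constant on the overlap and are glued at
    0. *)
Lemma global_antiderivative (phi : R -> R) : continuous phi ->
  exists F : R -> R, forall x : R, is_derive x 1 F (phi x).
Proof.
move=> cphi; have cN : continuous (fun x => phi (- x)).
  by move=> x; apply: (@continuous_comp _ _ _ (@GRing.opp R) phi); [exact: oppr_continuous|exact: cphi].
have [G dG] := antiderivative (- 2) cphi; have [H dH] := antiderivative (- 2) cN.
pose K x := G 0 + H 0 - H (- x).
have dK (x : R) : x < 2 -> is_derive x 1 K (phi x).
  move=> x2; have dN : is_derive x 1 (fun y : R => - y) (-1) by apply: is_derive_eq.
  have d1 : is_derive (- x) 1 H (phi (- - x)) by apply: dH; lra.
  have d2 := @is_derive1_comp _ H (fun y : R => - y) x _ _ d1 dN.
  by apply: is_derive_eq; rewrite opprK /GRing.scale/=; ring.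
pose F x := if 0 < x then G x else K x.
have FK x : x < 2 -> F x = K x.
  move=> x2; rewrite /F; case: ltP => // x0.
  have [y y0x|c _] := @mvt_cc R (fun y => G y - K y) (fun=> 0) 0 x (ltW x0).
    have y1 : - 2 < y by lra.
    have y2 : y < 2 by lra.
    have e1 := dG _ y1; have e2 := dK _ y2.
    by apply: is_derive_eq; rewrite subrr.
  rewrite mul0r /K oppr0; lra.
exists F => x; have [x0|x0] := ltP 0 x.
  have dx : is_derive x 1 G (phi x) by apply: dG; lra.
  apply: near_eq_is_derive dx; near=> y; rewrite /F ifT//.
  by near: y; exact: lt_nbhsr.
have x2 : x < 2 by lra.
apply: near_eq_is_derive (dK _ x2); near=> y; rewrite FK//.
by near: y; exact: lt_nbhsl.
Unshelve. all: by end_near. Qed.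

Lemma integral_derivative (F phi : R -> R) (a b : R) : a < b -> continuous phi ->
  (forall x : R, a <= x <= b -> is_derive x 1 F (phi x)) ->
  (\int[mu]_(x in (`]a, b[%classic : set (measurableTypeR R))) (phi x)%:E = (F b - F a)%:E)%E.
Proof.
move=> ab cphi dF; rewrite -(@integral_itv_bndoo _ _ _ _ true false); last first.
  apply/measurable_EFinP; apply: measurable_funTS.
  exact: continuous_measurable_fun.
have cF : {within `[a, b], continuous F}.
  apply: derivable_within_continuous => x; rewrite in_itv/= => /dF dFx.
  exact: ex_derive.
rewrite (@continuous_FTC2 _ phi F)// ?EFinB//.
- exact: continuous_subspaceT.
- split.
  + move=> x; rewrite in_itv/= => /andP[/ltW ax /ltW xb].
    by have [] := dF x (introT andP (conj ax xb)).
  + have [H _] : (F @ a^'+ --> F a) /\ (F @ b^'- --> F b).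
      by have /(continuous_within_itvP _ ab)[] := cF.
    exact: H.
  + by have /(continuous_within_itvP _ ab)[] := cF.
- move=> x; rewrite in_itv/= => /andP[/ltW ax /ltW xb].
  by rewrite derive1E; have dFx := dF x (introT andP (conj ax xb)); rewrite derive_val.
Qed.

(** The derivative may fail to be integrable, so the increment is compared with
    that of an antiderivative of the dominating function. *)
Lemma integral_ge_increment (G G' phi : R -> R) (a b : R) : a < b -> continuous phi ->
  (forall x : R, a <= x <= b -> is_derive x 1 G (G' x)) ->
  (forall x, a <= x <= b -> G' x <= phi x) ->
  ((G b - G a)%:E <= \int[mu]_(x in (`]a, b[%classic : set (measurableTypeR R))) (phi x)%:E)%E.
Proof.
move=> ab cphi dG Gphi; have [F dF] := antiderivative (a - 1) cphi.
have dF' x : a <= x <= b -> is_derive x 1 F (phi x).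
  by move=> /andP[ax xb]; apply: dF; lra.
rewrite (integral_derivative ab cphi dF') lee_fin.
have : F a - G a <= F b - G b.
  apply: (@ndecr_cc R (fun x => F x - G x) (fun x => phi x - G' x)) => [|x xab|x xab].
  - exact: ltW.
  - by have d1 := dF' x xab; have d2 := dG x xab; exact: is_deriveB.
  - by rewrite subr_ge0 Gphi.
lra.
Qed.

End Antiderivatives.

(** * Lower bound from a radial supersolution *)

Section LowerBound.
Variable R : realType.
Local Notation rT := (measurableTypeR R).
Local Notation plane := (R * R)%type.
Local Notation mplane := (measurableTypeR R * measurableTypeR R)%type.
Local Notation mu := (@lebesgue_measure R).

(** With f = u' / u for a radial u > 0, the differential inequality says that
    the Laplacian of u is at most [kappa u], and the end conditions say that
    its outward derivative is at least [alpha u] on both circles. *)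
Definition riccati_super (alpha kappa a b : R) (f : R -> R) :=
  exists f' : R -> R, [/\
    forall r : R, a <= r <= b -> is_derive r 1 f (f' r),
    forall r, a <= r <= b -> f' r + f r ^+ 2 + f r / r <= kappa,
    f a <= - alpha & alpha <= f b].

(** By completing the square, the Riccati inequality makes the derivative of r
    f h^2 at most r (h'^2 + kappa h^2). Integrating between a and b, the end
    conditions on f produce the boundary term. *)
Lemma ray_inequality (alpha kappa a b : R) (f h h' psi : R -> R) : 0 < a -> a < b ->
  riccati_super alpha kappa a b f ->
  (forall r : R, is_derive r 1 h (h' r)) -> continuous psi ->
  (forall r, a <= r <= b -> r * (h' r ^+ 2 + kappa * h r ^+ 2) <= psi r) ->
  ((alpha * (b * h b ^+ 2 + a * h a ^+ 2))%:E <=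
    \int[mu]_(r in (`]a, b[%classic : set rT)) (psi r)%:E)%E.
Proof.
move=> a0 ab [f' [df fk fa fb]] dh cpsi hpsi.
pose G r := r * f r * h r ^+ 2.
pose G' r := (f r + r * f' r) * h r ^+ 2 + r * f r * (2 * h r * h' r).
have dG r : a <= r <= b -> is_derive r 1 G (G' r).
  move=> rab; have d1 := df r rab; have d2 := dh r.
  by apply: is_derive_eq; rewrite /G' /GRing.scale/=; ring.
have Gpsi r : a <= r <= b -> G' r <= psi r.
  move=> /[dup] rab /andP[ar rb]; have r0 : 0 < r by exact: lt_le_trans ar.
  apply: le_trans (hpsi r rab); rewrite -subr_ge0.
  have -> : r * (h' r ^+ 2 + kappa * h r ^+ 2) - G' r = r * ((h' r - f r * h r) ^+ 2 +
      (kappa - (f' r + f r ^+ 2 + f r / r)) * h r ^+ 2).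
    by rewrite /G'; field; rewrite gt_eqF.
  apply: mulr_ge0; first exact: ltW.
  by rewrite addr_ge0 ?sqr_ge0// mulr_ge0 ?sqr_ge0// subr_ge0 fk.
apply: le_trans (integral_ge_increment ab cpsi dG Gpsi).
have b0 : 0 < b by exact: lt_trans ab.
have h1 : alpha * (b * h b ^+ 2) <= f b * (b * h b ^+ 2).
  by rewrite ler_wpM2r// mulr_ge0 ?(ltW b0)// sqr_ge0.
have h2 : f a * (a * h a ^+ 2) <= - alpha * (a * h a ^+ 2).
  by rewrite ler_wpM2r// mulr_ge0 ?(ltW a0)// sqr_ge0.
rewrite lee_fin /G; lra.
Qed.

Lemma polar_line (r t : R) : polar r t = (0 + r * cos t, 0 + r * sin t).
Proof. by rewrite !add0r. Qed.

Lemma polar_N_line (r t : R) : polar (- r) t = (0 + r * - cos t, 0 + r * - sin t).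
Proof. by rewrite !add0r /polar !mulrN !mulNr. Qed.

(** The derivative of phi along the ray is at most the norm of its gradient. *)
Lemma radial_inequality (alpha kappa a b : R) (f : R -> R) (phi : plane -> R) (v : plane) :
  0 < a -> a < b -> riccati_super alpha kappa a b f -> Ck 1 phi ->
  v.1 ^+ 2 + v.2 ^+ 2 = 1 ->
  ((alpha * (b * phi (0 + b * v.1, 0 + b * v.2)%R ^+ 2 +
             a * phi (0 + a * v.1, 0 + a * v.2)%R ^+ 2))%:E <=
    \int[mu]_(r in (`]a, b[%classic : set rT))
      (r * (partial1 phi (0 + r * v.1, 0 + r * v.2)%R ^+ 2 +
            partial2 phi (0 + r * v.1, 0 + r * v.2)%R ^+ 2 +
            kappa * phi (0 + r * v.1, 0 + r * v.2)%R ^+ 2))%:E)%E.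
Proof.
move=> a0 ab fsup Cphi v1; have [cphi [_ _ [c1 _] [c2 _]]] := Cphi.
pose l (r : R) : plane := (0 + r * v.1, 0 + r * v.2).
have cl : continuous l.
  have lin (k : R) : continuous (fun s : R => 0 + s * k).
    by move=> u; apply: cvgD; [exact: cvg_cst|apply: cvgM; [exact: cvg_id|exact: cvg_cst]].
  by move=> u; exact: (cvg_pair (lin v.1 u) (lin v.2 u)).
have comp (g : plane -> R) : continuous g -> continuous (g \o l).
  by move=> cg u; apply: continuous_comp; [exact: cl|exact: cg].
pose h := phi \o l; pose h' r := v.1 * partial1 phi (l r) + v.2 * partial2 phi (l r).
have dh (r : R) : is_derive r 1 h (h' r) by exact: (@is_derive_line R phi (0, 0) v r Cphi).
have ch' : continuous h'.
  move=> r; apply: cvgD; apply: cvgM; try exact: cvg_cst; exact: comp.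
have cd1 := comp _ c1; have cd2 := comp _ c2; have ch : continuous h := comp _ cphi.
apply: (ray_inequality a0 ab fsup dh) => [r|r /andP[ar _]].
  apply: cvgM; first exact: cvg_id.
  apply: cvgD; last by apply: cvgM; [exact: cvg_cst|apply: cvgM; exact: ch].
  by apply: cvgD; [apply: cvgM; exact: cd1|apply: cvgM; exact: cd2].
have r0 : 0 <= r by rewrite (le_trans _ ar)// ltW.
rewrite ler_wpM2l// lerD2r /h' -/(l r) -subr_ge0.
have -> : partial1 phi (l r) ^+ 2 + partial2 phi (l r) ^+ 2 -
    (v.1 * partial1 phi (l r) + v.2 * partial2 phi (l r)) ^+ 2 =
    (v.2 * partial1 phi (l r) - v.1 * partial2 phi (l r)) ^+ 2 +
    (1 - (v.1 ^+ 2 + v.2 ^+ 2)) * (partial1 phi (l r) ^+ 2 + partial2 phi (l r) ^+ 2) by ring.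
by rewrite v1 subrr mul0r addr0 sqr_ge0.
Qed.

(** The bounds of the inner integral are absorbed in an indicator function so
    that Tonelli applies to a product integrand. *)
Lemma measurable_radial_integral (a b : R) (g : mplane -> \bar R) : (0 <= a)%R ->
  measurable_fun setT g -> (forall z, 0 <= g z)%E ->
  measurable_fun [set: rT] (fun t : rT => \int[mu]_(r in (`]a, b[%classic : set rT))
     (r%:E * (g (polar r t) + g (polar (- r) t))))%E.
Proof.
move=> a0 mg g0.
pose I : set rT := `]a, b[%classic.
have mI : measurable I by exact: measurable_itv.
pose h (z : rT * rT) : \bar R :=
  (((\1_I z.2 * `|z.2|)%R)%:E * (g (polar z.2 z.1) + g (polar (- z.2) z.1)))%E.
have h0 z : (0 <= h z)%E.
  by rewrite mule_ge0 ?adde_ge0// lee_fin mulr_ge0.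
have mcos : measurable_fun [set: rT] (@cos R) by apply: continuous_measurable_fun; exact: continuous_cos.
have msin : measurable_fun [set: rT] (@sin R) by apply: continuous_measurable_fun; exact: continuous_sin.
have mpol (c : R) : measurable_fun [set: rT * rT] (fun z : rT * rT => polar (c * z.2) z.1 : mplane).
  apply: measurable_fun_pair; apply: measurable_funM.
  - by apply: measurable_funM => //; exact: measurable_snd.
  - by apply: (measurableT_comp mcos); exact: measurable_fst.
  - by apply: measurable_funM => //; exact: measurable_snd.
  - by apply: (measurableT_comp msin); exact: measurable_fst.
have mh : measurable_fun [set: rT * rT] h.
  apply: emeasurable_funM.
    apply/measurable_EFinP; apply: measurable_funM.
      by apply: measurableT_comp; [exact: measurable_indic|exact: measurable_snd].
    by apply: measurableT_comp; [exact: normr_measurable|exact: measurable_snd].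
  apply: emeasurable_funD.
    have := measurableT_comp mg (mpol 1); apply: eq_measurable_fun => z _ /=.
    by rewrite mul1r.
  have := measurableT_comp mg (mpol (-1)); apply: eq_measurable_fun => z _ /=.
  by rewrite mulN1r.
have := @measurable_fun_fubini_tonelli_F _ _ _ _ _ mu h mh h0.
apply: eq_measurable_fun => t _; rewrite /fubini_F [RHS]integral_mkcond.
apply: eq_integral => r _; rewrite /h /= patchE indicE.
case: ifPn => rI; last by rewrite mul0r mul0e.
rewrite mul1r ger0_norm//; move: rI; rewrite inE /I /= in_itv/= => /andP[ar _].
by rewrite (le_trans a0)// ltW.
Qed.

Definition energy_density (kappa : R) (phi : plane -> R) (z : plane) : R :=
  partial1 phi z ^+ 2 + partial2 phi z ^+ 2 + kappa * phi z ^+ 2.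

(** The inequality on rays is integrated over the angles, in polar
    coordinates. *)
Lemma robin_inequality_C1 (alpha kappa a b : R) (f : R -> R) (phi : plane -> R) :
  0 < a -> a < b -> 0 <= kappa -> 0 <= alpha -> riccati_super alpha kappa a b f -> Ck 1 phi ->
  (alpha%:E * sqint (@arclength R) (circles a b) phi <=
   \int[@area R]_(z in (open_ring a b : set mplane)) (energy_density kappa phi z)%:E)%E.
Proof.
move=> a0 ab k0 al0 fsup Cphi; have b0 : 0 < b by exact: lt_trans ab.
have [cphi [_ _ [c1 _] [c2 _]]] := Cphi.
have mphi := continuous_measurable_plane cphi.
have m1 := continuous_measurable_plane c1; have m2 := continuous_measurable_plane c2.
have mE : measurable_fun [set: mplane] (energy_density kappa phi : mplane -> R).
  apply: measurable_funD; last by apply: measurable_funM => //; exact: measurable_funX.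
  exact: (measurable_funD (measurable_funX 2 m1) (measurable_funX 2 m2)).
have E0 z : 0 <= energy_density kappa phi z.
  by rewrite !addr_ge0 ?sqr_ge0// mulr_ge0// sqr_ge0.
rewrite /sqint integral_circles//; last 2 first.
- by apply/measurable_EFinP; apply: measurable_funTS; exact: measurable_funX.
- by move=> x _; rewrite lee_fin sqr_ge0.
rewrite area_ring_polar//; last 3 first.
- exact: ltW.
- by apply/measurable_EFinP; exact: measurable_funTS.
- by move=> x _; rewrite lee_fin.
have mpol r : measurable_fun [set: rT] (fun t : rT => phi (polar r t) ^+ 2).
  apply: measurable_funX; apply: (measurableT_comp mphi).
  exact: measurable_polar.
pose bd t := a * (phi (polar a t) ^+ 2 + phi (polar (- a) t) ^+ 2) +
             b * (phi (polar b t) ^+ 2 + phi (polar (- b) t) ^+ 2).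
have mbd : measurable_fun [set: rT] bd.
  by apply: measurable_funD; apply: measurable_funM => //; apply: measurable_funD.
have bd0 t : 0 <= bd t.
  by apply: addr_ge0; apply: mulr_ge0; rewrite ?addr_ge0 ?sqr_ge0 ?(ltW a0) ?(ltW b0).
rewrite [X in (_ * X <= _)%E](_ : _ = \int[mu]_(t in (angles : set rT)) (bd t)%:E)%E; last first.
  by apply: eq_integral => t _; rewrite /bd !EFinD !EFinM !EFinD.
rewrite -ge0_integralZl//; last 3 first.
- exact: measurable_angles.
- by apply/measurable_EFinP; exact: measurable_funTS.
- by move=> t _; rewrite lee_fin.
have mEpol t : measurable_fun [set: rT] (fun r : rT => energy_density kappa phi (polar r t)).
  by apply: (measurableT_comp mE); exact: measurable_polar_radius.
have mEpolN t : measurable_fun [set: rT] (fun r : rT => energy_density kappa phi (polar (- r) t)).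
  by apply: (measurableT_comp (mEpol t)); exact: oppr_measurable.
apply: ge0_le_integral.
- exact: measurable_angles.
- by move=> t _; rewrite mule_ge0// lee_fin.
- apply: measurable_funeM; apply/measurable_EFinP; exact: measurable_funTS.
- apply: measurable_funTS; apply: (@measurable_radial_integral a b (fun z => (energy_density kappa phi z)%:E)).
  + exact: ltW.
  + exact/measurable_EFinP.
  + by move=> z; rewrite lee_fin.
move=> t _.
have cs1 : (cos t, sin t).1 ^+ 2 + (cos t, sin t).2 ^+ 2 = 1 by exact: cos2Dsin2.
have cs2 : (- cos t, - sin t).1 ^+ 2 + (- cos t, - sin t).2 ^+ 2 = 1.
  by rewrite /= !sqrrN cos2Dsin2.
have I1 := radial_inequality a0 ab fsup Cphi cs1.
have I2 := radial_inequality a0 ab fsup Cphi cs2.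
rewrite [leRHS](_ : _ = (\int[mu]_(r in (`]a, b[%classic : set rT)) (r * energy_density kappa phi (polar r t))%:E
   + \int[mu]_(r in (`]a, b[%classic : set rT)) (r * energy_density kappa phi (polar (- r) t))%:E)%E); last first.
  rewrite -ge0_integralD//.
  - by apply: eq_integral => r _; rewrite -EFinD -EFinM mulrDr EFinD.
  - move=> r; rewrite /= in_itv/= => /andP[ar _]; rewrite lee_fin mulr_ge0//.
    by rewrite (le_trans (ltW a0))// ltW.
  - by apply/measurable_EFinP; apply: measurable_funTS; exact: measurable_funM.
  - move=> r; rewrite /= in_itv/= => /andP[ar _]; rewrite lee_fin mulr_ge0//.
    by rewrite (le_trans (ltW a0))// ltW.
  - by apply/measurable_EFinP; apply: measurable_funTS; exact: measurable_funM.
under [X in (_ <= X + _)%E]eq_integral do rewrite /energy_density polar_line.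
under [X in (_ <= _ + X)%E]eq_integral do rewrite /energy_density polar_N_line.
apply: le_trans (leeD I1 I2) => /=.
rewrite -!polar_line -!polar_N_line -EFinD -EFinM lee_fin /bd; lra.
Qed.

End LowerBound.

Section TraceLimit.
Variable R : realType.
Local Notation rT := (measurableTypeR R).
Local Notation plane := (R * R)%type.
Local Notation mplane := (measurableTypeR R * measurableTypeR R)%type.
Local Notation mu := (@lebesgue_measure R).

Lemma sqint_ge0 (m : {measure set mplane -> \bar R}) (D : set mplane) f : (0 <= sqint m D f)%E.
Proof. by apply: integral_ge0 => x _; rewrite lee_fin sqr_ge0. Qed.

(** Young's inequality 2 u v <= e u^2 + v^2 / e. It is used in both directions
    to compare squared norms of a function and of an approximation. *)
Lemma sqint_perturb (m : {measure set mplane -> \bar R}) (D : set mplane)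
    (f g : mplane -> R) (e : R) : 0 < e -> measurable D ->
  measurable_fun D f -> measurable_fun D g ->
  (sqint m D f <= (1 + e)%:E * sqint m D g +
                  (1 + e^-1)%:E * sqint m D (fun x => f x - g x)%R)%E.
Proof.
move=> e0 mD mf mg; have ei : 0 < e^-1 by rewrite invr_gt0.
have msq (h : mplane -> R) : measurable_fun D h ->
    measurable_fun D (fun x => (h x ^+ 2)%:E).
  by move=> mh; apply/measurable_EFinP; exact: measurable_funX.
have mfg : measurable_fun D (fun x => f x - g x) by exact: measurable_funB.
rewrite /sqint -!ge0_integralZl//; last 6 first.
- exact: msq.
- by move=> x _; rewrite lee_fin sqr_ge0.
- by rewrite lee_fin; lra.
- exact: msq.
- by move=> x _; rewrite lee_fin sqr_ge0.
- by rewrite lee_fin; lra.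
rewrite -ge0_integralD//; last 4 first.
- by move=> x _; rewrite -EFinM lee_fin mulr_ge0 ?sqr_ge0//; lra.
- by apply: measurable_funeM; exact: msq.
- by move=> x _; rewrite -EFinM lee_fin mulr_ge0 ?sqr_ge0//; lra.
- by apply: measurable_funeM; exact: msq.
apply: ge0_le_integral => //.
- by move=> x _; rewrite lee_fin sqr_ge0.
- exact: msq.
- by apply: emeasurable_funD; apply: measurable_funeM; exact: msq.
move=> x _; rewrite -!EFinM -EFinD lee_fin -subr_ge0.
set u := f x; set v := g x.
have -> : (1 + e) * v ^+ 2 + (1 + e^-1) * (u - v) ^+ 2 - u ^+ 2 =
    e^-1 * (e * v - (u - v)) ^+ 2 by field; rewrite gt_eqF.
by rewrite mulr_ge0 ?sqr_ge0// ltW.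
Qed.

Lemma sqint_arclength (a b : R) (w : mplane -> R) : 0 < a -> a < b ->
  sqint (@arclength R) (circles a b) w = sqint (two_circles a b) (circles a b) w.
Proof.
move=> a0 ab; apply: eq_set_function_integral => A mA AD.
exact: arclength_circles.
Qed.

Lemma cvg0_lt (u : nat -> \bar R) (d : R) : u n @[n --> \oo] --> (0%E : \bar R) ->
  0 < d -> \forall n \near \oo, (u n < d%:E)%E.
Proof.
move=> cu d0; have H : ereal_nbhs (0%E : \bar R) (fun u => (u < d%:E)%E).
  by apply: open_ereal_lt'; rewrite lte_fin.
exact: (cu _ H).
Qed.

(** The inequality for C^1 functions passes to the limit along the sequence
    that defines the trace: by [sqint_perturb] the approximation multiplies
    each quadratic term by 1 + e, up to a term that tends to 0 with the
    distance, and then e tends to 0. *)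
Theorem robin_lower_bound (alpha kappa a b : R) (f : R -> R) : 0 < a -> a < b ->
  0 <= alpha -> 0 <= kappa -> riccati_super alpha kappa a b f ->
  ((- kappa)%:E <= robin_lambda1 alpha (annulus a b))%E.
Proof.
move=> a0 ab al0 k0 fsup; apply: le_ereal_inf_tmp => _ [v [g [w [Hv Tv v0 ->]]]].
rewrite lee_fin /robin_quotient.
have mA := @measurable_open_ring R a b; have mC := @measurable_circles R a b.
move: Hv Tv v0; rewrite /H1 /trace ebdry_annulus// annulusE//.
move=> [[mv vfin] [mg1 g1fin] [mg2 g2fin] _] [[mw wfin] [phi [Cphi cv c1 c2 cw]]] v0.
rewrite sqint_arclength// in wfin *.
set A : set mplane := open_ring a b in mA mv vfin mg1 g1fin mg2 g2fin cv c1 c2 v0 *.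
set C : set mplane := circles a b in mC mw wfin cw *.
set bd := two_circles a b in wfin *.
have dotE : (\int[@area R]_(x in A) (dotp (g x) (g x))%:E =
    sqint (@area R) A (fun x => (g x).1) + sqint (@area R) A (fun x => (g x).2))%E.
  rewrite /sqint -ge0_integralD//; last 4 first.
  - by move=> x _; rewrite lee_fin sqr_ge0.
  - by apply/measurable_EFinP; exact: measurable_funX.
  - by move=> x _; rewrite lee_fin sqr_ge0.
  - by apply/measurable_EFinP; exact: measurable_funX.
rewrite dotE.
have fin (m : {measure set mplane -> \bar R}) D h : (sqint m D h < +oo)%E -> sqint m D h \is a fin_num.
  by move=> h1; rewrite ge0_fin_numE// sqint_ge0.
pose N := fine (sqint (@area R) A v); pose G1 := fine (sqint (@area R) A (fun x => (g x).1)).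
pose G2 := fine (sqint (@area R) A (fun x => (g x).2)); pose W := fine (sqint bd C w).
have NE : sqint (@area R) A v = N%:E by rewrite fineK// fin.
have G1E : sqint (@area R) A (fun x => (g x).1) = G1%:E by rewrite fineK// fin.
have G2E : sqint (@area R) A (fun x => (g x).2) = G2%:E by rewrite fineK// fin.
have WE : sqint bd C w = W%:E by rewrite fineK// fin.
rewrite NE G1E G2E WE /=.
have N0 : 0 <= N by rewrite -lee_fin -NE sqint_ge0.
have G10 : 0 <= G1 by rewrite -lee_fin -G1E sqint_ge0.
have G20 : 0 <= G2 by rewrite -lee_fin -G2E sqint_ge0.
have W0 : 0 <= W by rewrite -lee_fin -WE sqint_ge0.
have Np : 0 < N by rewrite lt_neqAle N0 andbT eq_sym -eqe -NE.
(* The Robin inequality for one approximating C^1 function, with a loss e coming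
   from the quadratic terms and d from the distance to the limit. *)
have key e d : 0 < e -> 0 < d ->
    alpha * W <= (1 + e) ^+ 2 * (G1 + G2 + kappa * N) +
      ((1 + e) * (1 + e^-1) * (2 + kappa) + alpha * (1 + e^-1)) * d.
  move=> e0 d0; have ei : 0 < e^-1 by rewrite invr_gt0.
  rewrite /L2_cvg in cv c1 c2 cw.
  have [n [n1 n2 n3 n4]] : exists n, [/\
      (sqint (@area R) A (fun x => (phi n x - v x)%R) < d%:E)%E,
      (sqint (@area R) A (fun x => (partial1 (phi n) x - (g x).1)%R) < d%:E)%E,
      (sqint (@area R) A (fun x => (partial2 (phi n) x - (g x).2)%R) < d%:E)%E &
      (sqint (@arclength R) C (fun x => (phi n x - w x)%R) < d%:E)%E].
    have F1 := @cvg0_lt (fun n => sqint (@area R) A (fun x => phi n x - v x)) d cv d0.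
    have F2 := @cvg0_lt (fun n => sqint (@area R) A (fun x => partial1 (phi n) x - (g x).1)) d c1 d0.
    have F3 := @cvg0_lt (fun n => sqint (@area R) A (fun x => partial2 (phi n) x - (g x).2)) d c2 d0.
    have F4 := @cvg0_lt (fun n => sqint (@arclength R) C (fun x => phi n x - w x)) d cw d0.
    have := filter_ex (filterI (filterI F1 F2) (filterI F3 F4)).
    by move=> [n [[? ?] [? ?]]]; exists n; split.
  have [cphi [_ _ [cp1 _] [cp2 _]]] := Cphi n.
  have mphi : measurable_fun [set: mplane] (phi n : mplane -> R) := continuous_measurable_plane cphi.
  have mp1 : measurable_fun [set: mplane] (partial1 (phi n) : mplane -> R) := continuous_measurable_plane cp1.
  have mp2 : measurable_fun [set: mplane] (partial2 (phi n) : mplane -> R) := continuous_measurable_plane cp2.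
  have restr (h : mplane -> R) D : measurable_fun [set: mplane] h -> measurable_fun D h.
    by move=> mh; exact: measurable_funTS.
  rewrite sqint_arclength// in n4.
  have up (m : {measure set mplane -> \bar R}) (D : set mplane) (h k : mplane -> R) (K : R) :
      measurable D -> measurable_fun D h -> measurable_fun D k ->
      sqint m D k = K%:E -> (sqint m D (fun x => h x - k x)%R < d%:E)%E ->
      exists2 H : R, sqint m D h = H%:E & H <= (1 + e) * K + (1 + e^-1) * d.
    move=> mD mh mk kK hk.
    have hle : (sqint m D h <= ((1 + e) * K + (1 + e^-1) * d)%:E)%E.
      apply: le_trans (sqint_perturb m e0 mD mh mk) _.
      rewrite kK [leRHS]EFinD [X in (_ <= X + _)%E]EFinM [X in (_ <= _ + X)%E]EFinM.
      by apply: leeD2l; rewrite lee_pmul2l ?lte_fin ?ltW//; lra.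
    have hfin : sqint m D h \is a fin_num by apply: fin; apply: le_lt_trans hle (ltry _).
    by exists (fine (sqint m D h)); rewrite ?fineK// -lee_fin fineK.
  have [F0 F0E F0le] := up (@area R) A _ _ _ mA (restr _ A mphi) mv NE n1.
  have [F1 F1E F1le] := up (@area R) A _ _ _ mA (restr _ A mp1) mg1 G1E n2.
  have [F2 F2E F2le] := up (@area R) A _ _ _ mA (restr _ A mp2) mg2 G2E n3.
  have [B BE Ble] := up bd C _ _ _ mC (restr _ C mphi) mw WE n4.
  have Wle : W <= (1 + e) * B + (1 + e^-1) * d.
    rewrite -lee_fin -WE; apply: le_trans (sqint_perturb bd e0 mC mw (restr _ C mphi)) _.
    rewrite BE [leRHS]EFinD [X in (_ <= X + _)%E]EFinM [X in (_ <= _ + X)%E]EFinM.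
    apply: leeD2l; rewrite lee_pmul2l ?lte_fin//; last by lra.
    apply: le_trans (ltW n4); rewrite /sqint le_eqVlt; apply/orP; left; apply/eqP.
    by apply: eq_integral => x _; rewrite -[in RHS]sqrrN opprB.
  have := @robin_inequality_C1 R alpha kappa a b f (phi n) a0 ab k0 al0 fsup (Cphi n).
  rewrite sqint_arclength// -/bd -/C BE -EFinM.
  rewrite [leRHS](_ : _ = (F1 + F2 + kappa * F0)%:E); last first.
    rewrite !EFinD EFinM -F0E -F1E -F2E /sqint -ge0_integralZl//; last 2 first.
    - by apply/measurable_EFinP; apply: restr; exact: measurable_funX.
    - by move=> x _; rewrite lee_fin sqr_ge0.
    have msq (h : mplane -> R) : measurable_fun [set: mplane] h ->
        measurable_fun A (fun x => (h x ^+ 2)%:E).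
      by move=> mh; apply/measurable_EFinP; apply: restr; exact: measurable_funX.
    rewrite -ge0_integralD//; last 4 first.
    - by move=> x _; rewrite lee_fin sqr_ge0.
    - exact: msq.
    - by move=> x _; rewrite lee_fin sqr_ge0.
    - exact: msq.
    rewrite -ge0_integralD//; last 4 first.
    - by move=> x _; rewrite -EFinD lee_fin addr_ge0 ?sqr_ge0.
    - by apply: emeasurable_funD; exact: msq.
    - by move=> x _; rewrite -EFinM lee_fin mulr_ge0 ?sqr_ge0.
    - by apply: measurable_funeM; exact: msq.
  rewrite lee_fin => hB.
  set c := 1 + e^-1 in F0le F1le F2le Ble Wle *.
  have c0 : 0 < c by rewrite addr_gt0.
  have e10 : 0 <= 1 + e by rewrite ltW// addr_gt0.
  have h1 : alpha * W <= alpha * ((1 + e) * B + c * d) by rewrite ler_wpM2l.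
  have h2 : (1 + e) * (alpha * B) <= (1 + e) * (F1 + F2 + kappa * F0).
    rewrite ler_wpM2l//; clear -hB; lra.
  have h3 : kappa * F0 <= kappa * ((1 + e) * N + c * d) by rewrite ler_wpM2l.
  have h4 : (1 + e) * (F1 + F2 + kappa * F0) <=
      (1 + e) * ((1 + e) * (G1 + G2 + kappa * N) + c * (2 + kappa) * d).
    rewrite ler_wpM2l//; clear -F1le F2le F0le h3; lra.
  clear -h1 h2 h4; rewrite expr2; lra.
have key2 e : 0 < e -> alpha * W <= (1 + e) ^+ 2 * (G1 + G2 + kappa * N).
  move=> e0; apply/ler_addgt0Pr => d d0.
  set c := (1 + e) * (1 + e^-1) * (2 + kappa) + alpha * (1 + e^-1).
  have ei : 0 < e^-1 by rewrite invr_gt0.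
  have c0 : 0 < c.
    apply: ltr_pwDl; last by rewrite mulr_ge0// addr_ge0// ltW.
    by rewrite mulr_gt0 ?ltr_pwDl// mulr_gt0 ?addr_gt0.
  have := key e (d / c) e0 (divr_gt0 d0 c0).
  by rewrite -/c [c * _]mulrC divfK// gt_eqF.
have X0 : 0 <= G1 + G2 + kappa * N by rewrite !addr_ge0// mulr_ge0.
have fin_key : alpha * W <= G1 + G2 + kappa * N.
  apply/ler_addgt0Pr => d d0.
  pose X := G1 + G2 + kappa * N.
  pose e := Num.min 1 (d / (3 * (X + 1))).
  have X1 : 0 < 3 * (X + 1) by rewrite /X; lra.
  have e0 : 0 < e by rewrite lt_min ltr01 divr_gt0.
  have e1 : e <= 1 by rewrite ge_min lexx.
  have ed : e * (3 * (X + 1)) <= d by rewrite -ler_pdivlMr// ge_min lexx orbT.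
  have := key2 e e0; rewrite -/X => h; apply: (le_trans h).
  have ee : e * e * X <= e * X by rewrite -mulrA ler_piMl// mulr_ge0 ?(ltW e0).
  rewrite expr2; lra.
by rewrite ler_pdivlMr//; lra.
Qed.

End TraceLimit.

(** * Integration by parts on the ring *)

Section IntegrationByParts.
Variable R : realType.
Local Notation rT := (measurableTypeR R).
Local Notation plane := (R * R)%type.
Local Notation mplane := (measurableTypeR R * measurableTypeR R)%type.
Local Notation mu := (@lebesgue_measure R).

Lemma lebesgue_angles : mu (angles : set rT) = pi%:E.
Proof.
rewrite /angles lebesgue_measure_itv/= lte_fin.
have p := pi_gt0 R; rewrite ifT; last by lra.
by rewrite -EFinD; congr EFin; field.
Qed.

(** The angular integral is pi, and polar radii of both signs contribute. *)
Lemma area_radial (a b : R) (G : plane -> R) (g : R -> R) (I : R) : 0 <= a ->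
  measurable_fun (open_ring a b : set mplane) (G : mplane -> R) ->
  (forall z, 0 <= G z) -> (forall r t, G (polar r t) = g (r ^+ 2)) ->
  (\int[mu]_(r in (`]a, b[%classic : set rT)) (r * g (r ^+ 2))%:E = I%:E)%E ->
  measurable_fun (`]a, b[%classic : set rT) (fun r : rT => r * g (r ^+ 2)) ->
  (\int[@area R]_(z in (open_ring a b : set mplane)) (G z)%:E = (2 * pi * I)%:E)%E.
Proof.
move=> a0 mG G0 Gg gI mg.
have rpos r : (`]a, b[%classic : set rT) r -> 0 <= r * g (r ^+ 2).
  rewrite /= in_itv/= => /andP[ar _]; apply: mulr_ge0; first by rewrite (le_trans a0)// ltW.
  by rewrite -(Gg r 0).
rewrite area_ring_polar//; last 2 first.
- exact/measurable_EFinP.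
- by move=> z _; rewrite lee_fin.
rewrite (eq_integral (fun=> (2 * I)%:E)); last first.
  move=> t _; rewrite EFinM -gI -ge0_integralZl//; last exact/measurable_EFinP.
  by apply: eq_integral => r _; rewrite !Gg sqrrN -EFinD -!EFinM; congr EFin; ring.
rewrite integral_cst; last exact: measurable_angles.
by rewrite -[X in (_ * X)%E]/(mu angles) lebesgue_angles -EFinM; congr EFin; ring.
Qed.

Lemma area_open_ring_lty (a b : R) : 0 <= a -> (@area R (open_ring a b : set mplane) < +oo)%E.
Proof.
move=> a0; have mA := @measurable_open_ring R a b.
have [ba|ab] := leP b a.
  have -> : open_ring a b = set0.
    by apply/seteqP; split => // x; rewrite /open_ring/= => /andP[h1 h2]; lra.
  by rewrite measure0 ltry.
have dI x : a <= x <= b -> is_derive x 1 (fun r : R => r ^+ 2 / 2) (x * 1).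
  move=> _; apply: is_derive_eq; rewrite /GRing.scale/=; lra.
have cid : continuous (fun x : R => x * 1) by move=> x; apply: cvgM; [exact: cvg_id|exact: cvg_cst].
have I1 := integral_derivative ab cid dI.
have := @area_radial a b (fun=> 1) (fun=> 1) _ a0 _ _ _ I1.
rewrite integral_cst// mul1e => -> //; first by rewrite ltry.
exact: measurable_funTS (continuous_measurable_fun cid).
Qed.

Lemma open_ring_box (a b : R) x : open_ring a b x -> box b x.
Proof.
move=> /andP[_ /ltW xb]; split.
  exact: le_trans (norm_fst_le x) xb.
exact: le_trans (norm_snd_le x) xb.
Qed.

Lemma continuous_integrable_ring (a b : R) (h : plane -> R) : 0 <= a -> 0 <= b -> continuous h ->
  (@area R).-integrable (open_ring a b : set mplane) (EFin \o h).
Proof.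
move=> a0 b0 ch; have [M M0 HM] := bounded_on_box b0 ch.
apply: measurable_bounded_integrable.
- exact: measurable_open_ring.
- exact: area_open_ring_lty.
- exact: measurable_funTS (continuous_measurable_plane ch).
- exists M; split; first exact: num_real.
  move=> y My x /open_ring_box/HM hx; exact: le_trans hx (ltW My).
Qed.

Lemma derive_vanish (F : plane -> R) x v : (\forall y \near x, F y = 0) -> 'D_v F x = 0.
Proof. by move=> /(@near_eq_derive _ _ _ F (cst 0) x v) ->; exact: derive_cst. Qed.

(** The fundamental theorem of calculus for a compactly supported function. *)
Let integral_line_eq0 (H H' : R -> R) (b : R) : 0 < b ->
  (forall s : R, is_derive s 1 H (H' s)) -> continuous H' ->
  (forall s, b <= `|s| -> H s = 0 /\ H' s = 0) ->
  (\int[mu]_s (H' s)%:E = 0)%E.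
Proof.
move=> b0 dH cH' Hb.
have -> : (\int[mu]_s (H' s)%:E = \int[mu]_(s in (`](- b)%R, b[%classic : set rT)) (H' s)%:E)%E.
  rewrite [RHS]integral_mkcond; apply: eq_integral => s _; rewrite patchE.
  case: ifPn => //; rewrite notin_setE /= in_itv/= -ltr_norml => /negP.
  by rewrite -leNgt => /Hb[_ ->].
have bb : - b < b by lra.
rewrite (integral_derivative bb cH' (fun s _ => dH s)).
by rewrite !(Hb _ _).1 ?subrr// ?normrN gtr0_norm.
Qed.

(** Fubini, and the fundamental theorem of calculus on each horizontal line. *)
Lemma integral_partial1_eq0 (a b : R) (F : plane -> R) : 0 <= a -> 0 < b -> Ck 1 F ->
  (forall x, ~ open_ring a b x -> \forall y \near x, F y = 0) ->
  (\int[@area R]_(z in (open_ring a b : set mplane)) (partial1 F z)%:E = 0)%E.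
Proof.
move=> a0 b0 CF F0; have [cF [_ _ [c1 _] _]] := CF.
have mA := @measurable_open_ring R a b.
have E : ((EFin \o partial1 F : mplane -> \bar R) \_ (open_ring a b)) = EFin \o partial1 F.
  apply/funext => z; rewrite patchE; case: ifPn => //; rewrite notin_setE => /F0 nF.
  by rewrite /= /partial1 derive_vanish.
have I1 : (@area R).-integrable [set: mplane] (EFin \o partial1 F : mplane -> \bar R).
  by rewrite -E; apply/(integrable_mkcond _ mA); apply: continuous_integrable_ring => //; exact: ltW.
rewrite integral_mkcond E.
rewrite -[LHS]/(\int[(mu \x mu)%E]_z (partial1 F z)%:E)%E.
rewrite -(integral21_prod_meas1 I1) /fubini_G integral0_eq// => y _ /=.
apply: (@integral_line_eq0 (fun s => F (s, y)) (fun s => partial1 F (s, y)) b) => //.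
- by move=> s; apply: is_derive_slice1; exact: Ck_is_derive1 CF.
- move=> s; apply: (@continuous_comp _ _ _ (fun s : R => (s, y) : plane) (partial1 F)); last exact: c1.
  have ci : continuous (fun s : R => s) by move=> u; exact: cvg_id.
  have cy : continuous (fun _ : R => y) by move=> u; exact: cvg_cst.
  exact: (cvg_pair (ci s) (cy s)).
move=> s bs; have out : ~ open_ring a b (s, y).
  by move=> /andP[_]; rewrite ltNge (le_trans bs (norm_fst_le (s, y))).
by split; [exact: nbhs_singleton (F0 _ out)|exact/derive_vanish/F0].
Qed.

Lemma integral_partial2_eq0 (a b : R) (F : plane -> R) : 0 <= a -> 0 < b -> Ck 1 F ->
  (forall x, ~ open_ring a b x -> \forall y \near x, F y = 0) ->
  (\int[@area R]_(z in (open_ring a b : set mplane)) (partial2 F z)%:E = 0)%E.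
Proof.
move=> a0 b0 CF F0; have [cF [_ _ _ [c2 _]]] := CF.
have mA := @measurable_open_ring R a b.
have E : ((EFin \o partial2 F : mplane -> \bar R) \_ (open_ring a b)) = EFin \o partial2 F.
  apply/funext => z; rewrite patchE; case: ifPn => //; rewrite notin_setE => /F0 nF.
  by rewrite /= /partial2 derive_vanish.
have I1 : (@area R).-integrable [set: mplane] (EFin \o partial2 F : mplane -> \bar R).
  by rewrite -E; apply/(integrable_mkcond _ mA); apply: continuous_integrable_ring => //; exact: ltW.
rewrite integral_mkcond E.
rewrite -[LHS]/(\int[(mu \x mu)%E]_z (partial2 F z)%:E)%E.
rewrite -(integral12_prod_meas1 I1) /fubini_F integral0_eq// => x _ /=.
apply: (@integral_line_eq0 (fun s => F (x, s)) (fun s => partial2 F (x, s)) b) => //.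
- by move=> s; apply: is_derive_slice2; exact: Ck_is_derive2 CF.
- move=> s; apply: (@continuous_comp _ _ _ (fun s : R => (x, s) : plane) (partial2 F)); last exact: c2.
  have ci : continuous (fun s : R => s) by move=> u; exact: cvg_id.
  have cx : continuous (fun _ : R => x) by move=> u; exact: cvg_cst.
  exact: (cvg_pair (cx s) (ci s)).
move=> s bs; have out : ~ open_ring a b (x, s).
  by move=> /andP[_]; rewrite ltNge (le_trans bs (norm_snd_le (x, s))).
by split; [exact: nbhs_singleton (F0 _ out)|exact/derive_vanish/F0].
Qed.

(** The product of the function and the test function is C^1 with support in
    the ring, so its partial derivatives have zero integral. *)
Lemma weak_partials (a b : R) (v phi : plane -> R) : 0 < a -> a < b -> Ck 1 v ->
  test_function (open_ring a b) phi ->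
  (\int[@area R]_(x in (open_ring a b : set mplane)) (v x * partial1 phi x)%:E =
     - \int[@area R]_(x in (open_ring a b : set mplane)) (partial1 v x * phi x)%:E)%E /\
  (\int[@area R]_(x in (open_ring a b : set mplane)) (v x * partial2 phi x)%:E =
     - \int[@area R]_(x in (open_ring a b : set mplane)) (partial2 v x * phi x)%:E)%E.
Proof.
move=> a0 ab Cv [sphi _ suppA]; have b0 : 0 < b by exact: lt_trans ab.
have Cp : Ck 1 phi := sphi 1%N.
have [cv [_ _ [cv1 _] [cv2 _]]] := Cv; have [cp [_ _ [cp1 _] [cp2 _]]] := Cp.
pose F x := v x * phi x; have CF : Ck 1 F by exact: Ck_mul.
have F0 x : ~ open_ring a b x -> \forall y \near x, F y = 0.
  move=> nx; have : ~ closure [set x | phi x != 0] x by move=> /suppA.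
  move=> /existsNP[B /not_implyP[xB nB]].
  have HB y : B y -> phi y = 0.
    by move=> By; apply/eqP; apply: contra_notT nB => py; exists y.
  by apply: filterS xB => y /HB e; rewrite /F e mulr0.
have int (h : plane -> R) := @continuous_integrable_ring a b h (ltW a0) (ltW b0).
have cM (h k : plane -> R) : continuous h -> continuous k -> continuous (fun x => h x * k x).
  by move=> ch ck x; apply: cvgM; [exact: ch|exact: ck].
have mA := @measurable_open_ring R a b.
have fin (h : plane -> R) : continuous h ->
    (\int[@area R]_(x in (open_ring a b : set mplane)) (h x)%:E \is a fin_num)%E.
  by move=> ch; apply: integrable_fin_num => //; exact: int.
have opp (X Y : \bar R) : Y \is a fin_num -> (X + Y = 0)%E -> X = (- Y)%E.
  by move=> Yf XY; rewrite -(@addeK _ Y X)// XY add0e.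
split; apply: opp; try exact: fin (cM _ _ _ _).
- rewrite -[RHS](integral_partial1_eq0 (ltW a0) b0 CF F0) -integralD//.
  + apply: eq_integral => x _; rewrite -EFinD; congr EFin.
    have d1 := Ck_is_derive1 x Cv; have d2 := Ck_is_derive1 x Cp.
    have D : is_derive x ((1 : R), (0 : R)) F (v x * partial1 phi x + partial1 v x * phi x).
      by apply: is_derive_eq; rewrite /GRing.scale/=; ring.
    by rewrite [RHS](@derive_val _ _ _ _ _ _ _ D).
  + exact: int (cM _ _ cv cp1).
  + exact: int (cM _ _ cv1 cp).
- rewrite -[RHS](integral_partial2_eq0 (ltW a0) b0 CF F0) -integralD//.
  + apply: eq_integral => x _; rewrite -EFinD; congr EFin.
    have d1 := Ck_is_derive2 x Cv; have d2 := Ck_is_derive2 x Cp.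
    have D : is_derive x ((0 : R), (1 : R)) F (v x * partial2 phi x + partial2 v x * phi x).
      by apply: is_derive_eq; rewrite /GRing.scale/=; ring.
    by rewrite [RHS](@derive_val _ _ _ _ _ _ _ D).
  + exact: int (cM _ _ cv cp2).
  + exact: int (cM _ _ cv2 cp).
Qed.

End IntegrationByParts.

(** * Upper bound from radial functions *)

Section UpperBound.
Variable R : realType.
Local Notation rT := (measurableTypeR R).
Local Notation plane := (R * R)%type.
Local Notation mplane := (measurableTypeR R * measurableTypeR R)%type.
Local Notation mu := (@lebesgue_measure R).

Lemma slice1_is_derive (f : plane -> R) (z : plane) (d : R) :
  is_derive z.1 1 (fun s => f (s, z.2)) d -> is_derive z ((1 : R), (0 : R)) f d.
Proof.
move=> /eps_is_derive H; apply: is_derive_eps => e /H[k k0 Hk]; exists k => // h h0 hk.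
have := Hk h h0 hk; rewrite -surjective_pairing; congr (`|_ - _ * (f _ - _)| <= _).
by rewrite [RHS]surjective_pairing/= /GRing.scale/= mulr0 add0r.
Qed.

Lemma slice2_is_derive (f : plane -> R) (z : plane) (d : R) :
  is_derive z.2 1 (fun s => f (z.1, s)) d -> is_derive z ((0 : R), (1 : R)) f d.
Proof.
move=> /eps_is_derive H; apply: is_derive_eps => e /H[k k0 Hk]; exists k => // h h0 hk.
have := Hk h h0 hk; rewrite -surjective_pairing; congr (`|_ - _ * (f _ - _)| <= _).
by rewrite [RHS]surjective_pairing/= /GRing.scale/= mulr0 add0r.
Qed.

Section Radial.
Variables (U U1 : R -> R).
Hypothesis dU : forall t : R, is_derive t 1 U (U1 t).
Hypothesis cU1 : continuous U1.

(** A function of the squared radius, so that C^1 regularity at the origin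
    comes for free. *)
Definition radial (z : plane) : R := U (z.1 ^+ 2 + z.2 ^+ 2).

Let cU : continuous U.
Proof. exact: continuous_of_derive dU. Qed.

Let csq : continuous (fun z : plane => z.1 ^+ 2 + z.2 ^+ 2).
Proof.
have C : Ck 0 (fun z : plane => z.1 * z.1 + z.2 * z.2).
  by apply: Ck_add; apply: Ck_mul; (exact: Ck_fst || exact: Ck_snd).
exact: Ck_continuous C.
Qed.

Let ccomp (h : R -> R) : continuous h -> continuous (fun z : plane => h (z.1 ^+ 2 + z.2 ^+ 2)).
Proof. by move=> ch z; apply: (@continuous_comp _ _ _ (fun z : plane => z.1 ^+ 2 + z.2 ^+ 2) h); [exact: csq|exact: ch]. Qed.

Let d1 z : is_derive z ((1 : R), (0 : R)) radial (2 * z.1 * U1 (z.1 ^+ 2 + z.2 ^+ 2)).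
Proof.
apply: slice1_is_derive => /=.
have du : is_derive (z.1 : R) 1 (fun s : R => s ^+ 2 + z.2 ^+ 2) (2 * z.1).
  by apply: is_derive_eq; rewrite /GRing.scale/=; ring.
have := @is_derive1_comp _ U (fun s : R => s ^+ 2 + z.2 ^+ 2) z.1 _ _ (dU _) du.
by move/(@is_derive_eq _ _ _ _ _ _ _ _); apply; rewrite /GRing.scale/=; ring.
Qed.

Let d2 z : is_derive z ((0 : R), (1 : R)) radial (2 * z.2 * U1 (z.1 ^+ 2 + z.2 ^+ 2)).
Proof.
apply: slice2_is_derive => /=.
have du : is_derive (z.2 : R) 1 (fun s : R => z.1 ^+ 2 + s ^+ 2) (2 * z.2).
  by apply: is_derive_eq; rewrite /GRing.scale/=; ring.
have := @is_derive1_comp _ U (fun s : R => z.1 ^+ 2 + s ^+ 2) z.2 _ _ (dU _) du.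
by move/(@is_derive_eq _ _ _ _ _ _ _ _); apply; rewrite /GRing.scale/=; ring.
Qed.

Lemma partial1_radial z : partial1 radial z = 2 * z.1 * U1 (z.1 ^+ 2 + z.2 ^+ 2).
Proof. by have := d1 z => d; rewrite /partial1 derive_val. Qed.

Lemma partial2_radial z : partial2 radial z = 2 * z.2 * U1 (z.1 ^+ 2 + z.2 ^+ 2).
Proof. by have := d2 z => d; rewrite /partial2 derive_val. Qed.

Lemma radial_C1 : Ck 1 radial.
Proof.
apply: Ck_partialE d1 d2 _ _; first exact: ccomp cU.
  by split => // z; apply: cvgM; [apply: cvgM; [exact: cvg_cst|exact: cvg_fst]|exact: ccomp cU1 z].
by split => // z; apply: cvgM; [apply: cvgM; [exact: cvg_cst|exact: cvg_snd]|exact: ccomp cU1 z].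
Qed.

Lemma polar_sq (r t : R) : (polar r t).1 ^+ 2 + (polar r t).2 ^+ 2 = r ^+ 2.
Proof. by rewrite /polar/= !exprMn -mulrDr cos2Dsin2 mulr1. Qed.

Lemma radial_polar r t : radial (polar r t) = U (r ^+ 2).
Proof. by rewrite /radial polar_sq. Qed.

Let measurable_radius (a b : R) (h : R -> R) : continuous h ->
  measurable_fun (`]a, b[%classic : set rT) (fun r : rT => r * h (r ^+ 2)).
Proof.
move=> ch; apply: measurable_funTS; apply: continuous_measurable_fun => r.
by apply: cvgM; [exact: cvg_id|exact: (continuous_sq_comp ch)].
Qed.

Lemma sqint_radial_circles (a b : R) : 0 < a -> a < b ->
  (sqint (@arclength R) (circles a b) radial =
   (2 * pi * (b * U (b ^+ 2) ^+ 2 + a * U (a ^+ 2) ^+ 2))%:E)%E.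
Proof.
move=> a0 ab; have mr := continuous_measurable_plane (Ck_continuous radial_C1).
rewrite /sqint integral_circles//; last 2 first.
- by apply/measurable_EFinP; apply: measurable_funTS; exact: measurable_funX.
- by move=> x _; rewrite lee_fin sqr_ge0.
rewrite (eq_integral (fun=> (2 * (b * U (b ^+ 2) ^+ 2 + a * U (a ^+ 2) ^+ 2))%:E)); last first.
  move=> t _; rewrite !radial_polar !sqrrN.
  rewrite -[LHS]/((a * (U (a ^+ 2) ^+ 2 + U (a ^+ 2) ^+ 2) +
                   b * (U (b ^+ 2) ^+ 2 + U (b ^+ 2) ^+ 2))%:E).
  by congr EFin; ring.
rewrite integral_cst; last exact: measurable_angles.
by rewrite -[X in (_ * X)%E]/(mu angles) lebesgue_angles -EFinM; congr EFin; ring.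
Qed.

(** A radial C^1 function of the plane is its own trace, approximated by the
    constant sequence, and its quotient is computed in polar coordinates. *)
Theorem robin_upper_bound (alpha a b N D : R) : 0 < a -> a < b -> 0 < N ->
  (\int[mu]_(r in (`]a, b[%classic : set rT)) (r * U (r ^+ 2) ^+ 2)%:E = N%:E)%E ->
  (\int[mu]_(r in (`]a, b[%classic : set rT)) (r * (4 * r ^+ 2 * U1 (r ^+ 2) ^+ 2))%:E = D%:E)%E ->
  (robin_lambda1 alpha (annulus a b) <=
    ((D - alpha * (b * U (b ^+ 2) ^+ 2 + a * U (a ^+ 2) ^+ 2)) / N)%:E)%E.
Proof.
move=> a0 ab N0 IN ID; have b0 := lt_trans a0 ab.
have mA := @measurable_open_ring R a b.
have C1 := radial_C1; have [cv [_ _ [cp1 _] [cp2 _]]] := C1.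
have mv := continuous_measurable_plane cv.
have m1 := continuous_measurable_plane cp1; have m2 := continuous_measurable_plane cp2.
pose v := radial; pose g := grad radial.
have eN : (sqint (@area R) (open_ring a b) v = (2 * pi * N)%:E)%E.
  apply: (@area_radial R a b (fun z => v z ^+ 2) (fun t => U t ^+ 2) N) => //; first exact: ltW.
  - by apply: measurable_funTS; exact: measurable_funX.
  - by move=> z; exact: sqr_ge0.
  - by move=> r t; rewrite /v radial_polar.
  - by apply: (@measurable_radius a b (fun t => U t ^+ 2)) => t; apply: cvgM; exact: cU.
have mdot : measurable_fun [set: mplane] (fun z : mplane => dotp (g z) (g z) : rT).
  exact: (measurable_funD (measurable_funM m1 m1) (measurable_funM m2 m2)).
have dot0 (z : plane) : 0 <= dotp z z by rewrite addr_ge0// -expr2 sqr_ge0.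
have eD : (\int[@area R]_(z in (open_ring a b : set mplane)) (dotp (g z) (g z))%:E = (2 * pi * D)%:E)%E.
  apply: (@area_radial R a b (fun z => dotp (g z) (g z)) (fun t => 4 * t * U1 t ^+ 2) D) => //; first exact: ltW.
  - exact: measurable_funTS.
  - move=> r t; rewrite /g /grad /dotp /= partial1_radial partial2_radial polar_sq.
    rewrite -[X in _ = 4 * X * _](polar_sq r t); ring.
  - apply: (@measurable_radius a b (fun t => 4 * t * U1 t ^+ 2)) => t.
    by apply: cvgM; [apply: cvgM; [exact: cvg_cst|exact: cvg_id]|apply: cvgM; exact: cU1].
have L2w (h : plane -> R) (c : R) : continuous h -> (forall z, h z ^+ 2 <= c * dotp (g z) (g z) + (v z) ^+ 2) -> 0 <= c ->
   L2 (@area R) (open_ring a b) h.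
  move=> ch hle c0; have mh := continuous_measurable_plane ch; split; first exact: measurable_funTS.
  apply: (@le_lt_trans _ _ (\int[@area R]_(z in (open_ring a b : set mplane))
     (c%:E * (dotp (g z) (g z))%:E + (v z ^+ 2)%:E))%E).
    apply: ge0_le_integral => //.
    - by move=> z _; rewrite lee_fin sqr_ge0.
    - by apply/measurable_EFinP/measurable_funTS/measurable_funX.
    - apply/measurable_EFinP/measurable_funTS; apply: measurable_funD; last exact: measurable_funX.
      exact: measurable_funM.
    - by move=> z _; rewrite -EFinM -EFinD lee_fin.
  rewrite ge0_integralD//.
  - rewrite ge0_integralZl//.
    + by rewrite eD -/(sqint (@area R) (open_ring a b) v) eN -EFinM -EFinD ltry.
    + by apply/measurable_EFinP; exact: measurable_funTS.
    + by move=> z _; rewrite lee_fin.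
  - by move=> z _; rewrite mule_ge0// lee_fin.
  - by apply/measurable_EFinP/measurable_funTS; exact: measurable_funM.
  - by move=> z _; rewrite lee_fin sqr_ge0.
  - by apply/measurable_EFinP/measurable_funTS/measurable_funX.
have Lc (h : plane -> R) (m : {measure set mplane -> \bar R}) (S : set mplane) :
    sqint m S (fun x => h x - h x) = 0%E.
  by rewrite /sqint integral0_eq// => x _; rewrite subrr expr0n.
have Larea (h : plane -> R) : L2_cvg (@area R) (open_ring a b) (fun _ => h) h.
  by rewrite /L2_cvg Lc; exact: cvg_cst.
have Larc : L2_cvg (@arclength R) (circles a b) (fun _ => v) v.
  by rewrite /L2_cvg sqint_arclength// Lc; exact: cvg_cst.
have pi0 := pi_gt0 R.
rewrite annulusE//; apply: ereal_inf_lbound; exists v, g, v; split.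
- split.
  + by apply: (L2w v 0) => // z; rewrite mul0r add0r.
  + apply: (L2w (partial1 radial) 1 cp1) => // z; rewrite mul1r /g /dotp /= -!expr2.
    by rewrite -addrA lerDl addr_ge0 ?sqr_ge0.
  + apply: (L2w (partial2 radial) 1 cp2) => // z; rewrite mul1r /g /dotp /= -!expr2.
    by rewrite addrAC lerDr addr_ge0 ?sqr_ge0.
  + by move=> phi tphi; have [-> ->] := weak_partials a0 ab C1 tphi.
- rewrite -annulusE// /trace ebdry_annulus//; split.
    split; first exact: measurable_funTS.
    by rewrite sqint_radial_circles// ltry.
  rewrite annulusE//; exists (fun=> v); split; [by []|exact: Larea..|exact: Larc].
- rewrite eN eqe gt_eqF// mulr_gt0// mulr_gt0//.
- rewrite /robin_quotient eN eD -annulusE// ebdry_annulus// sqint_radial_circles//=.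
  congr EFin; move: (pi : R) pi0 => p p0.
  by field; rewrite (gt_eqF p0) (gt_eqF N0).
Qed.

End Radial.
End UpperBound.

(** * A modified Bessel function *)

Section Bessel.
Variable R : realType.

(** Comparison with the exponential series. *)
Lemma cvg_pseries_fact (c : R^nat) (x : R) : (forall n, 0 <= c n <= (n`!%:R)^-1) ->
  cvgn (pseries c x).
Proof.
move=> Hc; apply: normed_cvg; apply: (@series_le_cvg _ _ (exp_coeff `|x|)) => [n|n|n|].
- by rewrite /= normr_ge0.
- exact: exp_coeff_ge0.
- have /andP[c0 c1] := Hc n; rewrite /= normrM normrX exp_coeffE ger0_norm//.
  by rewrite ler_wpM2r// exprn_ge0.
- exact: is_cvg_series_exp_coeff.
Qed.

Lemma is_derive_pseries_fact (c d : R^nat) (x : R) : (forall n, 0 <= c n <= (n`!%:R)^-1) ->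
  pseries_diffs c = d -> (forall n, 0 <= d n <= (n`!%:R)^-1) ->
  (forall n, 0 <= pseries_diffs d n <= (n`!%:R)^-1) ->
  is_derive x 1 (fun x => limn (pseries c x)) (limn (pseries d x)).
Proof.
move=> Hc <- Hd He; apply: (@pseries_snd_diffs _ _ (`|x| + 1)); try exact: cvg_pseries_fact.
by rewrite [ltRHS]ger0_norm ?addr_ge0// ltrDl.
Qed.

Lemma pseries_ge_coef0 (c : R^nat) (x : R) : (forall n, 0 <= c n <= (n`!%:R)^-1) -> 0 <= x ->
  c 0%N <= limn (pseries c x).
Proof.
move=> Hc x0; apply: limr_ge; first exact: cvg_pseries_fact.
exists 1%N => // n /= n0; rewrite /pseries /series /= -(prednK n0) big_nat_recl//.
rewrite expr0 mulr1 lerDl sumr_ge0// => i _; rewrite mulr_ge0 ?exprn_ge0//.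
by have /andP[] := Hc i.+1.
Qed.

(** The series P(z) = sum of z^n / n!^2, that is, the modified Bessel function
    I_0(2 sqrt z). Its coefficients satisfy (z P')' = P. *)
Lemma bessel_exists : exists P Q : R -> R, [/\
  forall z : R, is_derive z 1 P (Q z),
  forall z : R, is_derive z 1 (fun z => z * Q z) (P z),
  continuous Q &
  forall z, 0 <= z -> 0 < P z /\ 0 <= Q z].
Proof.
pose c (n : nat) : R := (n`!%:R)^-1 * (n`!%:R)^-1.
pose d (n : nat) : R := (n`!%:R)^-1 * (n.+1`!%:R)^-1.
pose e (n : nat) : R := (n`!%:R)^-1 * (n.+2`!%:R)^-1.
(* c, d, e are the coefficients of P, P' and P''; t those of z P'. *)
pose t (n : nat) : R := n%:R * c n.
have f0 n : (n`!%:R : R) != 0 by rewrite pnatr_eq0 -lt0n fact_gt0.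
have f1 n : (n`!%:R : R)^-1 <= 1 by rewrite invf_le1 ?ler1n ?ltr0n fact_gt0.
have bnd n m : 0 <= ((n`!%:R)^-1 * (m`!%:R)^-1 : R) <= (n`!%:R)^-1.
  by rewrite mulr_ge0 ?invr_ge0//= ler_piMr ?invr_ge0.
have cd : pseries_diffs c = d.
  apply/funext => n; rewrite /pseries_diffs /c /d factS natrM; field.
  by rewrite f0 nat1r pnatr_eq0.
have de : pseries_diffs d = e.
  apply/funext => n; rewrite /pseries_diffs /e /d !factS !natrM; field.
  by rewrite f0 -natrD !nat1r !pnatr_eq0.
have tc : pseries_diffs t = c.
  apply/funext => n; rewrite /pseries_diffs /t /c !factS !natrM; field.
  by rewrite f0 nat1r pnatr_eq0.
have tb n : 0 <= t n <= (n`!%:R)^-1.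
  rewrite /t mulr_ge0//= ?mulr_ge0 ?invr_ge0// /c mulrA ler_piMl ?invr_ge0//.
  by rewrite ler_pdivrMr ?mul1r ?ltr0n ?fact_gt0// ler_nat fact_geq.
have db : forall n, 0 <= pseries_diffs d n <= (n`!%:R)^-1 by move=> n; rewrite de; exact: bnd.
have cb : forall n, 0 <= pseries_diffs c n <= (n`!%:R)^-1 by move=> n; rewrite cd; exact: bnd.
pose P (z : R) : R := limn (pseries c z); pose Q (z : R) : R := limn (pseries d z).
have dP (z : R) : is_derive z 1 P (Q z).
  have := @is_derive_pseries_fact c d z (fun n => bnd n n) cd (fun n => bnd n n.+1) db.
  exact.
have eb n : 0 <= pseries_diffs e n <= (n`!%:R)^-1.
  have -> : pseries_diffs e n = (n`!%:R)^-1 * (n.+3`!%:R)^-1.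
    rewrite /pseries_diffs /e (factS n) natrM; field.
    by rewrite !f0 nat1r pnatr_eq0.
  exact: bnd.
have dQ (z : R) : is_derive z 1 Q (limn (pseries e z)).
  have := @is_derive_pseries_fact d e z (fun n => bnd n n.+1) de (fun n => bnd n n.+2) eb.
  exact.
exists P, Q; split => //.
- have -> : (fun z => z * Q z) = fun z => limn (pseries t z).
    apply/funext => z.
    have C : cvgn (pseries (pseries_diffs c) z) by apply: cvg_pseries_fact.
    have := pseries_diffs_equiv C; rewrite cd => H.
    apply/esym/cvg_lim => //; rewrite -[X in X @ _ --> _]/(series (fun n => t n * z ^+ n)).
    have -> : series (fun n => t n * z ^+ n) = (fun n => z * series (fun i => i%:R * c i * z ^+ i.-1) n).
      apply/funext => n; rewrite /series /= mulr_sumr; apply: eq_bigr => -[|i] _.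
        by rewrite /t !mul0r mulr0.
      by rewrite /t exprS /=; ring.
    by apply: cvgM H; exact: cvg_cst.
  move=> z; have := @is_derive_pseries_fact t c z tb tc (fun n => bnd n n) cb.
  exact.
- exact: continuous_of_derive dQ.
- move=> z z0; split.
    by apply: lt_le_trans (pseries_ge_coef0 (fun n => bnd n n) z0); rewrite /c fact0 invr1 mul1r.
  by apply: le_trans (pseries_ge_coef0 (fun n => bnd n n.+1) z0); rewrite mulr_ge0 ?invr_ge0.
Qed.

End Bessel.

(** * Radial modes and their Wronskians *)

Section Modes.
Variable R : realType.

Lemma is_derive_sq_comp (U U1 : R -> R) (r : R) : is_derive (r ^+ 2) 1 U (U1 (r ^+ 2)) ->
  is_derive r 1 (fun s => U (s ^+ 2)) (2 * r * U1 (r ^+ 2)).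
Proof.
move=> dU; have dq : is_derive r 1 (fun s : R => s ^+ 2) (2 * r).
  by apply: is_derive_eq; rewrite /GRing.scale/=; ring.
have := @is_derive1_comp _ U (fun s : R => s ^+ 2) r _ _ dU dq.
by move/(@is_derive_eq _ _ _ _ _ _ _ _); apply; rewrite /GRing.scale/=; ring.
Qed.

(** The function is r (u' W - u W') for u(r) = U(r^2) and W' = l W: its
    derivative has the sign of the Riccati defect of l. *)
Lemma wronskian_derive (kappa r : R) (U U1 W l : R -> R) (l' : R) : r != 0 ->
  is_derive (r ^+ 2) 1 U (U1 (r ^+ 2)) ->
  is_derive (r ^+ 2) 1 (fun t => t * U1 t) (kappa / 4 * U (r ^+ 2)) ->
  is_derive r 1 W (l r * W r) -> is_derive r 1 l l' ->
  is_derive r 1 (fun s => W s * (2 * (s ^+ 2 * U1 (s ^+ 2)) - s * l s * U (s ^+ 2)))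
    (W r * (r * U (r ^+ 2)) * (kappa - (l' + l r ^+ 2 + l r / r))).
Proof.
move=> r0 dU dU1 dW dl; have d1 := is_derive_sq_comp dU.
have d2 := @is_derive_sq_comp (fun t => t * U1 t) (fun t => kappa / 4 * U t) r dU1.
by apply: is_derive_eq; rewrite /GRing.scale/=; field.
Qed.

(** In the variable t = r^2, the equation u'' + u' / r = kappa u for u(r) =
    U(r^2) becomes (t U')' = kappa / 4 U. It is required for t > m only, which
    leaves room to extend U smoothly through the origin, where other solutions
    are singular. *)
Definition mode (kappa m : R) (U U1 : R -> R) := [/\
  forall t : R, is_derive t 1 U (U1 t),
  continuous U1 &
  forall t : R, m < t -> is_derive t 1 (fun t => t * U1 t) (kappa / 4 * U t)].

Lemma sq_itv (a b r : R) : 0 < a -> a <= r <= b -> a ^+ 2 <= r ^+ 2 <= b ^+ 2.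
Proof.
move=> a0 /andP[ar rb]; rewrite !ler_pXn2r ?nnegrE ?ar ?rb//; lra.
Qed.

Lemma mode_wronskian (kappa m a b : R) (U U1 W l : R -> R) (l' r : R) : 0 < a -> m < a ^+ 2 ->
  mode kappa m U U1 -> a <= r <= b ->
  is_derive r 1 W (l r * W r) -> is_derive r 1 l l' ->
  is_derive r 1 (fun s => W s * (2 * (s ^+ 2 * U1 (s ^+ 2)) - s * l s * U (s ^+ 2)))
    (W r * (r * U (r ^+ 2)) * (kappa - (l' + l r ^+ 2 + l r / r))).
Proof.
move=> a0 ma [dU _ dU1] rab dW dl.
have /andP[r1 _] := sq_itv a0 rab; have /andP[ar _] := rab.
have r0 : r != 0 by rewrite gt_eqF// (lt_le_trans a0).
exact: (wronskian_derive r0 (dU _) (dU1 _ (lt_le_trans ma r1)) dW dl).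
Qed.

(** Comparison with exp (alpha r): the assumption on [kappa] makes this a
    subsolution on [a, b], so r (u' W - u W') is nonincreasing. *)
Lemma constant_barrier (alpha kappa a b m : R) (U U1 : R -> R) :
  0 < a -> a < b -> 0 < alpha -> m < a ^+ 2 -> mode kappa m U U1 ->
  (forall t, a ^+ 2 <= t <= b ^+ 2 -> 0 < U t) ->
  kappa <= alpha ^+ 2 + alpha / b -> exists w1 w2 : R, [/\ 0 < w1, 0 < w2 &
  w2 * (2 * b * U1 (b ^+ 2) - alpha * U (b ^+ 2)) <= w1 * (2 * a * U1 (a ^+ 2) - alpha * U (a ^+ 2))].
Proof.
move=> a0 ab al0 ma Umode Upos kb; have b0 : 0 < b by exact: lt_trans ab.
pose W (r : R) := expR (alpha * r).
exists (W a * a), (W b * b); split; [by rewrite mulr_gt0 ?expR_gt0..|].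
have dW (r : R) : is_derive r 1 W (alpha * W r).
  have dl : is_derive r 1 (fun r : R => alpha * r) alpha.
    by apply: is_derive_eq; rewrite /GRing.scale/=; ring.
  have := @is_derive1_comp _ expR (fun r : R => alpha * r) r _ _ (is_derive_expR _) dl.
  by move/(@is_derive_eq _ _ _ _ _ _ _ _); apply; rewrite /W mulrC.
have := @ndecr_cc R (fun s => - (W s * (2 * (s ^+ 2 * U1 (s ^+ 2)) - s * alpha * U (s ^+ 2))))
  (fun r => - (W r * (r * U (r ^+ 2)) * (kappa - (0 + alpha ^+ 2 + alpha / r)))) a b (ltW ab).
rewrite lerN2 => H.
have -> : W b * b * (2 * b * U1 (b ^+ 2) - alpha * U (b ^+ 2)) =
  W b * (2 * (b ^+ 2 * U1 (b ^+ 2)) - b * alpha * U (b ^+ 2)) by ring.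
have -> : W a * a * (2 * a * U1 (a ^+ 2) - alpha * U (a ^+ 2)) =
  W a * (2 * (a ^+ 2 * U1 (a ^+ 2)) - a * alpha * U (a ^+ 2)) by ring.
apply: H.
- move=> r rab; have := @mode_wronskian kappa m a b U U1 W (fun=> alpha) 0 r a0 ma Umode rab (dW r) (is_derive_cst _ _ _).
  by move=> d; exact: is_deriveN.
- move=> r rab; have /andP[ar rb] := rab; have r0 : 0 < r := lt_le_trans a0 ar.
  rewrite oppr_ge0; apply: mulr_ge0_le0.
    by rewrite !mulr_ge0 ?expR_ge0 ?(ltW r0)// ltW// Upos// sq_itv.
  have : alpha / b <= alpha / r by rewrite ler_pM2l// lef_pV2// posrE.
  lra.
Qed.

(** Comparison with the function whose logarithmic derivative l is affine, with
    l(a) = -alpha and l(b) = alpha. For [kappa] this large it is a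
    supersolution, so r (u' W - u W') is nondecreasing. *)
Lemma linear_barrier (alpha kappa a b m : R) (U U1 : R -> R) :
  0 < a -> a < b -> 0 < alpha -> m < a ^+ 2 -> mode kappa m U U1 ->
  (forall t, a ^+ 2 <= t <= b ^+ 2 -> 0 < U t) ->
  2 * alpha / (b - a) + alpha ^+ 2 + alpha / a <= kappa ->
  exists w1 w2 : R, [/\ 0 < w1, 0 < w2 &
  w1 * (2 * a * U1 (a ^+ 2) + alpha * U (a ^+ 2)) <= w2 * (2 * b * U1 (b ^+ 2) - alpha * U (b ^+ 2))].
Proof.
move=> a0 ab al0 ma Umode Upos kb; have b0 : 0 < b by exact: lt_trans ab.
have ba0 : 0 < b - a by rewrite subr_gt0.
pose k := alpha / (b - a); have k0 : 0 < k by rewrite divr_gt0.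
have ka : k * (b - a) = alpha by rewrite /k divfK// gt_eqF.
pose l (r : R) := k * (2 * r - a - b).
pose W (r : R) := expR (k * (r ^+ 2 - (a + b) * r)).
have dl (r : R) : is_derive r 1 l (2 * k).
  by apply: is_derive_eq; rewrite /GRing.scale/=; ring.
have dW (r : R) : is_derive r 1 W (l r * W r).
  have dA : is_derive r 1 (fun r : R => k * (r ^+ 2 - (a + b) * r)) (l r).
    by apply: is_derive_eq; rewrite /l /GRing.scale/=; ring.
  have := @is_derive1_comp _ expR (fun r : R => k * (r ^+ 2 - (a + b) * r)) r _ _ (is_derive_expR _) dA.
  by move/(@is_derive_eq _ _ _ _ _ _ _ _); apply; rewrite /W mulrC.
exists (W a * a), (W b * b); split; [by rewrite mulr_gt0 ?expR_gt0..|].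
have := @ndecr_cc R (fun s => W s * (2 * (s ^+ 2 * U1 (s ^+ 2)) - s * l s * U (s ^+ 2)))
  (fun r => W r * (r * U (r ^+ 2)) * (kappa - (2 * k + l r ^+ 2 + l r / r))) a b (ltW ab).
have la : l a = - alpha by rewrite /l; clear -ka; lra.
have lb : l b = alpha by rewrite /l; clear -ka; lra.
rewrite la lb => H.
have -> : W a * a * (2 * a * U1 (a ^+ 2) + alpha * U (a ^+ 2)) =
  W a * (2 * (a ^+ 2 * U1 (a ^+ 2)) - a * - alpha * U (a ^+ 2)) by ring.
have -> : W b * b * (2 * b * U1 (b ^+ 2) - alpha * U (b ^+ 2)) =
  W b * (2 * (b ^+ 2 * U1 (b ^+ 2)) - b * alpha * U (b ^+ 2)) by ring.
apply: H => r rab; first exact: (mode_wronskian a0 ma Umode rab (dW r) (dl r)).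
have /andP[ar rb] := rab; have r0 : 0 < r := lt_le_trans a0 ar.
apply: mulr_ge0; first by rewrite !mulr_ge0 ?expR_ge0 ?(ltW r0)// ltW// Upos// sq_itv.
have lr : - alpha <= l r <= alpha.
  have h1 : 0 <= k * (r - a) by rewrite mulr_ge0 ?(ltW k0)// subr_ge0.
  have h2 : 0 <= k * (b - r) by rewrite mulr_ge0 ?(ltW k0)// subr_ge0.
  by rewrite /l; clear -h1 h2 ka; apply/andP; split; lra.
have lr2 : l r ^+ 2 <= alpha ^+ 2.
  by rewrite -[leLHS]real_normK ?num_real// ler_sqr ?nnegrE ?ler_norml// ltW.
have : l r / r <= alpha / a.
  have /andP[_ lr1] := lr; apply: (@le_trans _ _ (alpha / r)).
    by rewrite ler_pM2r// invr_gt0.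
  by rewrite ler_pM2l// lef_pV2// posrE.
have -> : 2 * k = 2 * alpha / (b - a) by rewrite /k mulrA.
clear -lr2 kb; lra.
Qed.

End Modes.

(** * Existence of the radial ground state *)

Section Existence.
Variable R : realType.

Section SecondSolution.
Variables (P Q : R -> R).
Hypothesis dP : forall z : R, is_derive z 1 P (Q z).
Hypothesis dQ : forall z : R, is_derive z 1 (fun z => z * Q z) (P z).
Hypothesis cQ : continuous Q.
Hypothesis PQ : forall z, 0 <= z -> 0 < P z /\ 0 <= Q z.

Let cP : continuous P.
Proof. exact: continuous_of_derive dP. Qed.

(** Reduction of order: if Psi' = 1 / (z P^2) then P (C - Psi) solves the same
    equation as P. The integrand is frozen below d, because it is singular at
    0, and the equation is kept above d. *)
Lemma second_solution (d : R) : 0 < d -> exists Psi : R -> R, [/\ continuous Psi,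
  forall x y, x <= y -> Psi x <= Psi y &
  forall C, exists Y1 : R -> R, [/\
    forall z : R, is_derive z 1 (fun z => P z * (C - Psi z)) (Y1 z),
    continuous Y1,
    forall z : R, d < z -> is_derive z 1 (fun z => z * Y1 z) (P z * (C - Psi z)) &
    forall z, d <= z -> z * Y1 z = z * Q z * (C - Psi z) - (P z)^-1]].
Proof.
move=> d0; pose M (z : R) := Num.max z d.
have M0 z : 0 < M z by rewrite /M lt_max d0 orbT.
have cM : continuous M.
  by move=> z; apply: (@continuous_max _ _ (fun z : R => z) (fun=> d)); [exact: cvg_id|exact: cvg_cst].
have PM z : 0 < P (M z) by have [] := PQ (ltW (M0 z)).
pose psi z := (M z * P (M z) ^+ 2)^-1.
have den0 z : 0 < M z * P (M z) ^+ 2 by rewrite mulr_gt0// exprn_gt0.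
have psi0 z : 0 <= psi z by rewrite invr_ge0 ltW.
have cpsi : continuous psi.
  move=> z; apply: cvgV; first by rewrite gt_eqF.
  have cPM : {for z, continuous (P \o M)} by apply: continuous_comp; [exact: cM|exact: cP].
  by apply: cvgM; [exact: cM|apply: cvgM; exact: cPM].
have [Psi dPsi] := global_antiderivative cpsi.
have cPsi : continuous Psi := continuous_of_derive dPsi.
exists Psi; split => // [x y xy|C].
  by apply: (@ndecr_cc R Psi psi) => // z _.
pose Y1 z := Q z * (C - Psi z) - P z * psi z.
have psiE z : d <= z -> z * psi z = (P z ^+ 2)^-1.
  move=> dz; have Mz : M z = z by rewrite /M max_l.
  have z0 : 0 < z by exact: lt_le_trans dz.
  have [Pz _] := PQ (ltW z0).
  by rewrite /psi Mz; field; rewrite !gt_eqF.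
have Y1E z : d <= z -> z * Y1 z = z * Q z * (C - Psi z) - (P z)^-1.
  move=> dz; rewrite /Y1.
  have -> : z * (Q z * (C - Psi z) - P z * psi z) =
    z * Q z * (C - Psi z) - P z * (z * psi z) by ring.
  rewrite psiE//.
  have [Pz _] := PQ (ltW (lt_le_trans d0 dz)).
  by field; rewrite gt_eqF.
exists Y1; split => //.
- move=> z; have d1 := dP z; have d2 := dPsi z.
  by apply: is_derive_eq; rewrite /Y1 /GRing.scale/=; ring.
- move=> z; apply: cvgB; apply: cvgM.
  + exact: cQ.
  + by apply: cvgB; [exact: cvg_cst|exact: cPsi].
  + exact: cP.
  + exact: cpsi.
- move=> z dz; have [Pz _] := PQ (ltW (lt_trans d0 dz)).
  have Pn : P z != 0 by rewrite gt_eqF.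
  have D : is_derive z 1 (fun z => z * Q z * (C - Psi z) - (P z)^-1) (P z * (C - Psi z)).
    have d1 := dP z; have d2 := dPsi z; have d3 := dQ z.
    have d4 := is_deriveV Pn d1.
    have z0 : z != 0 by rewrite gt_eqF// (lt_trans d0).
    have e : psi z = (P z ^+ 2)^-1 / z by rewrite -psiE ?ltW// mulrAC divff// mul1r.
    by apply: is_derive_eq; rewrite /GRing.scale/= e; field; rewrite Pn z0.
  apply: near_eq_is_derive D; near=> y; rewrite Y1E// ltW//.
  by near: y; exact: lt_nbhsr.
Unshelve. all: by end_near. Qed.

End SecondSolution.

Lemma mode_rescale (kappa d : R) (Y Y1 : R -> R) : 0 < kappa ->
  (forall z : R, is_derive z 1 Y (Y1 z)) -> continuous Y1 ->
  (forall z : R, d < z -> is_derive z 1 (fun z => z * Y1 z) (Y z)) ->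
  mode kappa (4 * d / kappa) (fun t => Y (kappa / 4 * t)) (fun t => kappa / 4 * Y1 (kappa / 4 * t)).
Proof.
move=> k0 dY cY1 dY1; have dlin (t : R) : is_derive t 1 (fun t : R => kappa / 4 * t) (kappa / 4).
  by apply: is_derive_eq; rewrite /GRing.scale/= mulr1.
split => [t|t|t td].
- have := @is_derive1_comp _ Y (fun t : R => kappa / 4 * t) t _ _ (dY _) (dlin t).
  by move/(@is_derive_eq _ _ _ _ _ _ _ _); apply; rewrite mulrC.
- apply: cvgM; first exact: cvg_cst.
  apply: (@continuous_comp _ _ _ (fun t : R => kappa / 4 * t) Y1); last exact: cY1.
  by apply: cvgM; [exact: cvg_cst|exact: cvg_id].
have dt : d < kappa / 4 * t.
  by move: td; rewrite ltr_pdivrMr// => td; lra.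
have := @is_derive1_comp _ (fun z => z * Y1 z) (fun t : R => kappa / 4 * t) t _ _ (dY1 _ dt) (dlin t).
have -> : (fun z : R => z * Y1 z) \o (fun t : R => kappa / 4 * t) =
    (fun t : R => t * (kappa / 4 * Y1 (kappa / 4 * t))).
  by apply/funext => z /=; ring.
by move/(@is_derive_eq _ _ _ _ _ _ _ _); apply; rewrite mulrC.
Qed.

(** Write z = kappa r^2 / 4 and u = P(z) (C - Psi(z)), a positive combination
    as long as C > Psi(kappa b^2 / 4). The condition on the outer circle gives
    C = Psi(kappa b^2 / 4) + 1 / e(kappa), with e as in the proof, and it is
    met with u > 0 exactly when e(kappa) > 0. The condition on the inner circle
    becomes G(kappa) = 0 for a continuous function G. It is positive for small
    kappa, where e <= 0, and nonpositive for the value k1 of kappa in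
    [linear_barrier], so that the intermediate value theorem applies. *)
Theorem exists_mode (alpha a b : R) : 0 < alpha -> 0 < a -> a < b ->
  exists kappa m U U1, [/\ 0 < kappa, m < a ^+ 2, mode kappa m U U1,
    (forall t, a ^+ 2 <= t <= b ^+ 2 -> 0 < U t) &
    2 * a * U1 (a ^+ 2) = - (alpha * U (a ^+ 2)) /\
    2 * b * U1 (b ^+ 2) = alpha * U (b ^+ 2)].
Proof.
move=> al0 a0 ab; have b0 : 0 < b by exact: lt_trans ab.
have a20 : 0 < a ^+ 2 by rewrite exprn_gt0.
have b20 : 0 < b ^+ 2 by rewrite exprn_gt0.
have ab2 : a ^+ 2 < b ^+ 2 by rewrite ltr_pXn2r ?nnegrE ?ltW.
have [P [Q [dP dQ cQ PQ]]] := @bessel_exists R.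
have cP : continuous P := continuous_of_derive dP.
pose za (k : R) : R := k / 4 * a ^+ 2; pose zb (k : R) : R := k / 4 * b ^+ 2.
have clin (c : R) : continuous (fun k : R => k / 4 * c).
  by move=> k; apply: cvgM; [apply: cvgM; [exact: cvg_id|exact: cvg_cst]|exact: cvg_cst].
have comp (c : R) (h : R -> R) : continuous h -> continuous (fun k : R => h (k / 4 * c)).
  by move=> ch k; apply: (@continuous_comp _ _ _ (fun k : R => k / 4 * c) h); [exact: clin|exact: ch].
have cPQ (c s : R) : continuous (fun k : R => P (k / 4 * c) * (k / 4 * c * Q (k / 4 * c) + s * P (k / 4 * c))).
  move=> k; apply: cvgM; first exact: (comp _ _ cP).
  apply: cvgD; apply: cvgM; [exact: clin|exact: (comp _ _ cQ)|exact: cvg_cst|exact: (comp _ _ cP)].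
(* e and G are written without denominators: up to positive factors they are
   u' - alpha u at b for u = P(z), and u' + alpha u at a for the combination
   that satisfies the outer condition. *)
pose e (k : R) : R := P (zb k) * (zb k * Q (zb k) + (- (alpha * b / 2)) * P (zb k)).
pose g (k : R) : R := P (za k) * (za k * Q (za k) + (alpha * a / 2) * P (za k)).
have ce : continuous e by exact: cPQ.
have cg : continuous g by exact: cPQ.
have g0 k : 0 <= k -> 0 < g k.
  move=> k0; have z0 : 0 <= za k by rewrite !mulr_ge0// ltW.
  have [Pz Qz] := PQ _ z0; apply: mulr_gt0 => //.
  by apply: ltr_wpDl; [exact: mulr_ge0|rewrite mulr_gt0// divr_gt0// mulr_gt0].
pose k1 := 2 * alpha / (b - a) + alpha ^+ 2 + alpha / a.
have k10 : 0 < k1.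
  have ba0 : 0 < b - a by rewrite subr_gt0.
  have h1 : 0 < 2 * alpha / (b - a) by rewrite divr_gt0// mulr_gt0.
  have h2 : 0 < alpha ^+ 2 by rewrite exprn_gt0.
  have h3 : 0 < alpha / a by rewrite divr_gt0.
  by rewrite /k1 addr_gt0// addr_gt0.
have e1 : 0 < e k1.
  have dP1 (z : R) : 0 < z -> is_derive z 1 (fun z => z * Q z) (P z) by move=> _; exact: dQ.
  have Hm := mode_rescale k10 dP cQ dP1.
  have m0 : 4 * 0 / k1 < a ^+ 2 by rewrite mulr0 mul0r.
  have [|w1 [w2 [w10 w20]]] := linear_barrier a0 ab al0 m0 Hm _ (lexx k1).
    move=> t /andP[at1 _]; have [|//] := PQ (k1 / 4 * t).
    by rewrite mulr_ge0 ?divr_ge0 ?(ltW k10)// (le_trans (ltW a20)).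
  have za0 : 0 <= za k1 by rewrite !mulr_ge0// ltW.
  have zb0 : 0 <= zb k1 by rewrite !mulr_ge0// ltW.
  have [Pa Qa] := PQ _ za0; have [Pb Qb] := PQ _ zb0.
  rewrite -/(za k1) -/(zb k1) => H.
  have : 0 < w2 * (2 * b * (k1 / 4 * Q (zb k1)) - alpha * P (zb k1)).
    apply: lt_le_trans H; apply: mulr_gt0 => //; apply: ltr_wpDl; last exact: mulr_gt0.
    by rewrite mulr_ge0// ?mulr_ge0 ?divr_ge0// ltW.
  rewrite pmulr_rgt0// => H2; rewrite /e mulr_gt0//.
  have -> : zb k1 * Q (zb k1) + - (alpha * b / 2) * P (zb k1) =
    b / 2 * (2 * b * (k1 / 4 * Q (zb k1)) - alpha * P (zb k1)).
    by rewrite {1}/zb; field.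
  by rewrite mulr_gt0// divr_gt0.
have midf_half (x : R) : 0 < x -> x / 2 < x by move=> x0; lra.
have [k0 [k00 k01 e0]] : exists k0, [/\ 0 < k0, k0 < k1 & e k0 < 0].
  have e00 : e 0 < 0.
    have [P0 _] := PQ _ (lexx 0).
    rewrite /e /zb !mul0r add0r mulNr mulrN oppr_lt0 !mulr_gt0//.
  have : \forall k \near (0 : R), e k < 0 by exact: (ce 0 _ (lt_nbhsl e00)).
  move=> /nbhs_ballP[d /= d0 Hd]; exists (Num.min (d / 2) (k1 / 2)).
  have m0 : 0 < Num.min (d / 2) (k1 / 2) by rewrite lt_min !divr_gt0.
  split => //; first by rewrite gt_min (midf_half k1)// orbT.
  apply: Hd; rewrite /ball/= sub0r normrN gtr0_norm// gt_min midf_half//.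
(* Below this threshold the integrand of Psi is frozen; kappa r^2 / 4 stays above
   it for kappa >= k0 and r >= a, with a margin. *)
have d0 : 0 < k0 / 8 * a ^+ 2 by rewrite mulr_gt0// divr_gt0.
have [Psi [cPsi Psi_mono HC]] := second_solution dP dQ cQ PQ d0.
pose D (k : R) : R := Psi (zb k) - Psi (za k).
have core k : k0 <= k -> 0 < e k -> exists m U U1, [/\ m < a ^+ 2, mode k m U U1,
    (forall t, a ^+ 2 <= t <= b ^+ 2 -> 0 < U t),
    2 * b * U1 (b ^+ 2) = alpha * U (b ^+ 2) &
    exists2 w : R, 0 < w & 2 * a * U1 (a ^+ 2) + alpha * U (a ^+ 2) =
      w * (g k * (1 + D k * e k) - e k)].
  move=> k0k ek; have kpos : 0 < k by exact: lt_le_trans k0k.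
  have [Y1 [dY cY1 dY1 Y1E]] := HC (Psi (zb k) + (e k)^-1).
  have Hm := mode_rescale kpos dY cY1 dY1.
  have za0 : 0 < za k by rewrite !mulr_gt0.
  have zb0 : 0 < zb k by rewrite !mulr_gt0.
  have [Pa Qa] := PQ _ (ltW za0); have [Pb Qb] := PQ _ (ltW zb0).
  have dza : k0 / 8 * a ^+ 2 < za k by rewrite ltr_pM2r//; lra.
  have dzb : k0 / 8 * a ^+ 2 < zb k.
    by apply: lt_trans dza _; rewrite ltr_pM2l// divr_gt0.
  have Ea := Y1E _ (ltW dza); have Eb := Y1E _ (ltW dzb).
  eexists; eexists; eexists; split; [|exact: Hm|..].
  - by rewrite ltr_pdivrMr//; move: dza; rewrite /za; lra.
  - move=> t /andP[at1 bt1].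
    have t0 : 0 <= k / 4 * t.
      by rewrite mulr_ge0 ?divr_ge0 ?(ltW kpos)// (le_trans (ltW a20)).
    have [Pt _] := PQ _ t0; rewrite mulr_gt0//.
    have : Psi (k / 4 * t) <= Psi (zb k) by apply: Psi_mono; rewrite ler_pM2l// divr_gt0.
    have : 0 < (e k)^-1 by rewrite invr_gt0.
    by move: (Psi _) (Psi _) (_^-1) => x y z; lra.
  - rewrite -/(zb k).
    have -> : 2 * b * (k / 4 * Y1 (zb k)) = 2 / b * (zb k * Y1 (zb k)).
      by rewrite {2}/zb; field; rewrite gt_eqF.
    have X : zb k * Q (zb k) = e k / P (zb k) + alpha * b / 2 * P (zb k).
      by rewrite /e; field; rewrite gt_eqF.
    rewrite Eb X; field.
    by rewrite (gt_eqF b0) (gt_eqF Pb) (gt_eqF ek).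
  - exists (2 / (a * e k * P (za k))); first by apply: divr_gt0 => //; apply: mulr_gt0 => //; exact: mulr_gt0.
    rewrite -/(za k).
    have -> : 2 * a * (k / 4 * Y1 (za k)) = 2 / a * (za k * Y1 (za k)).
      by rewrite {2}/za; field; rewrite gt_eqF.
    have X : za k * Q (za k) = g k / P (za k) - alpha * a / 2 * P (za k).
      by rewrite /g; field; rewrite gt_eqF.
    rewrite Ea X /D; field.
    by rewrite (gt_eqF a0) (gt_eqF Pa) (gt_eqF ek).
(* The positive part of e makes G continuous on the whole of [k0, k1]; at a zero
   of G it cannot vanish, since g > 0. *)
pose G (k : R) : R := g k * (1 + D k * Num.max (e k) 0) - Num.max (e k) 0.
have cmax : continuous (fun k : R => Num.max (e k) 0).
  by move=> k; apply: (@continuous_max _ _ e (fun=> 0)); [exact: ce|exact: cvg_cst].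
have cG : continuous G.
  move=> k; apply: cvgB; last exact: cmax.
  apply: cvgM; first exact: cg.
  apply: cvgD; first exact: cvg_cst.
  apply: cvgM; last exact: cmax.
  by apply: cvgB; exact: (comp _ _ cPsi).
have G0 : 0 < G k0 by rewrite /G max_r ?(ltW e0)// mulr0 addr0 mulr1 subr0 g0// ltW.
have G1 : G k1 <= 0.
  have [m [U [U1 [ma Hm Upos Ub [w w0 Ua]]]]] := core k1 (ltW k01) e1.
  have [w1 [w2 [w10 w20]]] := linear_barrier a0 ab al0 ma Hm Upos (lexx k1).
  rewrite Ua Ub subrr mulr0 pmulr_rle0// pmulr_rle0//.
  by rewrite /G max_l// ltW.
have [k /andP[] kk0 kk1 Gk] : exists2 k, k \in `[k0, k1] & G k = 0.
  apply: IVT; [exact: ltW|exact: continuous_subspaceT|].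
  by rewrite ge_min le_max G1 (ltW G0) orbT.
rewrite bnd_simp in kk0.
have ek : 0 < e k.
  rewrite ltNge; apply/negP => ek; move: Gk; rewrite /G max_r// mulr0 addr0 mulr1 subr0 => gk.
  by have := g0 k; rewrite gk ltxx => /(_ (ltW (lt_le_trans k00 kk0))).
have [m [U [U1 [ma Hm Upos Ub [w w0 Ua]]]]] := core k kk0 ek.
exists k, m, U, U1; split => //; first exact: lt_le_trans kk0.
split => //; apply/eqP; rewrite -subr_eq0 opprK Ua.
by move: Gk; rewrite /G max_l ?(ltW ek)// => ->; rewrite mulr0.
Qed.

End Existence.

(** * The eigenvalue as a function of the outer radius *)

Section Squeeze.
Variable R : realType.

(** The error M c^2 is of second order because c vanishes at x. *)
Lemma is_derive_squeeze (u c : R -> R) (x l d M : R) : is_derive x 1 c d -> c x = 0 ->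
  (\forall y \near x, `|u y - (l + c y)| <= M * c y ^+ 2) -> is_derive x 1 u d.
Proof.
move=> dc cx0 H; have M0 : 0 <= Num.max M 0 by rewrite le_max lexx orbT.
have {}H : \forall y \near x, `|u y - (l + c y)| <= Num.max M 0 * c y ^+ 2.
  by apply: filterS H => y /le_trans; apply; rewrite ler_wpM2r ?sqr_ge0// le_max lexx.
move: (Num.max M 0) M0 H => {}M M0 H.
have ux : u x = l.
  have := nbhs_singleton H; rewrite cx0 expr0n mulr0 normr_le0 addr0 => /eqP e; lra.
apply: is_derive_eps => e e0; have e20 : 0 < e / 2 by rewrite divr_gt0.
have [k1 k10 H1] := eps_is_derive dc ltr01.
have [k2 k20 H2] := eps_is_derive dc e20.
move: H => /nbhs_ballP[k3 /= k30 H3].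
pose S := M * (`|d| + 1) ^+ 2 + 1.
have S0 : 0 < S by rewrite ltr_wpDl// mulr_ge0// sqr_ge0.
exists (Num.min (Num.min k1 k2) (Num.min k3 (e / 2 / S))).
  by rewrite !lt_min k10 k20 k30 divr_gt0.
move=> h h0; rewrite !lt_min => /andP[/andP[hk1 hk2] /andP[hk3 hS]].
have hn : 0 < `|h| by rewrite normr_gt0.
have e1 := H1 h h0 hk1; have e2 := H2 h h0 hk2.
rewrite /GRing.scale/= mulr1 cx0 subr0 in e1 e2 *.
have e3 : `|u (h + x) - (l + c (h + x))| <= M * c (h + x) ^+ 2.
  by apply: H3; rewrite /ball/= opprD addrCA subrr addr0 normrN.
rewrite ux; set w := u (h + x) - (l + c (h + x)) in e3.
have -> : d - h^-1 * (u (h + x) - l) = (d - h^-1 * c (h + x)) - h^-1 * w.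
  by rewrite /w; ring.
apply: le_trans (ler_normB _ _) _; rewrite [leRHS](splitr e) lerD//.
have ch : `|c (h + x)| <= (`|d| + 1) * `|h|.
  have -> : c (h + x) = (d - (d - h^-1 * c (h + x))) * h by field.
  rewrite normrM ler_wpM2r//; apply: le_trans (ler_normB _ _) _.
  by rewrite lerD2l.
rewrite normrM normfV ler_pdivrMl//; apply: le_trans e3 _.
rewrite -[c (h + x) ^+ 2]real_normK ?num_real//.
have ch2 : `|c (h + x)| ^+ 2 <= ((`|d| + 1) * `|h|) ^+ 2.
  by rewrite ler_sqr ?nnegrE// mulr_ge0// addr_ge0.
apply: le_trans (ler_wpM2l M0 ch2) _.
have -> : M * ((`|d| + 1) * `|h|) ^+ 2 = `|h| * (M * (`|d| + 1) ^+ 2 * `|h|) by ring.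
rewrite ler_pM2l//; apply: (@le_trans _ _ (S * `|h|)).
  by rewrite ler_wpM2r// lerDl.
by rewrite mulrC -ler_pdivlMr// ltW.
Qed.

End Squeeze.

Section Growth.
Variable R : realType.
Local Notation mu := (@lebesgue_measure R).
Local Notation rT := (measurableTypeR R).

Lemma mode_mass (a : R) (U : R -> R) : continuous U -> exists N : R -> R,
  [/\ continuous (fun r : R => r * U (r ^+ 2) ^+ 2),
      forall r : R, is_derive r 1 N (r * U (r ^+ 2) ^+ 2) & N a = 0].
Proof.
move=> cU; have c : continuous (fun r : R => r * U (r ^+ 2) ^+ 2).
  have cq := continuous_sq_comp cU.
  by move=> r; apply: cvgM; [exact: cvg_id|apply: cvgM; exact: cq].
have [F dF] := global_antiderivative c.
exists (fun r => F r - F a); split => //; last by rewrite subrr.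
by move=> r; have d := dF r; apply: is_derive_eq; rewrite subr0.
Qed.

Section WithMode.
Variables (alpha kappa a m : R) (U U1 N : R -> R).
Hypotheses (a0 : 0 < a) (al0 : 0 <= alpha) (ma : m < a ^+ 2).
Hypothesis Umode : mode kappa m U U1.
Hypothesis Ua : 2 * a * U1 (a ^+ 2) = - (alpha * U (a ^+ 2)).
Hypothesis cN : continuous (fun r : R => r * U (r ^+ 2) ^+ 2).
Hypothesis dN : forall r : R, is_derive r 1 N (r * U (r ^+ 2) ^+ 2).
Hypothesis Na : N a = 0.

(** The quantity r u u' for u(r) = U(r^2). *)
Definition flux (r : R) : R := 2 * (r ^+ 2 * U1 (r ^+ 2)) * U (r ^+ 2).
(** It measures by how much u fails the Robin condition on the circle of radius
    r: it is r u^2 (u' / u - alpha). *)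
Definition boundary_excess (r : R) : R := flux r - alpha * r * U (r ^+ 2) ^+ 2.
Definition excess_quotient (r : R) : R := boundary_excess r / N r.

Lemma derive_U (r : R) : is_derive r 1 (fun s => U (s ^+ 2)) (2 * r * U1 (r ^+ 2)).
Proof. by have [dU _ _] := Umode; exact: is_derive_sq_comp. Qed.

Lemma derive_weight (r : R) : is_derive r 1 (fun s => s * U (s ^+ 2) ^+ 2)
  (U (r ^+ 2) ^+ 2 + 4 * r ^+ 2 * U1 (r ^+ 2) * U (r ^+ 2)).
Proof.
by have d := derive_U r; apply: is_derive_eq; rewrite /GRing.scale/=; ring.
Qed.

Lemma derive_flux (r : R) : a <= r ->
  is_derive r 1 flux (kappa * r * U (r ^+ 2) ^+ 2 + r * (4 * r ^+ 2 * U1 (r ^+ 2) ^+ 2)).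
Proof.
move=> ar; have [dU _ dU1] := Umode; have d1 := derive_U r.
have mr : m < r ^+ 2.
  by apply: lt_le_trans ma _; rewrite ler_pXn2r ?nnegrE ?(ltW a0)// (le_trans (ltW a0)).
have d2 := @is_derive_sq_comp _ (fun t => t * U1 t) (fun t => kappa / 4 * U t) r (dU1 _ mr).
by apply: is_derive_eq; rewrite /GRing.scale/=; field.
Qed.

Lemma flux_a : flux a = - (alpha * a * U (a ^+ 2) ^+ 2).
Proof.
rewrite /flux (_ : 2 * (a ^+ 2 * U1 (a ^+ 2)) = a * (2 * a * U1 (a ^+ 2))); last by ring.
by rewrite Ua; ring.
Qed.

(** Test with u on the ring of outer radius b. Since (r u u')' = r u'^2 + kappa
    r u^2, its quotient is -kappa plus the excess of the boundary term over the
    mass. *)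
Lemma upper_estimate (b : R) : a < b -> 0 < N b ->
  (robin_lambda1 alpha (annulus a b) <= (- kappa + excess_quotient b)%:E)%E.
Proof.
move=> ab N0; have [dU cU1 _] := Umode.
pose phi (r : R) : R := r * (4 * r ^+ 2 * U1 (r ^+ 2) ^+ 2).
have cphi : continuous phi.
  have cq := continuous_sq_comp cU1.
  move=> r; apply: cvgM; first exact: cvg_id.
  apply: cvgM; last by apply: cvgM; exact: cq.
  by apply: cvgM; [exact: cvg_cst|apply: cvgM; exact: cvg_id].
have IN := integral_derivative ab cN (fun r _ => dN r).
have ID : (\int[mu]_(r in (`]a, b[%classic : set rT)) (phi r)%:E =
    ((flux b - kappa * N b) - (flux a - kappa * N a))%:E)%E.
  apply: (@integral_derivative R (fun r => flux r - kappa * N r)) => // r /andP[ar _].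
  have d1 := derive_flux ar; have d2 := dN r.
  by apply: is_derive_eq; rewrite /phi /GRing.scale/=; ring.
have Nba : 0 < N b - N a by rewrite Na subr0.
apply: le_trans (robin_upper_bound dU cU1 alpha a0 ab Nba IN ID) _.
rewrite lee_fin Na flux_a /excess_quotient /boundary_excess le_eqVlt; apply/orP; left; apply/eqP.
by field; rewrite gt_eqF.
Qed.

(** Correct the Riccati solution f = u' / u into F = f - c h, with h = N / (r
    u^2) and c the excess quotient at b. Since h(a) = 0 the inner condition is
    kept, and c is such that F(b) = alpha. As h' = 1 - h (1 / r + 2 f), one
    finds F' + F^2 + F / r = kappa - c + c^2 h^2, so F is a supersolution for a
    constant that differs from the upper estimate by M c^2 only. *)
Lemma lower_estimate (b M : R) : a < b -> 0 < N b ->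
  (forall r, a <= r <= b -> 0 < U (r ^+ 2)) ->
  (forall r, a <= r <= b -> (N r / (r * U (r ^+ 2) ^+ 2)) ^+ 2 <= M) ->
  0 <= kappa - excess_quotient b + M * excess_quotient b ^+ 2 ->
  ((- (kappa - excess_quotient b + M * excess_quotient b ^+ 2))%:E <= robin_lambda1 alpha (annulus a b))%E.
Proof.
move=> ab N0 Upos HM K0; set c := excess_quotient b in K0 *.
pose F r := (flux r - c * N r) / (r * U (r ^+ 2) ^+ 2).
pose h r := N r / (r * U (r ^+ 2) ^+ 2).
pose F' r := kappa - c + c ^+ 2 * h r ^+ 2 - F r ^+ 2 - F r / r.
apply: (@robin_lower_bound R alpha _ a b F) => //; exists F'; split.
- move=> r /[dup] rab /andP[ar rb]; have r0 : 0 < r by exact: lt_le_trans ar.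
  have Ur := Upos r rab; have d0 : r * U (r ^+ 2) ^+ 2 != 0 by rewrite gt_eqF// mulr_gt0// exprn_gt0.
  have d1 := derive_flux ar; have d2 := dN r.
  have d3 := @is_deriveV R (fun s : R => s * U (s ^+ 2) ^+ 2) r _ 1 d0 (derive_weight r).
  apply: is_derive_eq; rewrite /F' /F /h /flux /GRing.scale/=; field.
  by rewrite (gt_eqF r0) (gt_eqF Ur).
- move=> r rab; have -> : F' r + F r ^+ 2 + F r / r = kappa - c + c ^+ 2 * h r ^+ 2.
    by rewrite /F'; ring.
  by rewrite lerD2l [leRHS]mulrC ler_wpM2l ?sqr_ge0// HM.
- have aab : a <= a <= b by rewrite lexx ltW.
  have Ur := Upos a aab.
  rewrite /F Na mulr0 subr0 flux_a le_eqVlt; apply/orP; left; apply/eqP.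
  by field; rewrite (gt_eqF a0) (gt_eqF Ur).
- have bab : a <= b <= b by rewrite lexx ltW.
  have Ur := Upos b bab; have b0 := lt_trans a0 ab.
  rewrite /F /c /excess_quotient divfK ?(gt_eqF N0)// /boundary_excess le_eqVlt; apply/orP; left; apply/eqP.
  by field; rewrite (gt_eqF b0) (gt_eqF Ur).
Qed.

Lemma derive_excess_quotient (b : R) : a <= b -> N b != 0 -> 2 * b * U1 (b ^+ 2) = alpha * U (b ^+ 2) ->
  excess_quotient b = 0 /\
  is_derive b 1 excess_quotient (b * U (b ^+ 2) ^+ 2 * (kappa - (alpha ^+ 2 + alpha / b)) / N b).
Proof.
move=> ab Nb Ub; have b0 : 0 < b by exact: lt_le_trans ab.
have U1b : U1 (b ^+ 2) = alpha * U (b ^+ 2) / (2 * b).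
  by rewrite -Ub; field; rewrite gt_eqF.
have d0 : boundary_excess b = 0 by rewrite /boundary_excess /flux U1b; field; rewrite gt_eqF.
split; first by rewrite /excess_quotient d0 mul0r.
have d1 := derive_flux ab; have d2 := dN b; have d3 := derive_U b.
have d4 : is_derive b 1 boundary_excess (kappa * b * U (b ^+ 2) ^+ 2 + b * (4 * b ^+ 2 * U1 (b ^+ 2) ^+ 2)
   - alpha * (U (b ^+ 2) ^+ 2 + 4 * b ^+ 2 * U1 (b ^+ 2) * U (b ^+ 2))).
  by apply: is_derive_eq; rewrite /GRing.scale/=; ring.
have d5 := is_deriveV Nb d2.
apply: is_derive_eq; rewrite d0 /GRing.scale/= mul0r add0r U1b; field.
by rewrite (gt_eqF b0) Nb.
Qed.

End WithMode.
End Growth.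

Section Main.
Variable R : realType.

(** The mode u of the ring of outer radius b also gives two-sided bounds for
    nearby outer radii s: the eigenvalue is -kappa + c(s) up to M c(s)^2, where
    c vanishes at b. Hence its derivative at b is c'(b), which has the sign of
    kappa - alpha^2 - alpha / b. If this were nonpositive, [constant_barrier]
    would force u' >= alpha u on the inner circle, where u' = -alpha u. *)
Theorem lambda1_growth (alpha a b : R) : 0 < alpha -> 0 < a -> a < b ->
  robin_lambda1 alpha (annulus a b) \is a fin_num /\
  exists2 d : R, 0 < d &
    is_derive b 1 (fun s : R => fine (robin_lambda1 alpha (annulus a s))) d.
Proof.
move=> al0 a0 ab; have b0 : 0 < b by exact: lt_trans ab.
have [kappa [m [U [U1 [k0 ma Hm Upos [Ua Ub]]]]]] := exists_mode al0 a0 ab.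
have [dU _ _] := Hm.
have cU : continuous U := continuous_of_derive dU.
have cUq := continuous_sq_comp cU.
have [N [cN dN Na]] := mode_mass a cU.
have UaE : 0 < U (a ^+ 2) by apply: Upos; rewrite lexx ler_pXn2r ?nnegrE ?ltW.
have UbE : 0 < U (b ^+ 2) by apply: Upos; rewrite lexx ler_pXn2r ?nnegrE ?ltW.
(* The mode stays positive slightly beyond b. *)
have [e /= e0 He] : exists2 e : R, 0 < e & forall r : R, `|b - r| < e -> 0 < U (r ^+ 2).
  have : \forall r \near b, 0 < U (r ^+ 2) by exact: (cUq b _ (lt_nbhsr UbE)).
  by move=> /nbhs_ballP[e /= e0 He]; exists e.
pose B := b + e / 2; have bB : b < B by rewrite ltrDl divr_gt0.
have UB r : a <= r <= B -> 0 < U (r ^+ 2).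
  move=> /andP[ar rB]; have [rb|br] := leP r b.
    by apply: Upos; rewrite sq_itv// ar.
  apply: He; rewrite ltr_norml; move: rB br e0; rewrite /B => rB br e0.
  by apply/andP; split; lra.
have N0 s : a < s -> s <= B -> 0 < N s.
  move=> as1 sB; rewrite -Na.
  apply: (@incr_cc R N (fun r : R => r * U (r ^+ 2) ^+ 2)) => // r /andP[ar rs].
  apply: mulr_gt0; first exact: lt_le_trans ar.
  by apply: exprn_gt0; apply: UB; rewrite ar (le_trans rs).
pose h (r : R) : R := (N r / (r * U (r ^+ 2) ^+ 2)) ^+ 2.
have aB : a <= B by rewrite ltW// (lt_trans ab).
have [M HM] : exists M : R, forall r, a <= r <= B -> h r <= M.
  have ch : {within `[a, B], continuous h}.
    apply: derivable_within_continuous => r; rewrite in_itv/= => /[dup] rab /andP[ar _].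
    have Ur := UB r rab; have r0 := lt_le_trans a0 ar.
    have d0 : r * U (r ^+ 2) ^+ 2 != 0 by rewrite gt_eqF// mulr_gt0// exprn_gt0.
    have d1 := dN r; have d2 := derive_weight Hm r.
    have d3 := @is_deriveV R (fun s : R => s * U (s ^+ 2) ^+ 2) r _ 1 d0 d2.
    exact: ex_derive.
  have [c _ Hc] := EVT_max aB ch.
  by exists (h c) => r rab; apply: Hc; rewrite in_itv.
have M0 : 0 <= M.
  have aaB : a <= a <= B by rewrite lexx.
  exact: le_trans (sqr_ge0 _) (HM a aaB).
have Nb : N b != 0 by rewrite gt_eqF// N0// ltW.
pose c := excess_quotient alpha U U1 N.
have [cb dc] := derive_excess_quotient a0 ma Hm dN (ltW ab) Nb Ub.
have kd : alpha ^+ 2 + alpha / b < kappa.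
  rewrite ltNge; apply/negP => kle.
  have [w1 [w2 [w10 w20]]] := constant_barrier a0 ab al0 ma Hm Upos kle.
  rewrite Ub subrr mulr0 Ua -opprD leNgt => /negP; apply.
  by rewrite mulrN oppr_lt0 mulr_gt0// addr_gt0// mulr_gt0.
have cc : {for b, continuous c} := is_derive_continuous dc.
(* The lower estimate requires a nonnegative constant, which holds once c < kappa. *)
have near_est : \forall s \near b,
    ((- kappa + c s - M * c s ^+ 2)%:E <= robin_lambda1 alpha (annulus a s) <= (- kappa + c s)%:E)%E.
  have ck : \forall s \near b, c s < kappa.
    by apply: (cc _ (lt_nbhsl _)); rewrite /c cb.
  near=> s.
  have as1 : a < s by near: s; exact: lt_nbhsr.
  have sB : s <= B by apply: ltW; near: s; exact: lt_nbhsl.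
  have Ns := N0 s as1 sB.
  rewrite (upper_estimate a0 ma Hm Ua cN dN Na as1 Ns) andbT.
  have -> : - kappa + c s - M * c s ^+ 2 = - (kappa - c s + M * c s ^+ 2) by ring.
  apply: (lower_estimate a0 (ltW al0) ma Hm Ua dN Na as1 Ns) => [r /andP[ar rs]|r /andP[ar rs]|].
  - by apply: UB; rewrite ar (le_trans rs).
  - by apply: HM; rewrite ar (le_trans rs).
  - apply: addr_ge0; last by rewrite mulr_ge0// sqr_ge0.
    by rewrite subr_ge0 ltW//; near: s.
have fin_of (x y : R) (l : \bar R) : (x%:E <= l <= y%:E)%E -> l \is a fin_num.
  by move=> /andP[xl ly]; rewrite fin_numElt (lt_le_trans (ltNyr x) xl) (le_lt_trans ly (ltry y)).
split; first exact: fin_of (nbhs_singleton near_est).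
exists (b * U (b ^+ 2) ^+ 2 * (kappa - (alpha ^+ 2 + alpha / b)) / N b).
  rewrite divr_gt0 ?N0 ?(ltW bB)//; apply: mulr_gt0; last by rewrite subr_gt0.
  by rewrite mulr_gt0// exprn_gt0.
apply: (@is_derive_squeeze R _ c b (- kappa) _ M dc cb).
apply: filterS near_est => s /[dup] /fin_of lf; rewrite -(fineK lf) !lee_fin => /andP[h1 h2].
have q0 : 0 <= M * c s ^+ 2 by rewrite mulr_ge0// sqr_ge0.
by rewrite ler_norml; apply/andP; split; lra.
Unshelve. all: by end_near. Qed.

End Main.

Theorem theorem1 (R : realType) (alpha r1 r2 : R)
    (halpha : 0 < alpha) (hr1 : 0 < r1) (hr12 : r1 < r2) :
  (exists d : R,
     is_shape_derivative (robin_lambda1 alpha) (annulus r1 r2) (V1 r1 r2) d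
     /\ 0 < d) /\
  (forall r2' : R, r2 < r2' ->
     (robin_lambda1 alpha (annulus r1 r2)
        < robin_lambda1 alpha (annulus r1 r2'))%E).
Proof.
have growth s : r1 < s -> robin_lambda1 alpha (annulus r1 s) \is a fin_num /\
    exists2 d : R, 0 < d &
      is_derive s 1 (fun s : R => fine (robin_lambda1 alpha (annulus r1 s))) d.
  exact: lambda1_growth.
split.
  have [_ [d d0 dl]] := growth r2 hr12; exists d; split => //.
  split; first exact: V1_extension.
  move=> Vh /(deform_annulus hr1 hr12) deformE; split.
    near=> t; have -> : deform Vh t (annulus r1 r2) = annulus r1 (r2 + t) by near: t.
    suff rt : r1 < r2 + t by have [] := growth _ rt.
    by rewrite -ltrBlDl; near: t; apply: lt_nbhsr; rewrite subr_lt0.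
  have dt : is_derive (0 : R) 1 (fun t : R => r2 + t) 1 by apply: is_derive_eq; rewrite add0r mulr1.
  have dl0 : is_derive (r2 + 0) 1 (fun s : R => fine (robin_lambda1 alpha (annulus r1 s))) d.
    by rewrite addr0.
  have := @is_derive1_comp _ (fun s : R => fine (robin_lambda1 alpha (annulus r1 s)))
    (fun t : R => r2 + t) 0 _ _ dl0 dt.
  move=> /(@is_derive_eq _ _ _ _ _ _ _ _)/(_ (mulr1 d)).
  apply: near_eq_is_derive; near=> t => /=; congr (fine (robin_lambda1 _ _)).
  by apply/esym; near: t.
move=> s rs; have [f1 _] := growth r2 hr12; have [f2 _] := growth s (lt_trans hr12 rs).
rewrite -(fineK f1) -(fineK f2) lte_fin.
pose l (s : R) : R := fine (robin_lambda1 alpha (annulus r1 s)).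
apply: (@incr_cc R l (fun x : R => 'D_1 l x)) => // x /andP[rx _];
  have [_ [d d0 dl]] := growth x (lt_le_trans hr12 rx).
- by have [D _] := dl; exact: derivableP.
- by rewrite derive_val.
Unshelve. all: by end_near. Qed.
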